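(* Let $g:[-1,1]\to\mathbb{R}$ and $\psi:\mathcal{M}_+\to\mathbb{R}$ satisfy: (H1) $g$ is continuously differentiable and there is $m>0$ with $g(x)\ge m$ for all $x\in[-1,1]$; (H2) $|\psi(\mu)-\psi(\nu)|\le \|\psi\|_{\mathrm{Lip},\mathrm{TV}}\,\mathrm{TV}(\mu,\nu)$ for all $\mu,\nu\in\mathcal{M}_+$; (H3) there exists $a>0$ such that for every integer $K\ge1$, $\nabla\psi^{(K)}\in L^\infty(\mathbb{R}_{\ge0}^{D_K};\mathcal{K}_{a,K}')$. Then for every integer $K\ge 1$ and every $R>0$, the Hamilton-Jacobi equation $$\partial_t f(t,x)=\mathsf{H}_{K,R}\big(\nabla f(t,x)\big)\quad\text{on } \mathbb{R}_{>0}\times\mathbb{R}_{>0}^{D_K}$$ admits a unique viscosity solution $f_R^{(K)}\in\mathfrak{L}_{\mathrm{unif}}$ subject to the initial condition $f_R^{(K)}(0,\cdot)=\psi^{(K)}$ on $\mathbb{R}_{\ge0}^{D_K}$. Moreover, $f^{(K)}_R$ has its gradient in the set $\mathcal{K}_{a,K}'$ and $$\sup_{t>0}\|f_R^{(K)}(t,\cdot)\|_{\mathrm{Lip},1}=\|\psi^{(K)}\|_{\mathrm{Lip},1}\le\|\psi\|_{\mathrm{Lip},\mathrm{TV}}.$$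
   Context: $\mathcal{M}_+$ is the set of finite non-negative measures on $[-1,1]$, and $\mathrm{TV}(\mu,\nu)=\sup_A|\mu(A)-\nu(A)|$ over measurable $A\subset[-1,1]$. $\|\psi\|_{\mathrm{Lip},\mathrm{TV}}$ denotes the corresponding Lipschitz constant. For an integer $K\ge1$, $D_K=\{i/2^K: i\in\mathbb{Z},\ -2^K\le i<2^K\}$, so $|D_K|=2^{K+1}$; vectors in $\mathbb{R}^{D_K}$ are indexed by $D_K$. For $x\in\mathbb{R}_{\ge0}^{D_K}$ let $\mu_x^{(K)}=\frac1{|D_K|}\sum_{k\in D_K}x_k\delta_k$, and $\psi^{(K)}(x)=\psi(\mu_x^{(K)})$. Let $G^{(K)}=|D_K|^{-2}(g(kk'))_{k,k'\in D_K}$. Normalized norms on $\mathbb{R}^d$ (with $d=|D_K|$ for $\mathbb{R}^{D_K}$): $\|x\|_1=\frac1d\sum_k|x_k|$ and $\|y\|_{1,*}=\max_k d|y_k|$. For $h:\mathbb{R}_{\ge0}^d\to\mathbb{R}$, $\|h\|_{\mathrm{Lip},1}=\sup_{x\ne x'}|h(x)-h(x')|/\|x-x'\|_1$. Inequalities between vectors are coordinatewise. $\mathcal{K}_{a,K}=\{G^{(K)}x: x\in\mathbb{R}_{\ge0}^{D_K},\ \|x\|_1\le a\}$ and $\mathcal{K}_{a,K}'=\{y+w: y\in\mathcal{K}_{a,K},\ \|w\|_{1,*}\le|D_K|^{-1/2}\}$. A Lipschitz function on $\mathbb{R}_{\ge0}^d$ has its gradient in a closed convex set $\mathcal{K}$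 if its (a.e. defined) gradient lies in $\mathcal{K}$ almost everywhere; for a function of $(t,x)$ this refers to the gradient in $x$ at each $t$. The non-linearity: $\mathcal{C}_K=\{G^{(K)}x: x\in\mathbb{R}_{\ge0}^{D_K}\}$ and $\mathsf{C}_K:\mathcal{C}_K\to\mathbb{R}$, $\mathsf{C}_K(G^{(K)}x)=\frac12 G^{(K)}x\cdot x$ (well-defined). For $R>0$ define $\widetilde{\mathsf C}_{K,R}:\mathcal{C}_K\to\mathbb{R}$ by $\widetilde{\mathsf C}_{K,R}(y)=\max\big(\mathsf{C}_K(y),\frac{8R}{m}(\|y\|_{1,*}-R)\big)$ if $\|y\|_{1,*}\le2R$ and $\widetilde{\mathsf C}_{K,R}(y)=\frac{8R}{m}(\|y\|_{1,*}-R)$ otherwise, and $\mathsf{H}_{K,R}:\mathbb{R}^{D_K}\to\mathbb{R}$ by $\mathsf{H}_{K,R}(y)=\inf\{\widetilde{\mathsf C}_{K,R}(w): w\in\mathcal{C}_K,\ w\ge y\}$. (This is a non-decreasing, Lipschitz extension of $\mathsf{C}_K$ restricted to $\mathcal{C}_K\cap\{\|y\|_{1,*}\le R\}$.) Function spaces: for $u:[0,\infty)\times\mathbb{R}_{\ge0}^d\to\mathbb{R}$, $[u]_0=\sup_{t>0,x}|u(t,x)-u(0,x)|/t$; $\mathfrak{L}$ is the set of such $u$ with $u(0,\cdot)$ Lipschitz and $[u]_0<\infty$; $\mathfrak{L}_{\mathrm{unif}}=\{u\in\mathfrak{L}:\sup_{t\ge0}\|u(t,\cdot)\|_{\mathrm{Lip},1}<\infty\}$.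 Viscosity solutions: a continuous function $f$ is a viscosity solution of $\partial_tf=\mathsf{H}(\nabla f)$ on $\mathbb{R}_{>0}\times\mathbb{R}_{>0}^d$ if for every $\phi\in C^\infty((0,\infty)\times\mathbb{R}_{>0}^d)$ and $(t^*,x^* )\in(0,\infty)\times\mathbb{R}_{>0}^d$: $(\partial_t\phi-\mathsf{H}(\nabla\phi))(t^*,x^* )\le0$ whenever $f-\phi$ has a local maximum at $(t^*,x^* )$, and $(\partial_t\phi-\mathsf{H}(\nabla\phi))(t^*,x^* )\ge0$ whenever $f-\phi$ has a local minimum at $(t^*,x^* )$. *)

(* Defs.v *)
From HB Require Import structures.
From mathcomp Require Import all_boot all_order all_algebra.
From mathcomp Require Import all_classical all_reals all_analysis.
From mathcomp Require Import ring.

Set Implicit Arguments.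
Unset Strict Implicit.
Unset Printing Implicit Defensive.
Import Order.TTheory GRing.Theory Num.Theory.
Import numFieldNormedType.Exports.
Local Open Scope classical_set_scope.
Local Open Scope ring_scope.

(* Functions on R_{>=0}^d (resp. [0, +oo[ x R_{>=0}^d, [-1, 1]) are represented
   by total functions on 'rV[R]_d (resp. R -> 'rV[R]_d -> R, R -> R) whose
   values outside the domain are never used. *)

Section interval.
Variable R : realType.

Definition itv11 := {x : R | -1 <= x <= 1}.

Fact itv11_0 : -1 <= (0 : R) <= 1.
Proof. by rewrite oppr_le0 !ler01. Qed.

HB.instance Definition _ := Choice.on itv11.
HB.instance Definition _ := isPointed.Build itv11 (exist _ 0 itv11_0).

(* [-1, 1] with the trace of the Borel sigma-algebra of R. *)
Definition borel11 :=
  g_sigma_algebra_preimageType (fun x : itv11 => sval x : measurableTypeR R).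

(* One-sided derivatives at the endpoints. *)
Definition C1_on11 (g : R -> R) :=
  exists g' : R -> R, {within `[(-1), 1], continuous g'} /\
    forall x, -1 <= x <= 1 ->
      (g y - g x) / (y - x) @[y --> within `[(-1), 1] x^'] --> g' x.

End interval.

Notation Mplus R := {finite_measure set (borel11 R) -> \bar R}.

Section total_variation.
Variable R : realType.

Definition TV (mu nu : Mplus R) : R :=
  sup [set `|fine (mu A) - fine (nu A)| | A in measurable].

Definition lipTV (psi : Mplus R -> R) : \bar R :=
  ereal_sup [set r | exists mu nu : Mplus R, TV mu nu != 0 /\
    r = (`|psi mu - psi nu| / TV mu nu)%:E].

(* The inequality is not subsumed by the finiteness of the constant: two terms
   of type Mplus R may agree on measurable sets and yet differ. *)
Definition lipschitzTV (psi : Mplus R -> R) :=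
  (lipTV psi < +oo)%E /\
  forall mu nu : Mplus R,
    ((`|psi mu - psi nu|)%:E <= lipTV psi * (TV mu nu)%:E)%E.

End total_variation.

Section norms.
Variables (R : realType) (d : nat).
Implicit Types (x y : 'rV[R]_d) (h : 'rV[R]_d -> R).

Definition orthant : set 'rV[R]_d := [set x | forall k, 0 <= x 0 k].

Definition dot x y : R := \sum_k x 0 k * y 0 k.

Definition norm1 x : R := d%:R^-1 * \sum_k `|x 0 k|.

Definition norm1dual y : R := \big[Num.max/0]_k (d%:R * `|y 0 k|).

Definition lip1 h : \bar R :=
  ereal_sup [set r | exists x x', [/\ orthant x, orthant x', x != x' &
    r = (`|h x - h x'| / norm1 (x - x'))%:E]].

(* Null sets for the Lebesgue measure of R^d. *)
Definition lebesgue_null (N : set 'rV[R]_d) :=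
  forall e : R, 0 < e -> exists l u : nat -> 'rV[R]_d,
    [/\ forall n k, l n 0 k <= u n 0 k,
        N `<=` \bigcup_n [set x | forall k, l n 0 k <= x 0 k <= u n 0 k] &
        (\sum_(0 <= n <oo) (\prod_k (u n 0 k - l n 0 k))%:E <= e%:E)%E].

Definition gradient h x : 'rV[R]_d := \row_k 'D_(delta_mx 0 k) h x.

Definition gradient_in h (S : set 'rV[R]_d) :=
  lebesgue_null (orthant `\` [set x | differentiable h x /\ S (gradient h x)]).

End norms.

Arguments orthant {R d}.

Section viscosity.
Variables (R : realType) (d : nat).
Local Notation V := (R * 'rV[R]_d)%type.

Definition closed_domain : set V := [set p : V | 0 <= p.1 /\ orthant p.2].

Definition open_domain : set V :=
  [set p : V | 0 < p.1 /\ forall k, 0 < p.2 0 k].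

(* All iterated directional derivatives exist and are continuous. *)
Definition smooth_on (D : set V) (phi : V -> R) :=
  forall (s : seq V) (p : V), D p ->
    let dphi : V -> R := foldr (fun v h => 'D_v h) phi s in
    {for p, continuous dphi} /\ forall v, derivable dphi p v.

Definition dt (phi : V -> R) (p : V) : R := 'D_(1, 0) phi p.

Definition dx (phi : V -> R) (p : V) : 'rV[R]_d :=
  \row_k 'D_(0, delta_mx 0 k) phi p.

Definition viscosity_solution (H : 'rV[R]_d -> R) (f : R -> 'rV[R]_d -> R) :=
  {within closed_domain, continuous (fun p : V => f p.1 p.2)} /\
  forall (phi : V -> R) (q : V), smooth_on open_domain phi -> open_domain q ->
    ((\forall p \near q, f p.1 p.2 - phi p <= f q.1 q.2 - phi q) ->
       dt phi q - H (dx phi q) <= 0) /\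
    ((\forall p \near q, f q.1 q.2 - phi q <= f p.1 p.2 - phi p) ->
       0 <= dt phi q - H (dx phi q)).

Definition time_seminorm (u : R -> 'rV[R]_d -> R) : \bar R :=
  ereal_sup [set r | exists t x, [/\ 0 < t, orthant x &
    r = (`|u t x - u 0 x| / t)%:E]].

Definition frakL (u : R -> 'rV[R]_d -> R) :=
  (lip1 (u 0%R) < +oo)%E /\ (time_seminorm u < +oo)%E.

Definition frakL_unif (u : R -> 'rV[R]_d -> R) :=
  frakL u /\ (ereal_sup [set lip1 (u t) | t in [set t | (0 <= t)%R]] < +oo)%E.

Definition HJ_solution (H : 'rV[R]_d -> R) (u0 : 'rV[R]_d -> R)
    (f : R -> 'rV[R]_d -> R) :=
  [/\ viscosity_solution H f, frakL_unif f &
      forall x, orthant x -> f 0 x = u0 x].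

End viscosity.

Section dyadic.
Variables (R : realType) (K : nat).

Definition dimK := (2 ^ K.+1)%N.

(* Increasing enumeration of D_K = {i / 2^K : -2^K <= i < 2^K}. *)
Definition dyadic (i : 'I_dimK) : R := (i%:R - 2 ^+ K) / 2 ^+ K.

Fact dyadic_itv i : -1 <= dyadic i <= 1.
Proof.
have K0 : 0 < (2 : R) ^+ K by rewrite exprn_gt0.
rewrite ler_pdivlMr// ler_pdivrMr// mulN1r mul1r lerBrDr addNr ler0n/=.
rewrite lerBlDr -mulr2n -[leRHS]mulr_natl -exprS -natrX ler_nat.
exact/ltnW/ltn_ord.
Qed.

Definition dyadic_pt (i : 'I_dimK) : borel11 R := exist _ (dyadic i) (dyadic_itv i).

(* Negative weights are truncated, so that mu_x is a measure for all x; only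
   x in the orthant matter. *)
Definition mu_x (x : 'rV[R]_dimK) (A : set (borel11 R)) : \bar R :=
  ((dimK%:R^-1)%:E *
    \sum_(k < dimK) (Num.max (x 0 k) 0)%:E * \d_(dyadic_pt k) A)%E.

Let mu_x0 x : mu_x x set0 = 0%E.
Proof.
by rewrite /mu_x big1 ?mule0// => k _; rewrite measure0 mule0.
Qed.

Let weight_ge0 (x : 'rV[R]_dimK) k : (0 <= (Num.max (x 0 k) 0)%:E)%E.
Proof. by rewrite lee_fin le_max lexx orbT. Qed.

Let mu_x_ge0 x A : (0 <= mu_x x A)%E.
Proof.
rewrite mule_ge0// ?lee_fin ?invr_ge0// sume_ge0// => k _.
by rewrite mule_ge0.
Qed.

Let mu_x_sigma_additive x : semi_sigma_additive (mu_x x).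
Proof.
pose w k : {nonneg R} := NngNum (weight_ge0 x k).
pose m (n : nat) : {measure set (borel11 R) -> \bar R} :=
  if (insub n : option 'I_dimK) is Some k
  then mscale (w k) \d_(dyadic_pt k) else mzero.
have d0 : 0 <= (dimK%:R^-1 : R) by rewrite invr_ge0.
suff -> : mu_x x = mscale (NngNum d0) (msum m dimK).
  exact: measure_semi_sigma_additive.
apply/funext => A; rewrite /mu_x /mscale /msum /=; congr (_ * _)%E.
by apply: eq_bigr => k _; rewrite /m valK.
Qed.

HB.instance Definition _ x := isMeasure.Build _ _ _ (mu_x x)
  (mu_x0 x) (@mu_x_ge0 x) (@mu_x_sigma_additive x).

Let mu_x_fin x : fin_num_fun (mu_x x).
Proof.
move=> A mA; rewrite fin_numM//.
by apply/sum_fin_numP => k _ _; rewrite fin_numM// fin_num_measure.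
Qed.

HB.instance Definition _ x := Measure_isFinite.Build _ _ _ (mu_x x) (@mu_x_fin x).

Definition psiK (psi : Mplus R -> R) (x : 'rV[R]_dimK) : R := psi (mu_x x).

Variable g : R -> R.

Definition GK : 'M[R]_dimK :=
  \matrix_(i, j) (dimK%:R ^- 2 * g (dyadic i * dyadic j)).

(* The product G^(K) x, written for row vectors. *)
Definition GKx (x : 'rV[R]_dimK) : 'rV[R]_dimK := x *m GK^T.

Definition calK (a : R) : set 'rV[R]_dimK :=
  [set GKx x | x in [set x | orthant x /\ norm1 x <= a]].

Definition calK' (a : R) : set 'rV[R]_dimK :=
  [set y | exists z w, [/\ calK a z,
    norm1dual w <= (Num.sqrt dimK%:R)^-1 & y = z + w]].

Definition coneK : set 'rV[R]_dimK := [set GKx x | x in orthant].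

Definition CK (y : 'rV[R]_dimK) : R :=
  2^-1 * dot y (xget 0 [set x | orthant x /\ GKx x = y]).

Lemma dot_GKxC x x' : dot (GKx x) x' = dot (GKx x') x.
Proof.
rewrite /dot /GKx.
under eq_bigr do rewrite mxE big_distrl/=.
rewrite exchange_big; apply: eq_bigr => i _ /=; rewrite mxE big_distrl/=.
by apply: eq_bigr => j _; rewrite !mxE [dyadic j * _]mulrC; ring.
Qed.

Lemma CKE x : orthant x -> CK (GKx x) = 2^-1 * dot (GKx x) x.
Proof.
move=> x0; rewrite /CK; case: xgetP => [x' _ [_ xx']|/(_ x)]; last by case.
by rewrite dot_GKxC xx'.
Qed.

Definition CKtilde (m r : R) (y : 'rV[R]_dimK) : R :=
  let b := 8 * r / m * (norm1dual y - r) in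
  if norm1dual y <= 2 * r then Num.max (CK y) b else b.

Definition HK (m r : R) (y : 'rV[R]_dimK) : R :=
  inf [set CKtilde m r w | w in [set w | coneK w /\ forall k, y 0 k <= w 0 k]].

End dyadic.

(* Main.v *)
From HB Require Import structures.
Require Import Defs.
From mathcomp Require Import all_boot all_order all_algebra.
From mathcomp Require Import all_classical all_reals all_analysis.
From mathcomp Require Import ring lra zify.
Set Implicit Arguments.
Unset Strict Implicit.
Unset Printing Implicit Defensive.
Import Order.TTheory GRing.Theory Num.Theory.
Import numFieldNormedType.Exports.
Local Open Scope classical_set_scope.
Local Open Scope ring_scope.

(** The Hamiltonian is non-decreasing and Lipschitz ([HK_nondecreasing],
    [HK_lipschitz]); everything else about the equation holds for any
    Hamiltonian H with these two properties, and rests on three facts.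

    Uniqueness. Two solutions are compared by doubling the variables
    ([comparison]). No boundary condition is imposed on the faces of the
    orthant: a barrier th * (1 / x_k + 1 / y_k) keeps the maximum point in the
    open orthant, and the terms that it adds to the gradients, - th / x_k ^ 2
    on the side of the subsolution and th / y_k ^ 2 on the side of the
    supersolution, have the sign for which a non-decreasing H can only improve
    the inequality.

    Existence, with a constraint on the gradient. Let rho be a sublinear
    function of h such that the increments of the initial condition satisfy
    u (x + h) - u x <= rho h. The initial condition extends to the whole space
    with the same bound ([mcshane]), and there the explicit scheme with forward
    differences, u + delta H (D u), is monotone, because H is non-decreasing and
    Lipschitz, and commutes with translations and with the addition of
    constants. Hence it preserves the bound ([scheme_step_slope]). Limits of the
    scheme are viscosity solutions by the method of Barles and Souganidis
    ([scheme_subsolution], [scheme_solution]). The construction is applied to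
    two functions rho: the support function of the prescribed set of gradients,
    and L times the normalized l1 norm, with L the Lipschitz constant of the
    initial condition. By uniqueness the two solutions agree on the orthant,
    which gives both the constraint on the gradient and the sharp Lipschitz
    constant.

    From gradients to increments and back. The gradient of the initial
    condition is constrained almost everywhere, while the scheme needs a bound
    on all increments ([increment_le_support]). The slopes of a Lipschitz
    function, averaged over the faces of dyadic cubes, form a martingale
    ([slope_avg]); a bisection argument bounds a martingale everywhere once it is
    bounded at small scales off a null set ([martingale_le]). In the other
    direction, a function whose increments are bounded by the support function
    of a compact convex set has its gradient in that set wherever it is
    differentiable ([gradient_mem]), that is almost everywhere, by the theorem of
    Rademacher. The latter is proved with the same martingale of slopes: its
    second moments are bounded, so that the volume of the cubes in which slopes
    still vary at deeper levels tends to zero, and elsewhere the function is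
    nearly affine at all small scales ([rademacher]).

    Finally, the bound by the total variation constant holds because
    TV (mu_x, mu_y) <= |x - y|_1 ([TV_le_norm1]). *)

(** * Countable covers by boxes *)
Section coordinates.
Variables (R : realType) (d : nat).
Implicit Types x y : 'rV[R]_d.

Lemma ler_coord x k : `|x 0 k| <= `|x|.
Proof.
rewrite [leRHS]/Num.norm/= mx_normrE.
exact: (@le_bigmax _ _ _ 0 (fun ij : 'I_1 * 'I_d => `|x ij.1 ij.2|) (0, k)).
Qed.

Lemma ler_rV_norm x e : 0 <= e -> (forall k, `|x 0 k| <= e) -> `|x| <= e.
Proof.
move=> e0 xe; rewrite [leLHS]/Num.norm/= mx_normrE.
by apply: bigmax_le => // -[i k] _ /=; rewrite (ord1 i).
Qed.

End coordinates.

Lemma sum_halves (R : realType) (c : R) n :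
  \sum_(i < n) c / 2 ^+ i.+1 = c * (1 - 2 ^- n).
Proof.
elim: n => [|n IHn]; first by rewrite big_ord0 expr0 invr1 subrr mulr0.
by rewrite big_ord_recr/= IHn exprS; field; rewrite expf_neq0.
Qed.

Section covers.
Variables (R : realType) (d : nat).
Implicit Types (l u : nat -> 'rV[R]_d) (S : set 'rV[R]_d).

Definition box (l u : 'rV[R]_d) := [set x : 'rV[R]_d | forall k, l 0 k <= x 0 k <= u 0 k].

Definition vol (l u : 'rV[R]_d) : R := \prod_k (u 0 k - l 0 k).

Lemma vol_ge0 (l u : 'rV[R]_d) : (forall k, l 0 k <= u 0 k) -> 0 <= vol l u.
Proof. by move=> lu; apply: prodr_ge0 => k _; rewrite subr_ge0. Qed.

Lemma vol_enlarge (l u w : 'rV[R]_d) (e : R) : 0 < e ->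
  exists2 t : R, 0 < t & forall s : R, 0 < s <= t -> vol (l - s *: w) (u + s *: w) <= vol l u + e.
Proof.
move=> e0.
have cf : continuous (fun s : R => \prod_k (u 0 k - l 0 k + s * (2 * w 0 k))).
  apply: continuous_big => [|k _]; first exact: mul_continuous.
  move=> s; apply: cvgD; first exact: cvg_cst.
  by apply: cvgM; [exact: cvg_id|exact: cvg_cst].
have /cvgrPdist_le/(_ _ e0) := cf 0.
move=> /nbhs_ballP[t /= t0 tP]; exists (t / 2); first by rewrite divr_gt0.
move=> s /andP[s0 st]; have := tP s.
rewrite /ball/= sub0r normrN (gtr0_norm s0) => /(_ (le_lt_trans st _)).
rewrite ltr_pdivrMr// ltr_pMr// ltr1n => /(_ isT) /ler_normlP[+ _].
rewrite opprB lerBlDr addrC.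
have -> : \prod_k (u 0 k - l 0 k + 0 * (2 * w 0 k)) = vol l u.
  by apply: eq_bigr => k _; rewrite mul0r addr0.
apply: le_trans; rewrite le_eqVlt; apply/orP; left; apply/eqP.
by apply: eq_bigr => k _; rewrite !mxE; ring.
Qed.

(** Outer measure at most [e], phrased without infinite sums: the partial sums
    of the volumes of a countable family of boxes stay below [e]. *)
Definition covered S (e : R) := exists l u,
  [/\ forall n k, l n 0 k <= u n 0 k,
      S `<=` \bigcup_n box (l n) (u n) &
      forall n, \sum_(i < n) vol (l i) (u i) <= e].

Lemma lebesgue_null_covered S :
  lebesgue_null S <-> forall e : R, 0 < e -> covered S e.
Proof.
split=> NS e e0; have [l [u [lu Slu le]]] := NS e e0; exists l, u; split => //.
  move=> n; rewrite -lee_fin -sumEFin; apply: le_trans le.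
  rewrite -(big_mkord xpredT (fun i => (vol (l i) (u i))%:E)).
  by apply: nneseries_lim_ge => i _ _; rewrite lee_fin vol_ge0.
apply: lime_le.
  by apply: is_cvg_nneseries => i _ _; rewrite lee_fin vol_ge0.
by apply: nearW => n; rewrite sumEFin lee_fin big_mkord.
Qed.

Lemma covered_sub S S' e e' : S `<=` S' -> e' <= e -> covered S' e' -> covered S e.
Proof.
move=> SS' ee' [l [u [lu S'lu le]]]; exists l, u; split => //.
  exact: subset_trans S'lu.
by move=> n; exact: le_trans ee'.
Qed.

Lemma covered_ge0 S e : covered S e -> 0 <= e.
Proof. by move=> [l [u [_ _ /(_ 0%N)]]]; rewrite big_ord0. Qed.

(** Neighbourhoods are needed when a sequence of cubes shrinks to a covered
    point; enlarging the [n]-th box costs at most [(e' - e) / 2 ^+ n.+1]. *)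
Lemma covered_open S e e' : covered S e -> e < e' -> exists l u,
  [/\ forall n k, l n 0 k < u n 0 k,
      forall x, S x -> exists n, forall k, l n 0 k < x 0 k < u n 0 k &
      forall n, \sum_(i < n) vol (l i) (u i) <= e'].
Proof.
move=> [l [u [lu Slu le]]] ee'.
have g0 n : 0 < (e' - e) / 2 ^+ n.+1 by rewrite divr_gt0 ?subr_gt0 ?exprn_gt0.
pose s n := projT1 (cid2 (vol_enlarge (l n) (u n) (const_mx 1) (g0 n))).
have s0 n : 0 < s n by rewrite /s; case: cid2.
have sP n : vol (l n - s n *: const_mx 1) (u n + s n *: const_mx 1)
    <= vol (l n) (u n) + (e' - e) / 2 ^+ n.+1.
  by rewrite /s; case: cid2 => t t0 /= /(_ t); rewrite t0 lexx; apply.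
exists (fun n => l n - s n *: const_mx 1), (fun n => u n + s n *: const_mx 1); split.
- move=> n k; rewrite !mxE mulr1.
  by have := lu n k; have := s0 n; lra.
- move=> x /Slu[n _ xn]; exists n => k; rewrite !mxE mulr1.
  by have := xn k; have := s0 n; lra.
- move=> n; apply: (@le_trans _ _ (\sum_(i < n) vol (l i) (u i) +
     \sum_(i < n) (e' - e) / 2 ^+ i.+1)).
    by rewrite -big_split; apply: ler_sum => i _; exact: sP.
  rewrite sum_halves.
  have : (e' - e) * (1 - 2 ^- n) <= e' - e.
    by rewrite ler_piMr ?subr_ge0 ?(ltW ee')// gerBl invr_ge0 exprn_ge0.
  by have := le n; lra.
Qed.

Definition pair_of_nat : nat -> option (nat * nat) := @pickle_inv _.

(** The volumes of countably many countable covers, enumerated as one series. *)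
Lemma sum_pairs_le (F : nat -> nat -> R) (e : R) :
  (forall i j, 0 <= F i j) ->
  (forall I J, \sum_(i < I) \sum_(j < J) F i j <= e) ->
  forall n, \sum_(k < n)
    (if pair_of_nat k is Some ij then F ij.1 ij.2 else 0) <= e.
Proof.
move=> F0 Fe n.
pose s : seq (nat * nat) := pmap pair_of_nat (iota 0 n).
have us : uniq s by apply: (pmap_uniq (@pickle_invK _)); exact: iota_uniq.
have -> : \sum_(k < n) (if pair_of_nat k is Some ij then F ij.1 ij.2 else 0) =
    \sum_(ij <- s) F ij.1 ij.2.
  rewrite -(big_mkord xpredT (fun k => if pair_of_nat k is Some ij then F ij.1 ij.2 else 0)).
  rewrite /s /index_iota subn0; elim: (iota 0 n) => [|k r IHr]; first by rewrite !big_nil.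
  rewrite big_cons IHr /=; case: (pair_of_nat _) => [ij|] /=; first by rewrite big_cons.
  by rewrite add0r.
pose I := (\max_(ij <- s) ij.1)%N.+1; pose J := (\max_(ij <- s) ij.2)%N.+1.
apply: le_trans (Fe I J).
rewrite pair_bigA/=.
pose t : seq (nat * nat) := [seq (val ij.1, val ij.2) | ij <- enum {: 'I_I * 'I_J}].
have -> : \sum_(p : 'I_I * 'I_J) F p.1 p.2 = \sum_(ij <- t) F ij.1 ij.2.
  by rewrite /t big_map big_enum.
have ut : uniq t.
  by rewrite map_inj_uniq ?enum_uniq// => -[a b] [a' b'] [] /val_inj -> /val_inj ->.
have st : {subset s <= t}.
  move=> [a b] abs.
  have aI : (a < I)%N.
    by rewrite ltnS; exact: (@leq_bigmax_seq _ s xpredT (fun ij : nat * nat => ij.1) (a, b)).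
  have bJ : (b < J)%N.
    by rewrite ltnS; exact: (@leq_bigmax_seq _ s xpredT (fun ij : nat * nat => ij.2) (a, b)).
  by apply/mapP; exists (Ordinal aI, Ordinal bJ); rewrite ?mem_enum.
have pst : perm_eq s [seq ij <- t | ij \in s].
  apply: uniq_perm => //; first exact: filter_uniq.
  move=> ij; rewrite mem_filter; apply/idP/andP => [ijs|[]//].
  by split => //; exact: st.
rewrite (perm_big _ pst)/= big_filter [leRHS](bigID (mem s))/= lerDl.
by apply: sumr_ge0.
Qed.

Lemma pair_of_natK (i j : nat) : pair_of_nat (pickle (i, j)) = Some (i, j).
Proof. exact: pickleK_inv. Qed.

Hypothesis d0 : (0 < d)%N.

Lemma vol00 : vol 0 0 = 0.
Proof.
by apply/eqP; rewrite prodf_seq_eq0; apply/hasP; exists (Ordinal d0);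
  rewrite ?mem_index_enum//= subrr.
Qed.

Lemma covered_bigcup (S : nat -> set 'rV[R]_d) (c : nat -> R) e :
  (forall n, covered (S n) (c n)) -> (forall n, \sum_(i < n) c i <= e) ->
  covered (\bigcup_n S n) e.
Proof.
move=> /choice[l /choice[u luP]] ce.
have lu i j k : l i j 0 k <= u i j 0 k by have [+ _ _] := luP i.
pose L k := if pair_of_nat k is Some ij then l ij.1 ij.2 else 0.
pose U k := if pair_of_nat k is Some ij then u ij.1 ij.2 else 0.
exists L, U; split.
- by move=> n k; rewrite /L/U; case: (pair_of_nat _).
- move=> x [i _ Six]; have [_ /(_ _ Six)[j _ xij] _] := luP i.
  by exists (pickle (i, j)) => //; rewrite /L /U pair_of_natK.
- move=> n.
  rewrite (eq_bigr (fun k : 'I_n => if pair_of_nat k is Some ij then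
     vol (l ij.1 ij.2) (u ij.1 ij.2) else 0)); last first.
    by move=> i _; rewrite /L /U; case: (pair_of_nat _) => //; rewrite vol00.
  apply: (@sum_pairs_le (fun i j => vol (l i j) (u i j))) => [i j|I J].
    exact: vol_ge0.
  apply: le_trans (ce I); apply: ler_sum => i _.
  by have [_ _] := luP i; apply.
Qed.

Lemma covered0 e : 0 <= e -> covered set0 e.
Proof.
by move=> e0; exists (fun=> 0), (fun=> 0); split => // n; rewrite big1// => i _; rewrite vol00.
Qed.

Lemma covered_box (l u : 'rV[R]_d) : (forall k, l 0 k <= u 0 k) ->
  covered (box l u) (vol l u).
Proof.
move=> lu; exists (fun n => if n == 0%N then l else 0), (fun n => if n == 0%N then u else 0).
split=> [[|n] k//|x xlu|[|n]]; first by exists 0%N.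
  by rewrite big_ord0 vol_ge0.
by rewrite big_ord_recl/= big1 ?addr0// => i _; rewrite vol00.
Qed.

Lemma covered_fin (I : finType) (S : I -> set 'rV[R]_d) (c : I -> R) :
  (forall i, covered (S i) (c i)) ->
  covered (\bigcup_i S i) (\sum_i c i).
Proof.
move=> Sc.
pose S' n := if insub n is Some j then S (enum_val (j : 'I_#|I|)) else set0.
pose c' n := if insub n is Some j then c (enum_val (j : 'I_#|I|)) else 0.
apply: (@covered_sub _ (\bigcup_n S' n) _ (\sum_i c i)) => //.
  move=> x [i _ Six]; exists (enum_rank i) => //.
  by rewrite /S' valK enum_rankK.
apply: (@covered_bigcup S' c') => [n|n].
  by rewrite /S' /c'; case: insub => //; exact: covered0.
have c'0 i : 0 <= c' i.
  by rewrite /c'; case: insub => // j; exact: covered_ge0 (Sc _).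
apply: (@le_trans _ _ (\sum_(i < n + #|I|) c' i)).
  by rewrite big_split_ord/= lerDl sumr_ge0.
rewrite addnC big_split_ord/= [X in _ + X]big1 ?addr0 => [|i _]; last first.
  by rewrite /c' insubF// ltnNge leq_addr.
rewrite (reindex_onto (enum_rank : I -> 'I_#|I|) enum_val) => [|i _]; last by rewrite enum_valK.
rewrite le_eqVlt (eq_bigl xpredT) => [|i]; last by rewrite enum_rankK eqxx.
by apply/orP; left; apply/eqP/eq_bigr => i _; rewrite /c' valK enum_rankK.
Qed.

Lemma covered_setU S S' e e' : covered S e -> covered S' e' -> covered (S `|` S') (e + e').
Proof.
move=> Se S'e'.
have := @covered_fin bool (fun b => if b then S else S') (fun b => if b then e else e').
rewrite big_bool/= => H; apply: covered_sub (H _); [|exact: lexx|by case].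
by move=> x [?|?]; [exists true|exists false].
Qed.

Lemma lebesgue_null_bigcup (S : nat -> set 'rV[R]_d) :
  (forall n, lebesgue_null (S n)) -> lebesgue_null (\bigcup_n S n).
Proof.
move=> nS; apply/lebesgue_null_covered => e e0.
apply: (@covered_bigcup S (fun n => e / 2 ^+ n.+1)) => [n|n].
  by have /lebesgue_null_covered := nS n; apply; rewrite divr_gt0 ?exprn_gt0.
rewrite sum_halves.
by rewrite ler_piMr ?(ltW e0)// gerBl invr_ge0 exprn_ge0.
Qed.

End covers.

(** * Dyadic cubes and slopes of averages over their faces *)
Section dyadic_cubes.
Variables (R : realType) (d : nat).
Implicit Types (c v x y z : 'rV[R]_d) (l : R) (i k : 'I_d).

Definition corner := {ffun 'I_d -> bool}.
Implicit Types b : corner.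

Definition upd b i (t : bool) : corner := [ffun k => if k == i then t else b k].

Definition vec b : 'rV[R]_d := \row_k (b k)%:R.

Definition ei i : 'rV[R]_d := delta_mx 0 i.

Definition cube c l := [set x : 'rV[R]_d | forall k, c 0 k <= x 0 k <= c 0 k + l].

Definition child c l b := c + (l / 2) *: vec b.

Lemma vec_updT b i : vec (upd b i true) = vec (upd b i false) + ei i.
Proof. by apply/rowP => k; rewrite !mxE !ffunE eqxx/=; case: (k == i); rewrite ?addr0 ?add0r. Qed.

Lemma cube_child c l b : 0 <= l -> cube (child c l b) (l / 2) `<=` cube c l.
Proof.
move=> l0 x xb k; have := xb k; rewrite !mxE.
by case: (b k); rewrite ?mulr1 ?mulr0; lra.
Qed.

Lemma cube_split c l x : 0 <= l -> cube c l x -> exists b, cube (child c l b) (l / 2) x.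
Proof.
move=> l0 xc; exists [ffun k => c 0 k + l / 2 <= x 0 k] => k; rewrite !mxE ffunE.
by have := xc k; case: (leP (c 0 k + l / 2)) => /=; rewrite ?mulr1 ?mulr0; lra.
Qed.

Lemma cube_corner c l : 0 <= l -> cube c l c.
Proof. by move=> l0 k; rewrite lexx lerDl. Qed.

Lemma cube_dist c l x y : 0 <= l -> cube c l x -> cube c l y -> `|x - y| <= l.
Proof.
move=> l0 xc yc; apply: ler_rV_norm => // k; rewrite !mxE ler_norml.
by have := xc k; have := yc k; lra.
Qed.

Definition avgB (F : corner -> R) : R := (2 ^+ d)^-1 * \sum_b F b.

Lemma card_corner : (#|{: corner}|%:R : R) = 2 ^+ d.
Proof. by rewrite card_ffun card_bool card_ord natrX. Qed.

Lemma avgB_cst (a : R) : avgB (fun=> a) = a.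
Proof.
rewrite /avgB; have -> : \sum_(b : corner) a = a * 2 ^+ d.
  by rewrite -card_corner mulr_natr -sumr_const; apply: eq_bigl.
by rewrite mulrC mulfK// expf_neq0.
Qed.

Lemma avgB_le F G : (forall b, F b <= G b) -> avgB F <= avgB G.
Proof.
by move=> FG; apply: ler_wpM2l; [rewrite invr_ge0 exprn_ge0|exact: ler_sum].
Qed.

Lemma eq_avgB F G : (forall b, F b = G b) -> avgB F = avgB G.
Proof. by move=> FG; congr (_ * _); exact: eq_bigr. Qed.

Lemma avgBD F G : avgB (fun b => F b + G b) = avgB F + avgB G.
Proof. by rewrite /avgB big_split mulrDr. Qed.

Lemma avgBZ (a : R) F : avgB (fun b => a * F b) = a * avgB F.
Proof. by rewrite /avgB -mulr_sumr mulrCA. Qed.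

Lemma avgBN F : avgB (fun b => - F b) = - avgB F.
Proof. by rewrite /avgB sumrN mulrN. Qed.

Lemma avgBB F G : avgB (fun b => F b - G b) = avgB F - avgB G.
Proof. by rewrite avgBD avgBN. Qed.

Lemma ler_norm_avgB F : `|avgB F| <= avgB (fun b => `|F b|).
Proof.
rewrite /avgB normrM gtr0_norm ?invr_gt0 ?exprn_gt0//.
by rewrite ler_wpM2l ?invr_ge0 ?exprn_ge0// ler_norm_sum.
Qed.

Lemma avgB_dist F (a e : R) : (forall b, `|F b - a| <= e) -> `|avgB F - a| <= e.
Proof.
move=> Fe; rewrite -[X in avgB F - X]avgB_cst -avgBB.
by apply: le_trans (ler_norm_avgB _) _; rewrite -[leRHS]avgB_cst; exact: avgB_le.
Qed.

Lemma avgB_upd F i :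
  avgB F = avgB (fun b => 2^-1 * (F (upd b i false) + F (upd b i true))).
Proof.
pose flip b := upd b i (~~ b i).
have flipK : involutive flip.
  by move=> b; apply/ffunP => k; rewrite !ffunE eqxx negbK; case: eqP => // ->.
have flip_avg : avgB (F \o flip) = avgB F.
  rewrite /avgB [X in _ = _ * X](reindex_inj (inv_inj flipK)).
  by congr (_ * _); apply: eq_bigl.
have updE b : upd b i (b i) = b by apply/ffunP => k; rewrite !ffunE; case: eqP => // ->.
have -> : avgB (fun b => 2^-1 * (F (upd b i false) + F (upd b i true))) =
    2^-1 * avgB (fun b => F b + F (flip b)).
  rewrite avgBZ; congr (_ * _); apply: eq_avgB => b; rewrite -{3}(updE b) /flip.
  by case: (b i) => //=; exact: addrC.
by rewrite avgBD flip_avg; field.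
Qed.

Section face_averages.
Variable u : 'rV[R]_d -> R.

(** Average of [u] over the grid points of mesh [l / 2 ^+ N] of the face of
    [cube c l] through [c] orthogonal to direction [i]. Its limit [face] is the
    mean value of [u] on that face, obtained without any integral. *)
Fixpoint faceN i N c l : R := if N is N'.+1
  then avgB (fun b => faceN i N' (c + (l / 2) *: vec (upd b i false)) (l / 2))
  else u c.

Definition face i c l := limn (fun N => faceN i N c l).

Definition slope i c l := (face i (c + l *: ei i) l - face i c l) / l.

Lemma faceN_shift i N c l v (a e : R) : 0 <= l ->
  (forall z, cube c l z -> `|u (z + v) - u z - a| <= e) ->
  `|faceN i N (c + v) l - faceN i N c l - a| <= e.
Proof.
elim: N c l => [|N IHN] c l l0 ua /=; first exact/ua/cube_corner.
rewrite -avgBB; apply: avgB_dist => b.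
rewrite (addrAC c v); apply: IHN; first by rewrite divr_ge0.
by move=> z zb; apply: ua; exact: cube_child zb.
Qed.

Variable L : R.
Hypothesis uL : forall x y, `|u x - u y| <= L * `|x - y|.

Lemma norm_vec b : `|vec b| <= 1.
Proof. by apply: ler_rV_norm => // k; rewrite mxE; case: (b k); rewrite ?normr1 ?normr0. Qed.

Hypothesis L0 : 0 <= L.

(** Refining the grid moves each point by at most one mesh, hence the averages
    form a Cauchy sequence. *)
Lemma faceN_step i N c l : 0 <= l -> `|faceN i N.+1 c l - faceN i N c l| <= L * l / 2 ^+ N.+1.
Proof.
elim: N c l => [|N IHN] c l l0.
  rewrite /= expr1; apply: avgB_dist => b; apply: le_trans (uL _ _) _.
  rewrite addrAC subrr add0r normrZ ger0_norm ?divr_ge0// -mulrA ler_wpM2l//.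
  by rewrite ler_piMr ?divr_ge0// norm_vec.
rewrite [faceN _ N.+2 _ _]/= [faceN _ N.+1 _ _]/= -avgBB.
apply: le_trans (ler_norm_avgB _) _; rewrite -[leRHS]avgB_cst; apply: avgB_le => b.
apply: le_trans (IHN _ _ _) _; first by rewrite divr_ge0.
by rewrite [in leRHS]exprS invfM !mulrA.
Qed.

Lemma faceN_close i N c l : 0 <= l -> `|faceN i N c l - u c| <= L * l.
Proof.
move=> l0; apply: (@le_trans _ _ (L * l * (1 - 2 ^- N))); last first.
  by rewrite ler_piMr ?mulr_ge0// gerBl invr_ge0 exprn_ge0.
elim: N => [|N IHN]; first by rewrite /= subrr normr0 expr0 invr1 subrr mulr0.
rewrite -(subrK (faceN i N c l) (faceN _ _ _ _)) -addrA.
apply: le_trans (ler_normD _ _) _.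
apply: le_trans (lerD (faceN_step i N c l0) IHN) _.
rewrite le_eqVlt; apply/orP; left; apply/eqP; rewrite exprS; field.
by rewrite expf_neq0.
Qed.

Lemma face_cvg i c l : 0 <= l -> faceN i N c l @[N --> \oo] --> face i c l.
Proof.
move=> l0.
pose e N := L * l * 2^-1 ^+ N.
have e_cvg : e @ \oo --> (0 : R).
  rewrite -[X in _ --> X](mulr0 (L * l)); apply: cvgM; first exact: cvg_cst.
  by apply: cvg_expr; rewrite ger0_norm// invf_lt1// ltr1n.
have w_cvg : cvgn (fun N => faceN i N c l + e N).
  apply: nonincreasing_is_cvgn.
    apply/nonincreasing_seqP => N.
    have /ler_normlP[_] := faceN_step i N c l0.
    by rewrite /e -exprVn !exprS; lra.
  exists (u c - L * l) => _ [N _ <-].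
  have /ler_normlP[+ _] := faceN_close i N c l0.
  have : 0 <= e N by rewrite /e !mulr_ge0// exprn_ge0.
  by lra.
suff : cvgn (fun N => faceN i N c l) by [].
have -> : (fun N => faceN i N c l) = (fun N => faceN i N c l + e N - e N).
  by apply/funext => N; rewrite addrK.
by apply: is_cvgB => //; apply/cvg_ex; exists 0.
Qed.

Lemma face_rec i c l : 0 <= l ->
  face i c l = avgB (fun b => face i (c + (l / 2) *: vec (upd b i false)) (l / 2)).
Proof.
move=> l0; have /cvg_lim <- // : faceN i N.+1 c l @[N --> \oo] --> 
    avgB (fun b => face i (c + (l / 2) *: vec (upd b i false)) (l / 2)).
  apply: cvgM; first exact: cvg_cst.
  apply: cvg_big => [|b _]; first exact: add_continuous.
  by apply: face_cvg; rewrite divr_ge0.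
by apply/esym/cvg_lim => //; rewrite (cvg_shiftS (fun N => faceN i N c l)); exact: face_cvg.
Qed.

Lemma face_shift i c l v (a e : R) : 0 <= l ->
  (forall z, cube c l z -> `|u (z + v) - u z - a| <= e) ->
  `|face i (c + v) l - face i c l - a| <= e.
Proof.
move=> l0 ua.
have fc : `|faceN i N (c + v) l - faceN i N c l - a| @[N --> \oo] -->
    `|face i (c + v) l - face i c l - a|.
  by apply: cvg_norm; apply: cvgB; [apply: cvgB; exact: face_cvg|exact: cvg_cst].
by apply: (cvgr_to_le fc); apply: nearW => N; exact: faceN_shift.
Qed.

Lemma face_close i c l : 0 <= l -> `|face i c l - u c| <= L * l.
Proof.
move=> l0.
have fc : `|faceN i N c l - u c| @[N --> \oo] --> `|face i c l - u c|.
  by apply: cvg_norm; apply: cvgB; [exact: face_cvg|exact: cvg_cst].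
by apply: (cvgr_to_le fc); apply: nearW => N; exact: faceN_close.
Qed.

Lemma slope_close i c l (a e : R) : 0 < l ->
  (forall z, cube c l z -> `|u (z + l *: ei i) - u z - l * a| <= l * e) ->
  `|slope i c l - a| <= e.
Proof.
move=> l0 ua; rewrite -(ler_pM2l l0) -{1}(gtr0_norm l0) -normrM.
rewrite mulrBr /slope mulrC divfK ?gt_eqF//.
exact: face_shift (ltW l0) ua.
Qed.

Lemma norm_ei i : `|ei i| <= 1.
Proof.
apply: ler_rV_norm => // k; rewrite mxE.
by case: andP => _; rewrite ?normr1 ?normr0.
Qed.

Lemma norm_slope i c l : 0 < l -> `|slope i c l| <= L.
Proof.
move=> l0; rewrite -[slope _ _ _]subr0; apply: slope_close => // z _.
rewrite mulr0 subr0; apply: le_trans (uL _ _) _.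
rewrite addrAC subrr add0r normrZ gtr0_norm// mulrCA ler_wpM2l ?(ltW l0)//.
by rewrite ler_piMr// norm_ei.
Qed.

(** The slopes form a dyadic martingale: opposite faces of the children that
    are interior to the parent cancel. *)
Lemma slope_avg i c l : 0 < l -> slope i c l = avgB (fun b => slope i (child c l b) (l / 2)).
Proof.
move=> l0; have l20 : 0 < l / 2 by rewrite divr_gt0.
rewrite (avgB_upd _ i) /slope !face_rec ?(ltW l0)// -avgBB mulrC -avgBZ.
apply: eq_avgB => b; rewrite /child vec_updT.
set w := vec _; set F := face i.
have -> : c + (l / 2) *: (w + ei i) + (l / 2) *: ei i = c + l *: ei i + (l / 2) *: w.
  by apply/rowP => k; rewrite !mxE; field.
have -> : c + (l / 2) *: (w + ei i) = c + (l / 2) *: w + (l / 2) *: ei i.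
  by rewrite scalerDr addrA.
by field; rewrite gt_eqF.
Qed.

End face_averages.

End dyadic_cubes.

(** * A bound for dyadic martingales off a null set *)
Lemma cvg_half (R : realType) (a : R) : (fun n => a / 2 ^+ n) @ \oo --> (0 : R).
Proof.
rewrite -[X in _ --> X](mulr0 a).
under eq_fun do rewrite -exprVn.
apply: cvgM; first exact: cvg_cst.
by apply: cvg_expr; rewrite ger0_norm// invf_lt1// ltr1n.
Qed.

Lemma overlap_split (R : realType) (a b p m q : R) : p <= m <= q ->
  Num.max 0 (Num.min b q - Num.max a p) =
  Num.max 0 (Num.min b m - Num.max a p) + Num.max 0 (Num.min b q - Num.max a m).
Proof.
move=> /andP[pm mq]; have [bm|mb] := leP b m.
  rewrite (min_idPl (le_trans bm mq)).
  rewrite [X in _ = _ + X](_ : _ = 0) ?addr0//; apply/max_idPl.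
  by rewrite subr_le0 le_max bm orbT.
have [ma|am] := leP m a.
  rewrite (max_idPl (le_trans pm ma)).
  rewrite [X in _ = X + _](_ : _ = 0) ?add0r//; apply/max_idPl.
  by rewrite subr_le0 ma.
have H1 : m <= Num.min b q by rewrite le_min (ltW mb) mq.
have H2 : Num.max a p <= m by rewrite ge_max (ltW am) pm.
have E (x : R) : 0 <= x -> Num.max 0 x = x by move=> ?; apply/max_idPr.
rewrite !E ?subr_ge0//; last exact: le_trans H2 H1.
by rewrite [RHS]addrC addrA subrK.
Qed.

Section martingale_bound.
Variables (R : realType) (d : nat).
Implicit Types (a b c x : 'rV[R]_d) (l : R).

(** Volume of the intersection of a box and a cube. *)
Definition cap a b c l : R :=
  \prod_k Num.max 0 (Num.min (b 0 k) (c 0 k + l) - Num.max (a 0 k) (c 0 k)).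

Lemma cap_ge0 a b c l : 0 <= cap a b c l.
Proof. by apply: prodr_ge0 => k _; rewrite le_max lexx. Qed.

Lemma cap_split a b c l : 0 <= l ->
  cap a b c l = \sum_(t : corner d) cap a b (child c l t) (l / 2).
Proof.
move=> l0; rewrite /cap.
pose G (k : 'I_d) (t : bool) : R := Num.max 0
  (Num.min (b 0 k) (c 0 k + l / 2 * t%:R + l / 2) - Num.max (a 0 k) (c 0 k + l / 2 * t%:R)).
rewrite (eq_bigr (fun k => \sum_(t : bool) G k t)) => [|k _]; last first.
  rewrite big_bool /G/= mulr1 mulr0 addr0 addrC.
  rewrite (_ : c 0 k + l / 2 + l / 2 = c 0 k + l); last by field.
  by apply: overlap_split; lra.
rewrite bigA_distr_bigA/=; apply: eq_bigr => t _; apply: eq_bigr => k _.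
by rewrite /G !mxE.
Qed.

Lemma cap_le_vol a b c l : (forall k, a 0 k <= b 0 k) -> cap a b c l <= vol a b.
Proof.
move=> ab; apply: ler_prod => k _; rewrite le_max lexx/= ge_max subr_ge0 ab/=.
by rewrite lerB// ?ge_min ?le_max ?lexx.
Qed.

Lemma cap_subset a b c l : 0 <= l ->
  (forall k, a 0 k <= c 0 k /\ c 0 k + l <= b 0 k) -> cap a b c l = l ^+ d.
Proof.
move=> l0 abc; rewrite -[in RHS](card_ord d) -prodr_const; apply: eq_bigr => k _.
have [ac cb] := abc k.
by rewrite (min_idPr cb) (max_idPr ac) addrAC subrr add0r; apply/max_idPr.
Qed.

Variable F : 'rV[R]_d -> R -> R.
Hypothesis F_avg : forall c l, 0 < l -> F c l = avgB (fun t => F (child c l t) (l / 2)).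
Variable C : R.
Hypothesis F_ub : forall c l, 0 < l -> F c l <= C.

(** Bisection: if the bound failed on a cube by more than a multiple of the
    volume of a cover of [N] inside that cube, it would fail in the same way on
    a child, hence on a sequence of cubes shrinking to a point [x]. If [N x],
    these cubes end up inside one box of the cover, and the global bound [C] on
    [F] contradicts the failure; otherwise [F] is at most [s + e] on them. *)
Lemma martingale_le (N : set 'rV[R]_d) c0 l0 (s : R) : 0 < l0 ->
  (forall e : R, 0 < e -> covered N e) ->
  (forall x, cube c0 l0 x -> ~ N x -> forall e : R, 0 < e -> exists2 r : R, 0 < r &
    forall c l, 0 < l < r -> cube c l x -> cube c l `<=` cube c0 l0 -> F c l <= s + e) ->
  F c0 l0 <= s.
Proof.
move=> l00 N0 Fs.
pose C' : R := `|C| + `|s|.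
have C'0 : 0 <= C' by rewrite addr_ge0.
have dl0 : 0 < l0 ^+ d by rewrite exprn_gt0.
suff main (e eta : R) : 0 < e -> 0 < eta -> (F c0 l0 - s - e) * l0 ^+ d <= C' * eta.
  apply/ler_addgt0Pr => e e0.
  have e20 : 0 < e / 2 by rewrite divr_gt0.
  have C'1 : 0 < C' + 1 by rewrite ltr_wpDl.
  have eta0 : 0 < e / 2 * l0 ^+ d / (C' + 1) by rewrite divr_gt0 ?mulr_gt0.
  have := main _ _ e20 eta0.
  have : C' * (e / 2 * l0 ^+ d / (C' + 1)) <= e / 2 * l0 ^+ d.
    rewrite mulrCA -[leRHS]mulr1 ler_wpM2l//.
      by rewrite mulr_ge0// ltW.
    by rewrite ler_pdivrMr// mul1r lerDl.
  by move=> /[swap] /le_trans /[apply]; rewrite ler_pM2r//; lra.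
move=> e0 eta0.
have eta20 : 0 < eta / 2 by rewrite divr_gt0.
have eta2 : eta / 2 < eta by rewrite ltr_pdivrMr// ltr_pMr// ltr1n.
have [a [b [ab Nab abe]]] := covered_open (N0 _ eta20) eta2.
(* [nu c l] is the volume, with multiplicity, of the cover inside [cube c l]. *)
pose nuN c l n := \sum_(j < n) cap (a j) (b j) c l.
pose nu c l := limn (nuN c l).
have nu_nd c l : {homo nuN c l : n m / (n <= m)%N >-> n <= m}.
  by apply/nondecreasing_seqP => n; rewrite /nuN big_ord_recr/= lerDl cap_ge0.
have nuN_le c l n : nuN c l n <= eta.
  apply: le_trans (abe n); apply: ler_sum => j _; apply: cap_le_vol => k.
  exact/ltW/ab.
have nu_cvg c l : cvgn (nuN c l).
  by apply: nondecreasing_is_cvgn => //; exists eta => _ [n _ <-].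
have nu_le c l : nu c l <= eta by apply: limr_le => //; apply: nearW.
have nuN_nu c l n : nuN c l n <= nu c l by exact: nondecreasing_cvgn_le.
have nu_ge0 c l : 0 <= nu c l by apply: le_trans (nuN_nu c l 0%N); rewrite /nuN big_ord0.
have nu_split c l : 0 <= l -> nu c l = \sum_(t : corner d) nu (child c l t) (l / 2).
  move=> l_ge0; apply/cvg_lim => //.
  have -> : nuN c l = (fun n => \sum_(t : corner d) nuN (child c l t) (l / 2) n).
    apply/funext => n; rewrite /nuN exchange_big/=.
    by apply: eq_bigr => j _; exact: cap_split.
  apply: cvg_big => [|t _]; first exact: add_continuous.
  exact: nu_cvg.
pose bad c l := C' * nu c l < (F c l - s - e) * l ^+ d.
have bad_child c l : 0 < l -> bad c l -> exists t, bad (child c l t) (l / 2).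
  move=> lgt0; rewrite /bad; apply: contraPP => /forallNP nbad; apply/negP; rewrite -leNgt.
  have -> : (F c l - s - e) * l ^+ d =
      \sum_(t : corner d) (F (child c l t) (l / 2) - s - e) * (l / 2) ^+ d.
    rewrite -mulr_suml -(mulVKf (_ : 2 ^+ d != 0) (\sum_i _)) ?expf_neq0// -/(avgB _).
    rewrite avgBB avgBB !avgB_cst -F_avg// expr_div_n; field.
    by rewrite expf_neq0.
  rewrite (nu_split _ _ (ltW lgt0)) mulr_sumr; apply: ler_sum => t _.
  by rewrite leNgt; apply/negP.
rewrite leNgt; apply/negP => bad0.
pose next (p : 'rV[R]_d * R) :=
  (child p.1 p.2 (xget [ffun=> false] [set t | bad (child p.1 p.2 t) (p.2 / 2)]), p.2 / 2).
pose P n := iter n next (c0, l0).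
have Pl n : (P n).2 = l0 / 2 ^+ n.
  elim: n => [|n IHn]; first by rewrite expr0 divr1.
  by rewrite /P iterS/= -/(P n) IHn exprS invfM mulrCA mulrC.
have Pl0 n : 0 < (P n).2 by rewrite Pl divr_gt0// exprn_gt0.
have Pbad n : bad (P n).1 (P n).2.
  elim: n => [|n IHn]; first by rewrite /bad/=; apply: le_lt_trans bad0; rewrite ler_wpM2l.
  have [t tP] := bad_child _ _ (Pl0 n) IHn.
  by rewrite /P iterS -/(P n) /next/=; case: xgetP => [t' _ //|/(_ t)].
have P_sub n : cube (P n.+1).1 (P n.+1).2 `<=` cube (P n).1 (P n).2.
  by rewrite /P iterS -/(P n); apply: cube_child; exact/ltW.
have P_subm n m : (n <= m)%N -> cube (P m).1 (P m).2 `<=` cube (P n).1 (P n).2.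
  elim: m => [|m IHm]; first by rewrite leqn0 => /eqP ->.
  rewrite leq_eqVlt => /predU1P[->//|]; rewrite ltnS => /IHm; apply: subset_trans.
  exact: P_sub.
have Pc n m k : (n <= m)%N -> (P n).1 0 k <= (P m).1 0 k <= (P n).1 0 k + (P n).2.
  by move=> /P_subm; apply; apply: cube_corner; exact/ltW.
pose x : 'rV[R]_d := \row_k limn (fun n => (P n).1 0 k).
have Pcvg k : cvgn (fun n => (P n).1 0 k).
  apply: nondecreasing_is_cvgn => [n m /Pc|]; first by move=> /(_ k) /andP[].
  by exists (c0 0 k + l0) => _ [n _ <-]; have /andP[] := Pc 0%N n k isT.
have xP n : cube (P n).1 (P n).2 x.
  move=> k; rewrite mxE; apply/andP; split.
    apply: limr_ge => //; near=> m.
    have nm : (n <= m)%N by near: m; exists n.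
    by have /andP[] := Pc _ _ k nm.
  apply: limr_le => //; near=> m.
  have nm : (n <= m)%N by near: m; exists n.
  by have /andP[] := Pc _ _ k nm.
have Pl_cvg : (P n).2 @[n --> \oo] --> 0.
  by under eq_fun do rewrite Pl; exact: cvg_half.
have [Nx|Nx] := pselect (N x).
  have [j xj] := Nab _ Nx.
  have : \forall n \near \oo, forall k, (P n).2 < x 0 k - a j 0 k /\ (P n).2 < b j 0 k - x 0 k.
    apply: filter_forall => k; have /andP[ax xb] := xj k.
    by near=> n; split; near: n; apply: (cvgr_lt _ Pl_cvg); rewrite subr_gt0.
  move=> [n _ /(_ n (leqnn n)) nP].
  have := Pbad n; apply/negP; rewrite -leNgt.
  have : (P n).2 ^+ d <= nu (P n).1 (P n).2.
    apply: le_trans (nuN_nu _ _ j.+1); rewrite /nuN big_ord_recr/=.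
    rewrite [X in _ <= _ + X]cap_subset; last 2 first.
    - exact/ltW.
    - by move=> k; have := nP k; have := xP n k; split; lra.
    by rewrite lerDr; apply: sumr_ge0 => i _; exact: cap_ge0.
  move=> /(ler_wpM2l C'0); apply: le_trans.
  rewrite ler_pM2r ?exprn_gt0//.
  have := F_ub (P n).1 (Pl0 n); have := ler_norm C; have := ler_norm (- s).
  by rewrite normrN /C'; lra.
have x0 : cube c0 l0 x by exact: (xP 0%N).
have [r r0 rP] := Fs _ x0 Nx _ e0.
have [n _ /(_ n (leqnn n)) nr] : \forall n \near \oo, (P n).2 < r.
  exact: (cvgr_lt _ Pl_cvg).
have := Pbad n; apply/negP; rewrite -leNgt.
apply: (@le_trans _ _ 0); last by rewrite mulr_ge0.
rewrite mulr_le0_ge0 ?exprn_ge0 ?(ltW (Pl0 n))//.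
have := rP (P n).1 (P n).2; rewrite Pl0 nr => /(_ isT (xP n) (P_subm 0%N n isT)).
by lra.
Unshelve. all: by end_near.
Qed.

End martingale_bound.

Section rows.
Variables (R : realType) (d : nat) (u : 'rV[R]_d -> R) (L : R).
Hypothesis L0 : 0 <= L.
Hypothesis uL : forall x y, `|u x - u y| <= L * `|x - y|.
Implicit Types (c : 'rV[R]_d) (i : 'I_d).

Lemma face_row i c (l : R) M : 0 < l ->
  face u i (c + (M%:R * l) *: ei R i) l - face u i c l =
  \sum_(j < M) l * slope u i (c + (j%:R * l) *: ei R i) l.
Proof.
move=> l0; elim: M => [|M IHM]; first by rewrite big_ord0 mul0r scale0r addr0 subrr.
rewrite big_ord_recr/= -IHM /slope [l * _]mulrC divfK ?gt_eqF//.
have -> : c + (M.+1%:R * l) *: ei R i = c + (M%:R * l) *: ei R i + l *: ei R i.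
  by rewrite -natr1 mulrDl mul1r scalerDl addrA.
by rewrite addrC addrA subrK.
Qed.

(** A bound on the slopes of the small cubes along an edge bounds the increment
    of [u] along that edge, as face averages are close to point values. *)
Lemma increment_le i c (s : R) :
  (forall M, (0 < M)%N -> forall j, (j < M)%N ->
    slope u i (c + (j%:R / M%:R) *: ei R i) M%:R^-1 <= s) ->
  u (c + ei R i) - u c <= s.
Proof.
move=> slope_s; apply/ler_addgt0Pr => e e0.
pose M := (Num.trunc (2 * L / e)).+1.
have M0 : 0 < M%:R :> R by rewrite ltr0n.
have LM : 2 * L * M%:R^-1 <= e.
  by rewrite ler_pdivrMr// -ler_pdivrMl// mulrC; exact/ltW/truncnS_gt.
have Mi0 : 0 < M%:R^-1 :> R by rewrite invr_gt0.
have := face_row i c M Mi0; rewrite divff ?gt_eqF// scale1r => row.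
have : face u i (c + ei R i) M%:R^-1 - face u i c M%:R^-1 <= s.
  rewrite row; apply: (@le_trans _ _ (\sum_(j < M) M%:R^-1 * s)).
    by apply: ler_sum => j _; rewrite ler_wpM2l ?(ltW Mi0)// slope_s.
  by rewrite sumr_const card_ord -[leLHS]mulr_natl mulrA divff ?mul1r// gt_eqF.
have /ler_normlP[_] := face_close uL L0 i c (ltW Mi0).
have /ler_normlP[+ _] := face_close uL L0 i (c + ei R i) (ltW Mi0).
by lra.
Qed.

End rows.

(** * Increments from almost everywhere bounds on the gradient *)
Section differentiability.
Variables (R : realType) (d : nat).
Implicit Types (u : 'rV[R]_d -> R) (x w a : 'rV[R]_d).

Lemma norm_dot a w : `|dot a w| <= (\sum_k `|a 0 k|) * `|w|.
Proof.
apply: le_trans (ler_norm_sum _ _ _) _; rewrite mulr_suml; apply: ler_sum => k _.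
by rewrite normrM ler_wpM2l// ler_coord.
Qed.

Lemma dotDr a w w' : dot a (w + w') = dot a w + dot a w'.
Proof. by rewrite /dot -big_split; apply: eq_bigr => k _; rewrite mxE mulrDr. Qed.

Lemma dotZr a (t : R) w : dot a (t *: w) = t * dot a w.
Proof. by rewrite /dot mulr_sumr; apply: eq_bigr => k _; rewrite mxE mulrCA. Qed.

Lemma dotC a w : dot a w = dot w a.
Proof. by apply: eq_bigr => k _; rewrite mulrC. Qed.

Lemma dotNr a w : dot a (- w) = - dot a w.
Proof. by rewrite -scaleN1r dotZr mulN1r. Qed.

Lemma dotBr a w w' : dot a (w - w') = dot a w - dot a w'.
Proof. by rewrite dotDr dotNr. Qed.

Lemma dotDl a a' w : dot (a + a') w = dot a w + dot a' w.
Proof. by rewrite dotC dotDr !(dotC w). Qed.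

Lemma dotBl a a' w : dot (a - a') w = dot a w - dot a' w.
Proof. by rewrite dotC dotBr !(dotC w). Qed.

Lemma dotZl (t : R) a w : dot (t *: a) w = t * dot a w.
Proof. by rewrite dotC dotZr dotC. Qed.

Lemma dot_ei a i : dot a (ei R i) = a 0 i.
Proof.
rewrite /dot (bigD1 i)//= mxE !eqxx/= mulr1 big1 ?addr0// => k ki.
by rewrite mxE (negbTE ki) andbF mulr0.
Qed.

Lemma diff_gradient u x w : differentiable u x -> 'd u x w = dot (gradient u x) w.
Proof.
move=> du; rewrite [in LHS](row_sum_delta w) linear_sum/=; apply: eq_bigr => k _.
by rewrite linearZ/= -deriveE// mxE mulrC.
Qed.

(** The form in which differentiability is used: an affine approximation with
    relative error [e], without remainder functions. *)
Lemma differentiable_approx u x : differentiable u x -> forall e : R, 0 < e ->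
  exists2 r : R, 0 < r & forall w, `|w| < r ->
    `|u (x + w) - u x - dot (gradient u x) w| <= e * `|w|.
Proof.
move=> du e e0.
have : u \o shift x = cst (u x) + 'd u x +o_ (0 : 'rV[R]_d) id.
  by apply/funext => h; rewrite /= (diff_locallyx du).
move=> /eqaddoP/(_ e e0) /nbhs_ballP[r /= r0 rP]; exists r => // w wr.
have := rP w; rewrite -ball_normE/= sub0r normrN => /(_ wr) /=.
by rewrite -diff_gradient// (addrC x) -addrA -opprD.
Qed.

Let dot_linear a : linear (dot a).
Proof. by move=> t w w'; rewrite dotDr dotZr. Qed.

HB.instance Definition _ a := GRing.isLinear.Build R _ R _ (dot a) (@dot_linear a).

Lemma dot_continuous a : continuous (dot a).
Proof.
apply: continuous_big => [|k _ w]; first exact: add_continuous.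
by apply: continuousM; [exact: cst_continuous|exact: coord_continuous].
Qed.

Lemma approx_differentiable u x a :
  (forall e : R, 0 < e -> exists2 r : R, 0 < r & forall w, `|w| < r ->
    `|u (x + w) - u x - dot a w| <= e * `|w|) ->
  differentiable u x /\ gradient u x = a.
Proof.
move=> ua.
have ue : u \o shift x = cst (u x) + dot a +o_ (0 : 'rV[R]_d) id.
  apply/eqaddoP => e e0; have [r r0 rP] := ua _ e0.
  apply/nbhs_ballP; exists r => // w; rewrite -ball_normE/= sub0r normrN => wr.
  by have := rP _ wr; rewrite (addrC x) -addrA -opprD.
have dE : 'd u x = dot a :> (_ -> _) by apply: diff_unique => //; exact: dot_continuous.
have du : differentiable u x.
  apply/diff_locallyxP; split; first by rewrite dE; exact: dot_continuous.
  by move=> h; rewrite dE; exact: (congr1 (fun f => f h) ue).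
split => //; apply/rowP => k; rewrite mxE deriveE// dE; exact: dot_ei.
Qed.

End differentiability.

Section line_increments.
Variables (R : realType) (d : nat).
Implicit Types (x h a b : 'rV[R]_d) (N : set 'rV[R]_d).

(** The segment from [x0] to [x0 + h] may lie in the null set where nothing is
    known about the gradient. It is therefore thickened: the first coordinate of
    [y] runs along the segment and the others along a cube of side [r]. *)
Definition tube x0 h (r : R) (y : 'rV[R]_(1 + d)) : 'rV[R]_d :=
  x0 + y 0 (lshift d ord0) *: h + r *: rsubmx y.

Lemma vol_row_mx (s t : R) a b :
  vol (row_mx (const_mx s) a : 'rV[R]_(1 + d)) (row_mx (const_mx t) b) = (t - s) * vol a b.
Proof.
rewrite /vol big_split_ord/= big_ord1 !row_mxEl !mxE.
by congr (_ * _); apply: eq_bigr => k _; rewrite !row_mxEr.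
Qed.

Lemma volZ (t : R) a b : vol (t *: a) (t *: b) = t ^+ d * vol a b.
Proof.
have -> : t ^+ d = \prod_(k < d) t by rewrite prodr_const card_ord.
rewrite /vol -big_split.
by apply: eq_bigr => k _; rewrite !mxE -mulrBr.
Qed.

Lemma vol_shift x a b : vol (a - x) (b - x) = vol a b.
Proof. by apply: eq_bigr => k _; rewrite !mxE; ring. Qed.

(** The preimage of a box is cut into thin slabs, each of which lies in a box;
    their total volume tends to that of the preimage. *)
Lemma covered_tube_box x0 h (r : R) a b (e : R) : 0 < r -> 0 < e -> (forall k, a 0 k <= b 0 k) ->
  covered [set y : 'rV[R]_(1 + d) | 0 <= y 0 (lshift d ord0) <= 1 /\ box a b (tube x0 h r y)]
    (r^-1 ^+ d * (vol a b + e)).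
Proof.
move=> r0 e0 ab; pose w : 'rV[R]_d := \row_k `|h 0 k|.
have [t t0 tP] := vol_enlarge a b w e0.
pose M := (Num.trunc t^-1).+1.
have M0 : 0 < M%:R :> R by rewrite ltr0n.
have Mt : M%:R^-1 <= t.
  by rewrite -[leRHS]invrK lef_pV2 ?posrE ?invr_gt0//; exact/ltW/truncnS_gt.
pose ctr j := x0 + (j%:R / M%:R) *: h.
pose A j : 'rV[R]_d := r^-1 *: (a - M%:R^-1 *: w - ctr j).
pose B j : 'rV[R]_d := r^-1 *: (b + M%:R^-1 *: w - ctr j).
have AB j k : A j 0 k <= B j 0 k.
  rewrite !mxE ler_pM2l ?invr_gt0//; have := ab k.
  have : 0 <= M%:R^-1 * `|h 0 k| by rewrite mulr_ge0// invr_ge0 ltW.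
  by lra.
pose lo (j : nat) : 'rV[R]_(1 + d) := row_mx (const_mx (j%:R / M%:R)) (A j).
pose hi (j : nat) : 'rV[R]_(1 + d) := row_mx (const_mx (j.+1%:R / M%:R)) (B j).
have cov := @covered_fin R (1 + d) isT 'I_M (fun j => box (lo j) (hi j))
   (fun j => vol (lo j) (hi j)).
apply: covered_sub (cov _); last 1 first.
- move=> j; apply: covered_box => // k.
  have [k'|k'] := splitP k => kE.
    have -> : k = lshift d k' by exact: val_inj.
    by rewrite !row_mxEl !mxE ler_pM2r ?invr_gt0// ler_nat.
  have -> : k = rshift 1 k' by exact: val_inj.
  by rewrite !row_mxEr; exact: AB.
- move=> y /= [/andP[y0 y1] yab].
  have [j jM jy] : exists2 j, (j < M)%N &
      j%:R / M%:R <= y 0 (lshift d ord0) <= j.+1%:R / M%:R.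
    have t1 : (Num.trunc (y 0 (lshift d ord0) * M%:R))%:R <= y 0 (lshift d ord0) * M%:R.
      by rewrite truncn_le; apply: mulr_ge0 => //; exact: ltW.
    have [tM|Mt'] := ltnP (Num.trunc (y 0 (lshift d ord0) * M%:R)) M.
      exists (Num.trunc (y 0 (lshift d ord0) * M%:R)) => //.
      by rewrite ler_pdivrMr// ler_pdivlMr// t1/= ltW// truncnS_gt.
    exists M.-1 => //; rewrite prednK// divff ?gt_eqF// y1 andbT ler_pdivrMr//.
    by apply: le_trans t1; rewrite ler_nat; exact: leq_trans (leq_pred _) Mt'.
  exists (Ordinal jM) => // k.
  have [k'|k'] := splitP k => kE.
    have -> : k = lshift d ord0 by apply: val_inj; rewrite /= kE (ord1 k').
    by rewrite !row_mxEl !mxE.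
  have -> : k = rshift 1 k' by exact: val_inj.
  rewrite !row_mxEr !mxE ler_pdivrMl// ler_pdivlMl//.
  have := yab k'; rewrite !mxE/=.
  set s := y 0 (lshift d ord0) in jy *.
  have : `|(s - j%:R / M%:R) * h 0 k'| <= M%:R^-1 * `|h 0 k'|.
    rewrite normrM ler_wpM2r// ler_norml.
    have Mi : 0 < M%:R^-1 :> R by rewrite invr_gt0.
    by move: jy; rewrite -natr1 mulrDl mul1r; lra.
  by rewrite ler_norml mulrBl; lra.
- apply: (@le_trans _ _ (\sum_(j < M) M%:R^-1 * (r^-1 ^+ d * (vol a b + e)))); last first.
    by rewrite sumr_const card_ord -[leLHS]mulr_natl mulrA divff ?mul1r// gt_eqF.
  apply: ler_sum => j _; rewrite vol_row_mx volZ vol_shift -mulrBl -natr1 addrAC subrr add0r.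
  rewrite mul1r; apply: ler_wpM2l; first by rewrite invr_ge0 ltW.
  apply: ler_wpM2l; first by rewrite exprn_ge0// invr_ge0 ltW.
  by apply: tP; rewrite invr_gt0 M0.
Qed.

(** The factor [r^-1 ^+ d] is harmless, since the cover of [N] can be chosen
    of volume [r ^+ d] times smaller. *)
Lemma covered_tube x0 h (r : R) N : (0 < d)%N -> 0 < r -> lebesgue_null N ->
  forall e : R, 0 < e ->
  covered [set y : 'rV[R]_(1 + d) | 0 <= y 0 (lshift d ord0) <= 1 /\ N (tube x0 h r y)] e.
Proof.
move=> d0 r0 /lebesgue_null_covered N0 e e0.
have rd0 : 0 < r ^+ d by rewrite exprn_gt0.
have e'0 : 0 < e / 2 * r ^+ d by rewrite mulr_gt0// divr_gt0.
have [a [b [ab Nab abe]]] := N0 _ e'0.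
apply: (@covered_sub _ _ _ (\bigcup_n
  [set y : 'rV[R]_(1 + d) | 0 <= y 0 (lshift d ord0) <= 1 /\ box (a n) (b n) (tube x0 h r y)])
  _ e) => //.
  by move=> y [y01 /Nab[n _ yn]]; exists n.
apply: (@covered_bigcup _ _ _ _
  (fun n => r^-1 ^+ d * (vol (a n) (b n) + e / 2 * r ^+ d / 2 ^+ n.+1))) => // [n|n].
  by apply: covered_tube_box => //; rewrite divr_gt0// exprn_gt0.
rewrite -mulr_sumr big_split/= exprVn ler_pdivrMl//.
have -> : r ^+ d * e = e / 2 * r ^+ d + e / 2 * r ^+ d by field.
apply: lerD; first exact: abe.
rewrite sum_halves.
by rewrite ler_piMr ?(ltW e'0)// gerBl invr_ge0 exprn_ge0.
Qed.

Variables (u : 'rV[R]_d -> R) (L : R).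
Hypothesis L0 : 0 <= L.
Hypothesis uL : forall x y, `|u x - u y| <= L * `|x - y|.

Lemma tube_diff x0 h r y y' : 0 < r ->
  `|tube x0 h r y - tube x0 h r y'| <= (`|h| + r) * `|y - y'|.
Proof.
move=> r0.
have -> : tube x0 h r y - tube x0 h r y' =
    (y - y') 0 (lshift d ord0) *: h + r *: rsubmx (y - y').
  by apply/rowP => k; rewrite !mxE; ring.
apply: le_trans (ler_normD _ _) _; rewrite !normrZ mulrDl (gtr0_norm r0); apply: lerD.
  by rewrite mulrC ler_wpM2l// ler_coord.
rewrite ler_wpM2l ?(ltW r0)//; apply: ler_rV_norm => // k.
by rewrite mxE; exact: ler_coord.
Qed.

Lemma tube_step x0 h r y (l : R) :
  tube x0 h r (y + l *: ei R (lshift d ord0)) = tube x0 h r y + l *: h.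
Proof.
by apply/rowP => k; rewrite /tube !mxE !eqxx eq_rlshift/=; ring.
Qed.

(** The increment of [u] along [h] is an increment of [v := u \o tube] along its
    first coordinate. Where [u] is differentiable, the slopes of [v] on small
    cubes approach the derivative of [u] along [h], so they are almost bounded
    by [s] there, and [martingale_le] applies to these slopes. *)
Lemma increment_le_ae x0 h (r s : R) N : (0 < d)%N -> 0 < r -> lebesgue_null N ->
  (forall y : 'rV[R]_(1 + d), (forall k, 0 <= y 0 k <= 1) -> let x := tube x0 h r y in
     ~ N x -> differentiable u x /\ dot (gradient u x) h <= s) ->
  u (x0 + h) - u x0 <= s.
Proof.
move=> d0 r0 N0 ND.
pose i0 := lshift d (ord0 : 'I_1).
pose v y := u (tube x0 h r y).
pose L' := L * (`|h| + r).
have hr0 : 0 <= `|h| + r by rewrite addr_ge0// ltW.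
have L'0 : 0 <= L' by rewrite mulr_ge0.
have vL y y' : `|v y - v y'| <= L' * `|y - y'|.
  apply: le_trans (uL _ _) _; rewrite -mulrA ler_wpM2l//; exact: tube_diff.
have -> : u (x0 + h) - u x0 = v (0 + ei R i0) - v 0.
  have t0 : tube x0 h r 0 = x0 by apply/rowP => k; rewrite !mxE; ring.
  by rewrite /v -{1}[ei R i0]scale1r tube_step t0 scale1r.
apply: (increment_le L'0 vL) => M M0 j jM; rewrite add0r.
have M0' : 0 < M%:R :> R by rewrite ltr0n.
have Mi0 : 0 < M%:R^-1 :> R by rewrite invr_gt0.
set c0 := _ *: _.
have c01 y : cube c0 M%:R^-1 y -> forall k, 0 <= y 0 k <= 1.
  move=> yc k; have := yc k; rewrite !mxE/=.
  have : M%:R^-1 <= 1 :> R by rewrite invf_le1// ler1n.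
  have : 0 <= j%:R / M%:R :> R by rewrite divr_ge0.
  have : j%:R / M%:R + M%:R^-1 <= 1 :> R.
    by rewrite -[X in _ + X]mul1r -mulrDl natr1 ler_pdivrMr// mul1r ler_nat.
  by case: (k == i0); rewrite /= ?mulr1 ?mulr0; lra.
have slope_mart (c : 'rV[R]_(1 + d)) (l : R) : 0 < l ->
    slope v i0 c l = avgB (fun t => slope v i0 (child c l t) (l / 2)).
  by move=> l0; exact: (slope_avg vL L'0).
have slope_ub (c : 'rV[R]_(1 + d)) (l : R) : 0 < l -> slope v i0 c l <= L'.
  by move=> l0; exact: le_trans (ler_norm _) (norm_slope vL L'0 _ _ l0).
pose N' := [set y : 'rV[R]_(1 + d) | 0 <= y 0 (lshift d ord0) <= 1 /\ N (tube x0 h r y)].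
have := martingale_le slope_mart slope_ub (N := N') (c0 := c0) (s := s) Mi0.
apply.
- by move=> e e0; exact: covered_tube.
move=> y yc nN e e0.
have [du duh] : differentiable u (tube x0 h r y) /\ dot (gradient u (tube x0 h r y)) h <= s.
  by apply: ND; [exact: c01|move=> Ny; apply: nN; split => //; exact: c01].
set x := tube x0 h r y in du duh *.
pose kap := 2 * `|h| + r + 1.
have kap0 : 0 < kap by rewrite /kap; have := normr_ge0 h; lra.
have e'0 : 0 < e / (2 * kap) by rewrite divr_gt0// mulr_gt0.
have [rho rho0 rhoP] := differentiable_approx du e'0.
exists (rho / kap); first by rewrite divr_gt0.
move=> c l /andP[l0 lrho] yl _.
suff : `|slope v i0 c l - dot (gradient u x) h| <= e by move=> /ler_normlP[_]; lra.
apply: (slope_close vL L'0) => // z zc.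
have lk : l * kap < rho by rewrite -ltr_pdivlMr.
rewrite /v tube_step.
pose w := tube x0 h r z - x.
have wl : `|w| <= (`|h| + r) * l.
  apply: le_trans (tube_diff _ _ _ _ r0) _; rewrite ler_wpM2l//.
  exact: cube_dist (ltW l0) zc yl.
have wl' : `|w + l *: h| <= l * kap.
  apply: le_trans (ler_normD _ _) _; rewrite normrZ gtr0_norm//.
  by rewrite /kap; have := wl; have := ltW l0; nra.
have wl2 : `|w| <= l * kap.
  by apply: le_trans wl _; rewrite /kap mulrC ler_pM2l//; have := normr_ge0 h; lra.
have := rhoP _ (le_lt_trans wl' lk); have := rhoP _ (le_lt_trans wl2 lk).
have -> : x + w = tube x0 h r z by rewrite addrC subrK.
have -> : x + (w + l *: h) = tube x0 h r z + l *: h by rewrite addrA [x + w]addrC subrK.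
rewrite dotDr dotZr.
have E : e / (2 * kap) * (l * kap) = l * e / 2 by field; rewrite gt_eqF.
have : e / (2 * kap) * `|w| <= l * e / 2 by rewrite -E ler_wpM2l// ltW.
have : e / (2 * kap) * `|w + l *: h| <= l * e / 2 by rewrite -E ler_wpM2l// ltW.
rewrite !ler_norml; lra.
Qed.

End line_increments.

(** * Almost everywhere differentiability of Lipschitz functions *)
Section differentiability_from_approximations.
Variables (R : realType) (d : nat) (u : 'rV[R]_d -> R) (x : 'rV[R]_d).

(** The slopes of increasingly good affine approximations at [x] form a Cauchy
    family; their limit is the gradient. *)
Lemma differentiable_of_affine_approx :
  (forall e : R, 0 < e -> exists a, exists2 r : R, 0 < r &
    forall w, `|w| < r -> `|u (x + w) - u x - dot a w| <= e * `|w|) ->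
  differentiable u x.
Proof.
move=> ua.
have e0 n : 0 < n.+1%:R^-1 :> R by rewrite invr_gt0.
pose e n : R := n.+1%:R^-1.
have [a aP] := choice (fun n => ua _ (e0 n)).
have aa n m k : a n 0 k - e n <= a m 0 k + e m.
  have [r r0 rP] := aP n; have [r' r'0 rP'] := aP m.
  have mr : Num.min r r' <= r by rewrite ge_min lexx.
  have mr' : Num.min r r' <= r' by rewrite ge_min lexx orbT.
  have m0 : 0 < Num.min r r' by rewrite lt_min r0.
  pose t : R := Num.min r r' / 2.
  have t0 : 0 < t by rewrite divr_gt0.
  have tm : t < Num.min r r' by rewrite /t; lra.
  have nt : `|t *: ei R k| <= t.
    by rewrite normrZ gtr0_norm// ler_piMr ?(ltW t0)// norm_ei.
  have /ler_normlP[_] := rP' _ (le_lt_trans nt (lt_le_trans tm mr')).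
  have /ler_normlP[+ _] := rP _ (le_lt_trans nt (lt_le_trans tm mr)).
  rewrite !dotZr !dot_ei.
  have := ler_wpM2l (ltW (e0 n)) nt; have := ler_wpM2l (ltW (e0 m)) nt.
  rewrite -/(e n) -/(e m) => h1 h2 h3 h4.
  by rewrite -(ler_pM2l t0); lra.
pose A : 'rV[R]_d := \row_k sup (range (fun n => a n 0 k - e n)).
have As k : has_sup (range (fun n => a n 0 k - e n)).
  split; first by exists (a 0%N 0 k - e 0%N), 0%N.
  by exists (a 0%N 0 k + e 0%N) => _ [n _ <-].
have aA n k : `|a n 0 k - A 0 k| <= e n.
  rewrite mxE ler_norml; apply/andP; split.
    rewrite lerNl opprB lerBlDl ge_sup//; first by have [] := As k.
    by move=> _ [m _ <-]; exact: aa.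
  by rewrite lerBlDr -lerBlDl; apply: ub_le_sup; [have [] := As k|exists n].
suff /approx_differentiable[] : forall e, 0 < e -> exists2 r : R, 0 < r &
    forall w, `|w| < r -> `|u (x + w) - u x - dot A w| <= e * `|w| by [].
move=> eps eps0.
pose n := Num.trunc ((1 + d%:R) / eps).
have neps : (1 + d%:R) * e n <= eps.
  by rewrite ler_pdivrMr ?ltr0n// mulrC -ler_pdivrMr//; exact/ltW/truncnS_gt.
have [r r0 rP] := aP n; exists r => // w wr.
have -> : u (x + w) - u x - dot A w = (u (x + w) - u x - dot (a n) w) + dot (a n - A) w.
  by rewrite dotBl; ring.
apply: le_trans (ler_normD _ _) _; apply: le_trans (lerD (rP _ wr) (norm_dot _ _)) _.
rewrite -mulrDl ler_wpM2r//; apply: le_trans neps; rewrite mulrDl mul1r lerD2l.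
apply: (@le_trans _ _ (\sum_(k < d) e n)); last by rewrite sumr_const card_ord mulr_natl.
by apply: ler_sum => k _; rewrite !mxE; have := aA n k; rewrite mxE.
Qed.

End differentiability_from_approximations.

Section rademacher.
Variables (R : realType) (d : nat) (u : 'rV[R]_d -> R) (L : R).
Hypothesis L0 : 0 <= L.
Hypothesis uL : forall x y, `|u x - u y| <= L * `|x - y|.
Hypothesis d0 : (0 < d)%N.
Implicit Types (c x y a : 'rV[R]_d) (l : R) (b : corner d).

(** [c'] is the corner of one of the subcubes of [cube c l] of side
    [l / 2 ^+ n]. *)
Fixpoint desc n c l c' : Prop :=
  if n is n'.+1 then exists b, desc n' (child c l b) (l / 2) c' else c' = c.

(** Mean of [phi] over the subcubes at depth [n], that is the conditional
    expectation of the [n]-th term of the process [phi]. *)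
Fixpoint expect n (phi : 'rV[R]_d -> R -> R) c l : R :=
  if n is n'.+1 then avgB (fun b => expect n' phi (child c l b) (l / 2)) else phi c l.

Lemma expect_mart n phi c l :
  (forall c' l', 0 < l' -> phi c' l' = avgB (fun b => phi (child c' l' b) (l' / 2))) ->
  0 < l -> expect n phi c l = phi c l.
Proof.
move=> mart; elim: n c l => //= n IHn c l l0; rewrite mart//; apply: eq_avgB => b.
by rewrite IHn// divr_gt0.
Qed.

Lemma expect_submart n phi c l :
  (forall c' l', 0 < l' -> phi c' l' <= avgB (fun b => phi (child c' l' b) (l' / 2))) ->
  0 < l -> expect n phi c l <= expect n.+1 phi c l.
Proof.
move=> sub; elim: n c l => [|n IHn] c l l0; first exact: sub.
by rewrite [leRHS]/=; apply: avgB_le => b; apply: IHn; rewrite divr_gt0.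
Qed.

Lemma expect_submart_le n m phi c l : (n <= m)%N ->
  (forall c' l', 0 < l' -> phi c' l' <= avgB (fun b => phi (child c' l' b) (l' / 2))) ->
  0 < l -> expect n phi c l <= expect m phi c l.
Proof.
move=> /subnK <- sub l0; elim: (m - n)%N => //= k /le_trans; apply.
exact: expect_submart.
Qed.

(** A non-negative term of a mean is at most the mean times the number of
    terms. *)
Lemma expect_term n phi c l c' : (forall c' l', 0 <= phi c' l') -> desc n c l c' ->
  phi c' (l / 2 ^+ n) <= (2 ^+ d) ^+ n * expect n phi c l.
Proof.
move=> phi0; elim: n c l => [|n IHn] c l /=; first by move=> ->; rewrite divr1 mul1r.
move=> [b /IHn]; have -> : l / 2 / 2 ^+ n = l / 2 ^+ n.+1 by rewrite exprS invfM mulrA.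
move=> /le_trans; apply; rewrite exprSr -mulrA; apply: ler_wpM2l; first by rewrite !exprn_ge0.
rewrite /avgB mulVKf ?expf_neq0// (bigD1 b)//= lerDl; apply: sumr_ge0 => b' _.
elim: n {IHn} (child _ _ _) (l / 2) => //= n IHn c2 l2.
by rewrite mulr_ge0 ?invr_ge0 ?exprn_ge0// sumr_ge0.
Qed.

Lemma desc_split n c l x : 0 <= l -> cube c l x ->
  exists2 c', desc n c l c' & cube c' (l / 2 ^+ n) x.
Proof.
elim: n c l => [|n IHn] c l l0 xc; first by exists c => //=; rewrite divr1.
have [b xb] := cube_split l0 xc.
have [|c' cc' xc'] := IHn _ _ _ xb; first by rewrite divr_ge0.
by exists c'; [exists b|rewrite exprS invfM mulrA].
Qed.

Lemma desc_grid n c l c' : desc n c l c' ->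
  exists g : 'I_d -> nat, forall k, c' 0 k = c 0 k + l / 2 ^+ n * (g k)%:R.
Proof.
elim: n c l => [|n IHn] c l /=.
  by move=> ->; exists (fun=> 0%N) => k; rewrite mulr0 addr0.
move=> [b /IHn[g gP]]; exists (fun k => (b k * 2 ^ n + g k)%N) => k.
rewrite gP !mxE natrD natrM natrX exprS; field.
by rewrite expf_neq0.
Qed.

Notation p := (slope u).

(** With [a = 0] these are the second moments of the martingale of slopes; with
    [a] the slopes of a cube they measure the deviation of the slopes of its
    subcubes. *)
Definition sq a c l : R := \sum_i (p i c l - a 0 i) ^+ 2.

Lemma sq_ge0 a c l : 0 <= sq a c l.
Proof. by apply: sumr_ge0 => i _; exact: sqr_ge0. Qed.

Lemma avgB_sum (I : finType) (F : I -> corner d -> R) :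
  avgB (fun b => \sum_i F i b) = \sum_i avgB (F i).
Proof. by rewrite /avgB exchange_big mulr_sumr. Qed.

Lemma avgB_sqr (F : corner d -> R) : (avgB F) ^+ 2 <= avgB (fun b => F b ^+ 2).
Proof.
set m := avgB F.
have : 0 <= avgB (fun b => (F b - m) ^+ 2).
  by rewrite -[X in X <= _](@avgB_cst R d); apply: avgB_le => b; exact: sqr_ge0.
rewrite (eq_avgB (G := fun b => F b ^+ 2 - (2 * m * F b - m ^+ 2))) => [|b]; last by ring.
rewrite avgBB avgBB avgBZ avgB_cst -/m; lra.
Qed.

Lemma sq_submart a c l : 0 < l -> sq a c l <= avgB (fun b => sq a (child c l b) (l / 2)).
Proof.
move=> l0; rewrite /sq avgB_sum; apply: ler_sum => i _.
rewrite (slope_avg uL L0)// -[X in _ - X](@avgB_cst R d) -avgBB; exact: avgB_sqr.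
Qed.

Lemma sq0_ub c l : 0 < l -> sq 0 c l <= d%:R * L ^+ 2.
Proof.
move=> l0; apply: (@le_trans _ _ (\sum_(i < d) L ^+ 2)).
  apply: ler_sum => i _; rewrite mxE subr0 -[leLHS](real_normK (num_real _)).
  by rewrite lerXn2r ?nnegrE ?normr_ge0//; exact: norm_slope.
by rewrite sumr_const card_ord mulr_natl.
Qed.

(** Variance of the slopes at depth [n] around the slope of the cube itself. *)
Lemma expect_sq n c l : 0 < l ->
  expect n (sq (\row_i p i c l)) c l = expect n (sq 0) c l - sq 0 c l.
Proof.
move=> l0; set a := \row_i _.
have E m c' l' : 0 < l' -> expect m (sq a) c' l' =
    expect m (sq 0) c' l' - 2 * \sum_i a 0 i * p i c' l' + \sum_i a 0 i ^+ 2.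
  elim: m c' l' => [|m IHm] c' l' l'0 /=.
    rewrite /sq mulr_sumr -sumrB -big_split/=; apply: eq_bigr => i _.
    by rewrite [(0 : 'rV_d) 0 i]mxE; ring.
  rewrite (eq_avgB (fun b => IHm _ _ (divr_gt0 l'0 (ltr0Sn _ 1)))).
  rewrite avgBD avgBB avgB_cst avgBZ avgB_sum; congr (_ - _ * _ + _).
  by apply: eq_bigr => i _; rewrite avgBZ -(slope_avg uL L0).
rewrite E// /sq; under [X in _ = _ - X]eq_bigr do rewrite [(0 : 'rV_d) 0 _]mxE subr0.
have -> : \sum_i a 0 i * p i c l = \sum_i p i c l ^+ 2.
  by apply: eq_bigr => i _; rewrite mxE expr2.
have -> : \sum_i a 0 i ^+ 2 = \sum_i p i c l ^+ 2 by apply: eq_bigr => i _; rewrite mxE.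
by ring.
Qed.

Section hits.
Variables (k : nat) (delta : R) (a : 'rV[R]_d).
Hypothesis delta0 : 0 < delta.

(** A deviation by more than [delta] from [a], seen [k] generations below. The
    delay [k] is there because a function is nearly affine on a cube only if the
    slopes of its subcubes are controlled down to a fine scale. *)
Definition hit c l := exists c', desc k c l c' /\ exists i, delta < `|p i c' (l / 2 ^+ k) - a 0 i|.

Definition kappa : R := (2 ^+ d) ^+ k / delta ^+ 2.

Lemma kappa_ge0 : 0 <= kappa.
Proof. by rewrite divr_ge0 ?exprn_ge0// ltW. Qed.

Lemma hit_expect c l : hit c l -> 1 <= kappa * expect k (sq a) c l.
Proof.
move=> [c' [cc' [i di]]]; have := expect_term (sq_ge0 a) cc'.
rewrite /kappa mulrAC ler_pdivlMr ?exprn_gt0// mul1r; apply: le_trans.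
rewrite /sq (bigD1 i)//=; apply: (@le_trans _ _ ((p i c' (l / 2 ^+ k) - a 0 i) ^+ 2)).
  by rewrite -[leRHS](real_normK (num_real _)) lerXn2r ?nnegrE ?normr_ge0 ?ltW.
by rewrite lerDl; apply: sumr_ge0 => j _; exact: sqr_ge0.
Qed.

(** Proportion of the cube covered by the first hits at depth [j]. *)
Fixpoint first_hit j c l : R := if j is j'.+1
  then if `[< hit c l >] then 0 else avgB (fun b => first_hit j' (child c l b) (l / 2))
  else (`[< hit c l >])%:R.

(** A maximal inequality for the martingale of slopes: the first hits at
    different depths are disjoint, each of them contributes at least its own
    volume divided by [kappa] to the second moment [k] generations later, and
    second moments do not decrease with the depth. *)
Lemma first_hit_sum M c l : 0 < l ->
  \sum_(j < M) first_hit j c l <= kappa * expect (M + k) (sq a) c l.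
Proof.
elim: M c l => [|M IHM] c l l0.
  rewrite big_ord0 mulr_ge0 ?kappa_ge0//.
  by apply: le_trans (sq_ge0 a c l) _; apply: (@expect_submart_le 0) => //; exact: sq_submart.
rewrite big_ord_recl/=.
have [hc|hc] := asboolP (hit c l).
  rewrite big1// addr0; apply: le_trans (hit_expect hc) _.
  apply: ler_wpM2l; first exact: kappa_ge0.
  apply: (@expect_submart_le k (M.+1 + k)) => //; first exact: leq_addl.
  exact: sq_submart.
rewrite add0r -avgBZ -avgB_sum; apply: avgB_le => b.
by apply: IHM; rewrite divr_gt0.
Qed.

(** At a given scale, the behaviour of [u] near a point depends on the cubes
    adjacent to the one that contains the point. A cube that is hit is thus
    charged to its neighbours too. *)
Definition triple c l := cube (c - const_mx l) (3 * l).

Lemma triple_child c l b : 0 <= l -> triple (child c l b) (l / 2) `<=` triple c l.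
Proof.
move=> l0 x xb i; have := xb i; rewrite !mxE.
by case: (b i); rewrite ?mulr1 ?mulr0; lra.
Qed.

Lemma desc_triple n c l c' : 0 <= l -> desc n c l c' -> triple c' (l / 2 ^+ n) `<=` triple c l.
Proof.
elim: n c l => [|n IHn] c l l0 /=; first by move=> ->; rewrite divr1.
move=> [b] /IHn; rewrite divr_ge0// => /(_ isT).
have -> : l / 2 / 2 ^+ n = l / 2 ^+ n.+1 by rewrite exprS invfM mulrA.
move=> /subset_trans; apply; exact: triple_child.
Qed.

(** Sorting the points by the depth [j] of the first hit makes the volumes add up
    to the sum in [first_hit_sum]. *)
Fixpoint hit_set j c l : set 'rV[R]_d := if j is j'.+1
  then [set x | ~ hit c l /\ exists b, hit_set j' (child c l b) (l / 2) x]
  else [set x | hit c l /\ triple c l x].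

Lemma vol_cube c l : vol c (c + const_mx l) = l ^+ d.
Proof.
have -> : l ^+ d = \prod_(i < d) l by rewrite prodr_const card_ord.
by apply: eq_bigr => i _; rewrite !mxE addrAC subrr add0r.
Qed.

Lemma covered_cube c l : 0 <= l -> covered (cube c l) (l ^+ d).
Proof.
move=> l0; rewrite -(vol_cube c); apply: covered_sub (covered_box _ _) => //.
  by move=> x xc i; have := xc i; rewrite !mxE.
by move=> i; rewrite !mxE lerDl.
Qed.

Lemma covered_hit_set j c l : 0 <= l ->
  covered (hit_set j c l) ((3 * l) ^+ d * first_hit j c l).
Proof.
elim: j c l => [|j IHj] c l l0 /=.
  have [hc|hc] := asboolP (hit c l); rewrite ?mulr1 ?mulr0.
    have l3 : 0 <= 3 * l by rewrite mulr_ge0.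
    by apply: covered_sub (covered_cube (c - const_mx l) l3) => // x [].
  by apply: covered_sub (covered0 d0 (lexx 0)) => // x [].
have [hc|hc] := asboolP (hit c l); rewrite ?mulr0.
  by apply: covered_sub (covered0 d0 (lexx 0)) => // x [].
apply: covered_sub (covered_fin d0 (fun b => IHj (child c l b) (l / 2) (divr_ge0 l0 _))) => //.
  by move=> x [_ [b xb]]; exists b.
by rewrite -mulr_sumr /avgB [leRHS]mulrA -expr_div_n mulrA.
Qed.

Lemma hit_in_hit_set n c l c' x : 0 <= l -> desc n c l c' -> hit c' (l / 2 ^+ n) ->
  triple c' (l / 2 ^+ n) x -> exists j, hit_set j c l x.
Proof.
elim: n c l => [|n IHn] c l l0.
  by move=> /= ->; rewrite divr1 => hc xc; exists 0%N.
move=> cc' hc' xc'; have [hc|hc] := pselect (hit c l).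
  by exists 0%N; split => //; exact: desc_triple cc' _ xc'.
move: cc' => [b bc'].
have E : l / 2 ^+ n.+1 = l / 2 / 2 ^+ n by rewrite exprS invfM mulrA.
rewrite E in hc' xc'.
have l20 : 0 <= l / 2 by rewrite divr_ge0.
have [j xj] := IHn _ _ l20 bc' hc' xc'.
by exists j.+1; split => //; exists b.
Qed.

End hits.

Definition energy c l : R := limn (fun n => expect n (sq 0) c l).

Lemma energy_cvg c l : 0 < l -> expect n (sq 0) c l @[n --> \oo] --> energy c l.
Proof.
move=> l0; suff : cvgn (fun n => expect n (sq 0) c l) by [].
apply: nondecreasing_is_cvgn.
  by apply/nondecreasing_seqP => n; apply: expect_submart => //; exact: sq_submart.
exists (d%:R * L ^+ 2) => _ [n _ <-].
elim: n c l l0 => /= [|n IHn] c l l0; first exact: sq0_ub.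
by rewrite -[leRHS](@avgB_cst R d); apply: avgB_le => b; apply: IHn; rewrite divr_gt0.
Qed.

Lemma energy_ge n c l : 0 < l -> expect n (sq 0) c l <= energy c l.
Proof.
move=> l0; apply: nondecreasing_cvgn_le; last by apply/cvg_ex; exists (energy c l); exact: energy_cvg.
by apply/nondecreasing_seqP => m; apply: expect_submart => //; exact: sq_submart.
Qed.

Lemma energy_avg c l : 0 < l -> energy c l = avgB (fun b => energy (child c l b) (l / 2)).
Proof.
move=> l0; have /cvg_lim <- // : expect n.+1 (sq 0) c l @[n --> \oo] -->
    avgB (fun b => energy (child c l b) (l / 2)).
  apply: cvgM; first exact: cvg_cst.
  apply: cvg_big => [|b _]; first exact: add_continuous.
  by apply: energy_cvg; rewrite divr_gt0.
by apply/esym/cvg_lim => //; rewrite (cvg_shiftS (fun n => expect n (sq 0) c l)); exact: energy_cvg.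
Qed.

Lemma expect_energy n c l : 0 < l -> expect n energy c l = energy c l.
Proof. by apply: expect_mart; exact: energy_avg. Qed.

Lemma expectB n phi phi' c l :
  expect n (fun c l => phi c l - phi' c l) c l = expect n phi c l - expect n phi' c l.
Proof. by elim: n c l => //= n IHn c l; rewrite -avgBB; apply: eq_avgB => b. Qed.

Lemma expectZ n (t : R) phi c l : expect n (fun c l => t * phi c l) c l = t * expect n phi c l.
Proof. by elim: n c l => //= n IHn c l; rewrite -avgBZ; apply: eq_avgB => b. Qed.

Lemma covered_desc n (A : 'rV[R]_d -> R -> set 'rV[R]_d) (e : 'rV[R]_d -> R -> R) c l : 0 < l ->
  (forall c' l', 0 < l' -> covered (A c' l') (l' ^+ d * e c' l')) ->
  covered [set x | exists2 c', desc n c l c' & A c' (l / 2 ^+ n) x] (l ^+ d * expect n e c l).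
Proof.
move=> + Ae; elim: n c l => [|n IHn] c l l0 /=.
  by apply: covered_sub (Ae _ _ l0) => // x [c' ->]; rewrite divr1.
have l20 : 0 < l / 2 by rewrite divr_gt0.
apply: covered_sub (covered_fin d0 (fun b => IHn (child c l b) _ l20)) => //.
  move=> x [c' [b bc'] xc']; exists b => //; exists c' => //.
  by move: xc'; rewrite exprS invfM mulrA.
by rewrite -mulr_sumr /avgB [leRHS]mulrA -expr_div_n.
Qed.

Definition face_set c l := [set x | cube c l x /\
  exists i, x 0 i = c 0 i \/ x 0 i = c 0 i + l].

Lemma covered_face_set c l : 0 <= l -> covered (face_set c l) 0.
Proof.
move=> l0.
pose lo (ib : 'I_d * bool) : 'rV[R]_d := \row_j (if (j == ib.1) && ib.2 then c 0 j + l else c 0 j).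
pose hi (ib : 'I_d * bool) : 'rV[R]_d := \row_j (if (j == ib.1) && ~~ ib.2 then c 0 j else c 0 j + l).
have H ib : covered (box (lo ib) (hi ib)) 0.
  have <- : vol (lo ib) (hi ib) = 0.
    apply/eqP; rewrite prodf_seq_eq0; apply/hasP; exists ib.1; rewrite ?mem_index_enum//=.
    by rewrite !mxE eqxx/=; case: ib.2; rewrite /= subrr.
  apply: covered_box => // j; rewrite !mxE.
  by case: (j == _); case: ib.2; rewrite /= ?lexx ?lerDl.
apply: covered_sub (covered_fin d0 H) => //; last by rewrite big1.
move=> x [xc [i [xi|xi]]].
  exists (i, false) => // j; have := xc j; rewrite !mxE/= andbF andbT.
  by case: eqP => [->|_]; rewrite ?xi ?lexx.
exists (i, true) => // j; have := xc j; rewrite !mxE/= andbF andbT.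
by case: eqP => [->|_]; rewrite ?xi ?lexx.
Qed.

(** Outside this set, a point is interior to a cube [c'] at depth [n], and the
    slopes of all the smaller cubes around it are within [delta] of those of
    [c']. *)
Definition bad_set k delta n c l := [set x | exists2 c', desc n c l c' &
  (face_set c' (l / 2 ^+ n) `|`
   \bigcup_j hit_set k delta (\row_i p i c' (l / 2 ^+ n)) j c' (l / 2 ^+ n)) x].

(** By the maximal inequality the volume is controlled by what the second
    moments can still gain below depth [n]. The factor [3 ^+ d] comes from the
    tripled cubes. *)
Lemma covered_bad_set k (delta : R) n c l : 0 < delta -> 0 < l ->
  covered (bad_set k delta n c l)
    (l ^+ d * (3 ^+ d * kappa k delta * (energy c l - expect n (sq 0) c l))).
Proof.
move=> delta0 l0.
rewrite -(expect_energy n c l0) -expectB -expectZ.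
apply: (@covered_desc n (fun c' l' => face_set c' l' `|`
   \bigcup_j hit_set k delta (\row_i p i c' l') j c' l')) => // c' l' l'0.
rewrite -[X in covered _ X]add0r; apply: covered_setU => //.
  exact/covered_face_set/ltW.
apply: (covered_bigcup d0 (fun j => covered_hit_set k delta _ j c' (ltW l'0))) => M.
rewrite -mulr_sumr exprMn (mulrC (3 ^+ d)) -(mulrA (l' ^+ d)) -(mulrA (3 ^+ d)).
rewrite ler_wpM2l ?exprn_ge0// ?(ltW l'0)// ler_wpM2l ?exprn_ge0//.
apply: le_trans (first_hit_sum _ _ _ _ _ _) _ => //.
by rewrite ler_wpM2l ?kappa_ge0// expect_sq// lerD2r energy_ge.
Qed.

(** The second moments at depth [n] tend to the energy, so the remaining gain
    tends to zero. *)
Lemma bad_null k (delta : R) c l : 0 < delta -> 0 < l ->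
  lebesgue_null (\bigcap_n bad_set k delta n c l).
Proof.
move=> delta0 l0; apply/lebesgue_null_covered => e e0.
pose C := l ^+ d * (3 ^+ d * kappa k delta).
have : C * (energy c l - expect n (sq 0) c l) @[n --> \oo] --> C * (energy c l - energy c l).
  apply: cvgM; first exact: cvg_cst.
  by apply: cvgB; [exact: cvg_cst|exact: energy_cvg].
rewrite subrr mulr0 => /cvgr_le/(_ _ e0)[n _ /(_ n (leqnn n)) ne].
apply: covered_sub (covered_bad_set k n c delta0 l0); first by move=> x; apply.
by rewrite mulrA.
Qed.

Section affine.
Variables (delta : R) (a : 'rV[R]_d).
Hypothesis delta0 : 0 < delta.
Hypothesis aL : forall i, `|a 0 i| <= L.

Definition near_a k c l := forall c' i, desc k c l c' -> `|p i c' (l / 2 ^+ k) - a 0 i| <= delta.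

Lemma near_a_child k c l : near_a k.+1 c l -> forall b, near_a k (child c l b) (l / 2).
Proof.
move=> h b c' i bc'; have := h c' i; rewrite exprS invfM mulrA; apply.
by exists b.
Qed.
Arguments near_a_child [k c l] _ b.

Lemma child0 c l : child c l [ffun=> false] = c.
Proof. by apply/rowP => i; rewrite !mxE ffunE mulr0 addr0. Qed.

(** The two children along the edge have half of its length and see the same
    fine faces, so that their estimates add up. *)
Lemma face_edge k c l i : 0 < l -> near_a k c l ->
  `|face u i (c + l *: ei R i) (l / 2 ^+ k) - face u i c (l / 2 ^+ k) - l * a 0 i| <= l * delta.
Proof.
elim: k c l => [|k IHk] c l l0 na.
  have := na c i erefl; rewrite divr1 -(ler_pM2l l0) -{1}(gtr0_norm l0) -normrM.
  by rewrite mulrBr /slope mulrC divfK ?gt_eqF.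
have l20 : 0 < l / 2 by rewrite divr_gt0.
have := IHk _ _ l20 (near_a_child na [ffun=> false]).
have := IHk _ _ l20 (near_a_child na (upd [ffun=> false] i true)).
rewrite child0.
have -> : child c l (upd [ffun=> false] i true) = c + (l / 2) *: ei R i.
  rewrite /child vec_updT.
  have -> : upd [ffun=> false] i false = [ffun=> false].
    by apply/ffunP => j; rewrite !ffunE; case: ifP.
  by rewrite scalerDr addrA -/(child c l _) child0.
have -> : c + (l / 2) *: ei R i + (l / 2) *: ei R i = c + l *: ei R i.
  by rewrite -addrA -scalerDl -splitr.
have -> : l / 2 / 2 ^+ k = l / 2 ^+ k.+1 by rewrite exprS invfM mulrA.
by rewrite !ler_norml; lra.
Qed.

(** Averages over faces of side [l / 2 ^+ k] differ from point values by at
    most [L] times that side. *)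
Lemma edge k c l i : 0 < l -> near_a k c l ->
  `|u (c + l *: ei R i) - u c - l * a 0 i| <= l * delta + 2 * L * (l / 2 ^+ k).
Proof.
move=> l0 na; have := face_edge i l0 na.
have lk : 0 <= l / 2 ^+ k by rewrite divr_ge0 ?exprn_ge0// ltW.
have := face_close uL L0 i c lk; have := face_close uL L0 i (c + l *: ei R i) lk.
by rewrite !ler_norml; lra.
Qed.

(** The corner of the child is reached from [c] by moving along one coordinate
    direction at a time, each time along an edge of a child. *)
Lemma child_affine k c l b : 0 < l -> near_a k.+1 c l ->
  `|u (child c l b) - u c - dot a (child c l b - c)| <=
     d%:R * (l / 2 * delta + 2 * L * (l / 2 ^+ k.+1)).
Proof.
move=> l0 na; set tau := _ * delta + _.
pose bm (m : nat) : corner d := [ffun i : 'I_d => (i < m)%N && b i].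
have tau0 : 0 <= tau.
  by rewrite addr_ge0// !mulr_ge0 ?invr_ge0 ?exprn_ge0// ltW.
suff main m : (m <= d)%N ->
    `|u (child c l (bm m)) - u c - dot a (child c l (bm m) - c)| <= m%:R * tau.
  have := main d (leqnn d); have -> // : bm d = b.
  by apply/ffunP => i; rewrite ffunE ltn_ord.
elim: m => [|m IHm] md.
  have -> : bm 0%N = [ffun=> false] by apply/ffunP => i; rewrite !ffunE.
  by rewrite child0 dotBr !subrr normr0 mul0r.
have {IHm} := IHm (ltnW md).
pose i := Ordinal md.
have [bi|bi] := boolP (b i); last first.
  have -> : bm m.+1 = bm m.
    apply/ffunP => j; rewrite !ffunE ltnS leq_eqVlt.
    have [jm|//] := eqVneq (j : nat) m.
    have -> : j = i by exact: val_inj.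
    by rewrite (negbTE bi) !andbF.
  move=> /le_trans; apply; rewrite ler_wpM2r// ler_nat//.
have -> : bm m.+1 = upd (bm m) i true.
  apply/ffunP => j; rewrite !ffunE ltnS leq_eqVlt.
  have [->|ji] := eqVneq j i; first by rewrite eqxx bi.
  by have /negbTE -> : (j : nat) != m by apply: contra ji => /eqP jm; apply/eqP/val_inj.
have -> : child c l (upd (bm m) i true) = child c l (bm m) + (l / 2) *: ei R i.
  rewrite /child vec_updT.
  have -> : upd (bm m) i false = bm m.
    by apply/ffunP => j; rewrite !ffunE; case: eqP => // ->; rewrite ltnn.
  by rewrite scalerDr addrA.
have l20 : 0 < l / 2 by rewrite divr_gt0.
have := edge i l20 (near_a_child na (bm m)).
have -> : l / 2 / 2 ^+ k = l / 2 ^+ k.+1 by rewrite exprS invfM mulrA.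
rewrite -/tau !dotBr dotDr dotZr dot_ei -[m.+1%:R]natr1 mulrDl mul1r !ler_norml; lra.
Qed.

(** A point of the cube is reached from its corner through the corners of the
    subcubes that contain it, down to depth [k], where the Lipschitz bound takes
    over. The errors in [delta] decrease geometrically along this chain, and
    each of its [k] steps adds an error of order [l / 2 ^+ k]. *)
Lemma near_a_affine k c l y : 0 < l -> near_a k c l -> cube c l y ->
  `|u y - u c - dot a (y - c)| <=
    l * (L * (1 + d%:R) / 2 ^+ k + d%:R * delta + 2 * d%:R * L * k%:R / 2 ^+ k).
Proof.
elim: k c l => [|k IHk] c l l0 na yc.
  rewrite expr0 !divr1 mulr0 addr0.
  apply: le_trans (ler_normB _ _) _.
  have yl : `|y - c| <= l by apply: (cube_dist (ltW l0) yc); exact/cube_corner/ltW.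
  have : `|u y - u c| <= L * l by apply: le_trans (uL _ _) _; exact: ler_wpM2l.
  have : `|dot a (y - c)| <= d%:R * L * l.
    apply: le_trans (norm_dot _ _) _; apply: ler_pM => //; first exact: sumr_ge0.
    apply: (@le_trans _ _ (\sum_(i < d) L)); first exact: ler_sum.
    by rewrite sumr_const card_ord mulr_natl.
  have : 0 <= l * (d%:R * delta).
    by apply: mulr_ge0; [exact: ltW|apply: mulr_ge0 => //; exact: ltW].
  lra.
have l20 : 0 < l / 2 by rewrite divr_gt0.
have [b yb] := cube_split (ltW l0) yc.
have := IHk _ _ l20 (near_a_child na b) yb.
have := child_affine b l0 na.
have -> : u y - u c - dot a (y - c) = (u y - u (child c l b) - dot a (y - child c l b))
   + (u (child c l b) - u c - dot a (child c l b - c)) by rewrite !dotBr; ring.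
move=> h1 h2; apply: le_trans (ler_normD _ _) _; apply: le_trans (lerD h2 h1) _.
rewrite le_eqVlt; apply/orP; left; apply/eqP; rewrite -[k.+1%:R]natr1 exprS; field.
by rewrite expf_neq0.
Qed.

(** Both corners lie on the grid of mesh [l / 2 ^+ n], so in each coordinate
    they differ by at most one mesh as soon as they differ by less than two. *)
Lemma desc_adjacent n c l cx cy x y : 0 < l -> desc n c l cx -> desc n c l cy ->
  cube cx (l / 2 ^+ n) x -> cube cy (l / 2 ^+ n) y -> `|x - y| < l / 2 ^+ n ->
  exists2 z, cube cx (l / 2 ^+ n) z & cube cy (l / 2 ^+ n) z.
Proof.
move=> l0 /desc_grid[g gP] /desc_grid[g' gP'] xcx ycy xy.
set h := l / 2 ^+ n in gP gP' xcx ycy xy *.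
have h0 : 0 < h by rewrite divr_gt0// exprn_gt0.
have cmp (m m' : nat) : h * m%:R < h * m'%:R + 2 * h -> h * m%:R <= h * m'%:R + h.
  have -> : h * m'%:R + 2 * h = h * (m' + 2)%N%:R by rewrite natrD; ring.
  have -> : h * m'%:R + h = h * m'.+1%:R by rewrite -natr1; ring.
  by rewrite ltr_pM2l// ler_pM2l// ltr_nat ler_nat addn2 ltnS.
have gg i : h * (g i)%:R <= h * (g' i)%:R + h /\ h * (g' i)%:R <= h * (g i)%:R + h.
  have := xcx i; have := ycy i; rewrite gP gP'.
  have := le_lt_trans (ler_coord (x - y) i) xy; rewrite !mxE ltr_norml.
  by split; apply: cmp; lra.
exists (\row_i Num.max (cx 0 i) (cy 0 i)) => i; rewrite mxE gP gP'; have [h1 h2] := gg i;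
  by rewrite le_max ge_max lexx ?orbT/=; lra.
Qed.

Lemma dyadic_scale l t : 0 < t -> t < l ->
  exists n, l / 2 ^+ n.+1 <= t /\ t < l / 2 ^+ n.
Proof.
move=> t0 tl.
have ex : exists n, l / 2 ^+ n.+1 <= t.
  have /cvgr_le/(_ _ t0)[n _ /(_ n.+1 (leqnSn n))] := cvg_half l.
  by exists n.
exists (ex_minn ex); case: ex_minnP => n nP nmin; split => //.
case: n nP nmin => [|n] nP nmin; first by rewrite divr1.
by rewrite ltNge; apply/negP => /nmin; rewrite ltnn.
Qed.

Lemma cube_interior c l x : 0 < l -> (forall i, c 0 i < x 0 i < c 0 i + l) ->
  exists2 r : R, 0 < r <= l & forall w, `|w| < r -> cube c l (x + w).
Proof.
move=> l0 xc.
pose F i := Num.min (x 0 i - c 0 i) (c 0 i + l - x 0 i).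
exists (\big[Num.min/l]_i F i).
  rewrite bigmin_le_id andbT; apply: lt_bigmin => // i _.
  by have := xc i; rewrite lt_min; lra.
move=> w wr i; rewrite mxE.
have := le_lt_trans (ler_coord w i) (lt_le_trans wr (bigmin_le_cond l F (isT : xpredT i))).
by rewrite /F lt_min !ltr_norml; lra.
Qed.

(** The points [x] and [x + w] lie in two cubes with a common point, of a side
    comparable to [|w|]; [u] is nearly affine with slope [a] on each of them. *)
Lemma affine_at_good_point k c l x : 0 < l -> (forall i, c 0 i < x 0 i < c 0 i + l) ->
  (forall n c', desc n c l c' -> triple c' (l / 2 ^+ n) x -> near_a k c' (l / 2 ^+ n)) ->
  exists2 r : R, 0 < r & forall w, `|w| < r -> `|u (x + w) - u x - dot a w| <=
    8 * (L * (1 + d%:R) / 2 ^+ k + d%:R * delta + 2 * d%:R * L * k%:R / 2 ^+ k) * `|w|.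
Proof.
move=> l0 xint good.
set eps := _ + _ + _.
have xc : cube c l x by move=> i; have := xint i; lra.
have [r /andP[r0 rl] rP] := cube_interior l0 xint.
exists r => // w wr.
have [->|w0] := eqVneq w 0.
  by rewrite addr0 subrr sub0r normrN normr0 mulr0 -(scale0r 0) dotZr mul0r normr0.
have w00 : 0 < `|w| by rewrite normr_gt0.
have [n [nw wn]] := dyadic_scale w00 (lt_le_trans wr rl).
have [cx ccx xcx] := desc_split n (ltW l0) xc.
have [cy ccy ycy] := desc_split n (ltW l0) (rP _ wr).
set h := l / 2 ^+ n in wn xcx ycy *.
have h0 : 0 < h by rewrite divr_gt0// exprn_gt0.
have xw : `|x - (x + w)| < h by rewrite opprD addrA subrr sub0r normrN.
have [z zx zy] := desc_adjacent l0 ccx ccy xcx ycy xw; rewrite -/h in zx zy.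
have nx : near_a k cx h.
  by apply: good => // i; have := xcx i; rewrite !mxE -/h; lra.
have ny : near_a k cy h.
  apply: good => // i; have := ycy i; rewrite !mxE -/h.
  have := le_lt_trans (ler_coord w i) wn; rewrite ltr_norml; lra.
have hw : h <= 2 * `|w|.
  by move: nw; rewrite exprS invfM mulrCA -/h; lra.
have eps0 : 0 <= eps.
  by rewrite !addr_ge0 ?mulr_ge0 ?invr_ge0 ?exprn_ge0 ?addr_ge0// ltW.
have : eps * h <= eps * (2 * `|w|) by rewrite ler_wpM2l.
have := near_a_affine h0 nx xcx; have := near_a_affine h0 nx zx.
have := near_a_affine h0 ny ycy; have := near_a_affine h0 ny zy.
rewrite -/eps !dotBr dotDr !ler_norml; lra.
Qed.

End affine.

Lemma not_bad_good k delta n c l x : 0 < delta -> 0 < l -> cube c l x -> ~ bad_set k delta n c l x ->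
  exists a, (forall i, `|a 0 i| <= L) /\ exists2 r : R, 0 < r &
    forall w, `|w| < r -> `|u (x + w) - u x - dot a w| <=
      8 * (L * (1 + d%:R) / 2 ^+ k + d%:R * delta + 2 * d%:R * L * k%:R / 2 ^+ k) * `|w|.
Proof.
move=> delta0 l0 xc nbad.
have [c' cc' xc'] := desc_split n (ltW l0) xc.
set h := l / 2 ^+ n in xc' *.
have h0 : 0 < h by rewrite divr_gt0// exprn_gt0.
pose a : 'rV[R]_d := \row_i p i c' h.
have aL i : `|a 0 i| <= L by rewrite mxE; exact: norm_slope.
exists a; split => //; apply: (@affine_at_good_point delta a delta0 aL k c' h) => //.
  move=> i; rewrite !lt_neqAle; have /andP[h1 h2] := xc' i; rewrite h1 h2 !andbT.
  apply/andP; split; apply/eqP => xi; apply: nbad; exists c' => //; left; split => //.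
    by exists i; left.
  by exists i; right.
move=> m c2 c'c2 xc2 c3 i c2c3; rewrite leNgt; apply/negP => far.
apply: nbad; exists c' => //; right.
have [|j xj] := hit_in_hit_set (k := k) (delta := delta) (a := a) (ltW h0) c'c2 _ xc2.
  by exists c3; split => //; exists i.
by exists j.
Qed.

Lemma sqrS_le_exp2 j : (j.+1 * j.+1 <= 4 * 2 ^ j)%N.
Proof.
elim: j => // j IHj; rewrite expnS.
have : (j < 2 ^ j)%N by exact: ltn_expl.
by move: IHj; nia.
Qed.

(** Deviations [1 / (j + 1)] with delay [j] make the relative error in
    [not_bad_good] of order [1 / j]. The cubes [[- M - 1, M + 1]] exhaust the
    space. *)
Theorem rademacher : exists2 N : set 'rV[R]_d, lebesgue_null N &
  forall x, ~ N x -> differentiable u x.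
Proof.
pose N M j := \bigcap_n bad_set j j.+1%:R^-1 n (const_mx (- M.+1%:R)) (2 * M.+1%:R).
exists (\bigcup_M \bigcup_j N M j).
  apply: lebesgue_null_bigcup => // M; apply: lebesgue_null_bigcup => // j.
  by apply: bad_null; rewrite ?invr_gt0// mulr_gt0.
move=> x xN; apply: differentiable_of_affine_approx => e e0.
pose M := Num.trunc `|x|.
have xM : cube (const_mx (- M.+1%:R)) (2 * M.+1%:R) x.
  move=> i; rewrite mxE.
  have := le_lt_trans (ler_coord x i) (truncnS_gt `|x|); rewrite -/M ltr_norml; lra.
pose C := 4 * L * (1 + d%:R) + d%:R + 8 * d%:R * L.
have C0 : 0 <= C by rewrite !addr_ge0// !mulr_ge0// addr_ge0.
pose j := Num.trunc (8 * C / e).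
have Cj : 8 * (C * j.+1%:R^-1) <= e.
  by rewrite mulrA ler_pdivrMr// -ler_pdivrMl// mulrC; exact/ltW/truncnS_gt.
have : ~ N M j x by move=> Nx; apply: xN; exists M => //; exists j.
move=> /existsNP[n /not_implyP[_ nbad]].
have j0 : 0 < j.+1%:R^-1 :> R by rewrite invr_gt0.
have [|a [aL [r r0 rP]]] := not_bad_good j0 _ xM nbad; first by rewrite mulr_gt0.
exists a, r => // w wr; apply: le_trans (rP w wr) _; rewrite ler_wpM2r//.
apply: le_trans Cj; rewrite ler_pM2l//.
have t1 : j.+1%:R / 2 ^+ j <= 4 * j.+1%:R^-1 :> R.
  rewrite ler_pdivrMr ?exprn_gt0// mulrAC ler_pdivlMr//.
  by rewrite -natrX -!natrM ler_nat sqrS_le_exp2.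
have t2 : (2 ^+ j)^-1 <= 4 * j.+1%:R^-1 :> R.
  by apply: le_trans t1; rewrite ler_peMl ?invr_ge0 ?exprn_ge0// ler1n.
have t3 : j%:R / 2 ^+ j <= 4 * j.+1%:R^-1 :> R.
  by apply: le_trans t1; rewrite ler_wpM2r ?invr_ge0 ?exprn_ge0// ler_nat.
have dL0 : 0 <= 2 * d%:R * L by rewrite !mulr_ge0.
have L10 : 0 <= L * (1 + d%:R) by rewrite mulr_ge0// addr_ge0.
have := ler_wpM2l L10 t2; have := ler_wpM2l dL0 t3.
by rewrite /C; move: (2 ^+ j)^-1 (j.+1%:R^-1 : R) (j%:R : R) => A B J; lra.
Qed.

End rademacher.

(** * Gradients in a compact convex set and support functions *)
Section convex_sets.
Variables (R : realType) (d : nat).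
Implicit Types (p q h w : 'rV[R]_d) (S : set 'rV[R]_d).

Lemma dotr0 p : dot p 0 = 0.
Proof. by rewrite -(scale0r 0) dotZr mul0r. Qed.

Lemma dot_ge0 h : 0 <= dot h h.
Proof. by apply: sumr_ge0 => k _; rewrite -expr2 sqr_ge0. Qed.

Lemma dot_eq0 h : dot h h <= 0 -> h = 0.
Proof.
move=> h0; apply/rowP => k; rewrite mxE; apply/eqP; rewrite -sqrf_eq0.
have : h 0 k ^+ 2 <= 0.
  apply: le_trans h0; rewrite /dot (bigD1 k)//= -expr2 lerDl.
  by apply: sumr_ge0 => j _; rewrite -expr2 sqr_ge0.
by rewrite le_eqVlt ltNge sqr_ge0 orbF.
Qed.

(** A point lying in all the closed half-spaces that contain a compact convex
    set belongs to it: take the half-space given by its projection. *)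
Lemma mem_compact_convex S p : compact S -> S !=set0 ->
  (forall q q' (t : R), S q -> S q' -> 0 <= t <= 1 -> S (q + t *: (q' - q))) ->
  (forall h (s : R), (forall q, S q -> dot q h <= s) -> dot p h <= s) -> S p.
Proof.
move=> cS S0 convS pS.
have cf : continuous (fun q => dot (p - q) (p - q)).
  apply: continuous_big => [|k _ q]; first exact: add_continuous.
  have c1 : {for q, continuous (fun q : 'rV[R]_d => (p - q) 0 k)}.
    apply: (@continuous_comp _ _ _ (fun q : 'rV[R]_d => p - q)
       (fun M : 'rV[R]_d => M 0 k)); last exact: coord_continuous.
    by apply: continuousB; [exact: cst_continuous|exact: cvg_id].
  exact: continuousM.
have [z zS zmin] : exists2 z, z \in S &
    forall q, q \in S -> dot (p - z) (p - z) <= dot (p - q) (p - q).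
  by apply: compact_EVT_min => //; exact: continuous_subspaceT.
rewrite inE in zS.
have main w : S w -> dot w (p - z) <= dot z (p - z).
  move=> wS; rewrite -subr_le0 -dotBl; apply/ler_addgt0Pr => e e0; rewrite add0r.
  set B := dot (w - z) (w - z).
  have B0 : 0 <= B by exact: dot_ge0.
  have B10 : 0 < B + 1 by lra.
  pose t := Num.min 1 (e / (B + 1)).
  have t0 : 0 < t by rewrite lt_min ltr01 divr_gt0.
  have t1 : t <= 1 by rewrite ge_min lexx.
  have tB : t * B <= e.
    apply: (@le_trans _ _ (e / (B + 1) * B)); first by rewrite ler_wpM2r// ge_min lexx orbT.
    by rewrite mulrAC ler_pdivrMr// ler_pM2l//; lra.
  have := zmin (z + t *: (w - z)); rewrite inE => /(_ (convS _ _ _ zS wS _)).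
  rewrite (ltW t0) t1 => /(_ isT).
  have -> : p - (z + t *: (w - z)) = (p - z) - t *: (w - z) by rewrite opprD addrA.
  rewrite [leRHS]dotBl 2![dot _ (_ - t *: _)]dotBr !dotZl !dotZr -/B (dotC (p - z) (w - z)).
  move=> h; rewrite -(ler_pM2l t0); nra.
have := pS (p - z) _ main; rewrite -subr_le0 -dotBl => /dot_eq0/subr0_eq -> //.
Qed.

Definition support_fun S h : R := sup [set dot q h | q in S].

Section support_function.
Variables (S : set 'rV[R]_d) (C : R).
Hypothesis S0 : S !=set0.
Hypothesis SC : forall q, S q -> \sum_k `|q 0 k| <= C.

Lemma dot_le_norm q h : S q -> dot q h <= C * `|h|.
Proof.
move=> Sq; apply: le_trans (ler_norm _) _; apply: le_trans (norm_dot _ _) _.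
by rewrite ler_wpM2r// SC.
Qed.

Lemma has_sup_support h : has_sup [set dot q h | q in S].
Proof.
split; first by have [q Sq] := S0; exists (dot q h), q.
by exists (C * `|h|) => _ [q Sq <-]; exact: dot_le_norm.
Qed.

Lemma dot_le_support q h : S q -> dot q h <= support_fun S h.
Proof. by move=> Sq; apply: ub_le_sup; [have [] := has_sup_support h|exists q]. Qed.

Lemma support_le h s : (forall q, S q -> dot q h <= s) -> support_fun S h <= s.
Proof.
by move=> qs; apply: ge_sup; [have [] := has_sup_support h|move=> _ [q Sq <-]; exact: qs].
Qed.

Lemma support_le_norm h : support_fun S h <= C * `|h|.
Proof. by apply: support_le => q; exact: dot_le_norm. Qed.

Lemma supportD h h' : support_fun S (h + h') <= support_fun S h + support_fun S h'.
Proof. by apply: support_le => q Sq; rewrite dotDr lerD// dot_le_support. Qed.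

Lemma support0 : support_fun S 0 = 0.
Proof.
apply/eqP; rewrite eq_le support_le => [|q _]; last by rewrite dotr0.
by have [q Sq] := S0; rewrite -(dotr0 q) dot_le_support.
Qed.

(** The derivative along [h] is at most the support function at [h], so the
    gradient lies in every half-space that contains [S]. *)
Lemma gradient_mem (u : 'rV[R]_d -> R) x : compact S ->
  (forall q q' (t : R), S q -> S q' -> 0 <= t <= 1 -> S (q + t *: (q' - q))) ->
  (forall y h, u (y + h) - u y <= support_fun S h) -> differentiable u x -> S (gradient u x).
Proof.
move=> cS convS uS du; apply: mem_compact_convex => // h s.
have [->|h0] := eqVneq h 0 => qs.
  by have [q Sq] := S0; have := qs _ Sq; rewrite !dotr0.
have nh0 : 0 < `|h| by rewrite normr_gt0.
apply/ler_addgt0Pr => e e0.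
have e'0 : 0 < e / `|h| by rewrite divr_gt0.
have [r r0 rP] := differentiable_approx du e'0.
pose t := r / (2 * `|h|).
have t0 : 0 < t by rewrite divr_gt0// mulr_gt0.
have th : `|t *: h| = t * `|h| by rewrite normrZ gtr0_norm.
have : `|t *: h| < r.
  by rewrite th /t invfM mulrA mulfVK ?gt_eqF// ltr_pdivrMr// ltr_pMr// ltr1n.
move=> /rP; rewrite th mulrCA mulfVK ?gt_eqF// dotZr => /ler_normlP[+ _].
have := uS x (t *: h).
have : support_fun S (t *: h) <= t * s.
  by apply: support_le => q Sq; rewrite dotZr ler_pM2l// qs.
by move=> h1 h2 h3; rewrite -(ler_pM2l t0); lra.
Qed.

End support_function.

Section mcshane.
Variables (rho : 'rV[R]_d -> R) (C : R) (D : set 'rV[R]_d) (psi : 'rV[R]_d -> R).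
Hypothesis rhoD : forall h h', rho (h + h') <= rho h + rho h'.
Hypothesis rho0 : rho 0 = 0.
Hypothesis rhoC : forall h, rho h <= C * `|h|.
Hypothesis psi_rho : forall x y, D x -> D y -> psi x - psi y <= rho (x - y).
Variable x0 : 'rV[R]_d.
Hypothesis Dx0 : D x0.

(** The extension of McShane, for a modulus [rho] that may fail to be even. *)
Definition mcshane x : R := inf [set psi y + rho (x - y) | y in D].

Lemma has_inf_mcshane x : has_inf [set psi y + rho (x - y) | y in D].
Proof.
split; first by exists (psi x0 + rho (x - x0)), x0.
exists (psi x0 - rho (x0 - x)) => _ [y Dy <-].
have := psi_rho Dx0 Dy; have := rhoD (x0 - x) (x - y); rewrite addrA subrK; lra.
Qed.

Lemma mcshane_le x y : D y -> mcshane x <= psi y + rho (x - y).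
Proof. by move=> Dy; apply: ge_inf; [have [] := has_inf_mcshane x|exists y]. Qed.

Lemma mcshaneE x : D x -> mcshane x = psi x.
Proof.
move=> Dx; apply/eqP; rewrite eq_le; apply/andP; split.
  by have := mcshane_le x Dx; rewrite subrr rho0 addr0.
apply: lb_le_inf; first by have [] := has_inf_mcshane x.
by move=> _ [y Dy <-]; have := psi_rho Dx Dy; lra.
Qed.

Lemma mcshane_rho x h : mcshane (x + h) - mcshane x <= rho h.
Proof.
suff : mcshane (x + h) - rho h <= mcshane x by lra.
apply: lb_le_inf; first by have [] := has_inf_mcshane x.
move=> _ [y Dy <-]; have := mcshane_le (x + h) Dy.
by have := rhoD h (x - y); rewrite [h + _]addrCA addrA; lra.
Qed.

Lemma rho_lipschitz (u : 'rV[R]_d -> R) : (forall x h, u (x + h) - u x <= rho h) ->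
  forall x y, `|u x - u y| <= C * `|x - y|.
Proof.
move=> ur x y; rewrite ler_norml; apply/andP; split.
  have := ur x (y - x); have := rhoC (y - x); rewrite [x + _]addrC subrK [`|y - x|]distrC; lra.
by have := ur y (x - y); have := rhoC (x - y); rewrite [y + _]addrC subrK; lra.
Qed.

End mcshane.

Lemma orthant0 : orthant (0 : 'rV[R]_d).
Proof. by move=> k; rewrite mxE. Qed.

(** On the orthant the directional bounds on the gradient integrate, because
    the segments between interior points have a neighbourhood in the orthant. *)
Lemma increment_le_support (psi : 'rV[R]_d -> R) (L : R) S (C : R) : (0 < d)%N -> 0 <= L ->
  (forall x y, orthant x -> orthant y -> `|psi x - psi y| <= L * `|x - y|) ->
  S !=set0 -> (forall q, S q -> \sum_k `|q 0 k| <= C) -> gradient_in psi S ->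
  forall x y, orthant x -> orthant y -> psi x - psi y <= support_fun S (x - y).
Proof.
move=> d0 L0 psiL S0 SC psiS.
pose rho h := L * `|h|.
have rhoD h h' : rho (h + h') <= rho h + rho h'.
  by rewrite /rho -mulrDr ler_wpM2l// ler_normD.
have rho0 : rho 0 = 0 by rewrite /rho normr0 mulr0.
have psi_rho x y : orthant x -> orthant y -> psi x - psi y <= rho (x - y).
  by move=> Dx Dy; apply: le_trans (ler_norm _) (psiL _ _ Dx Dy).
pose u := mcshane rho orthant psi.
have uE x : orthant x -> u x = psi x by apply: mcshaneE => //; exact: orthant0.
have uL x y : `|u x - u y| <= L * `|x - y|.
  by apply: (@rho_lipschitz rho L) => // x' h; apply: mcshane_rho => //; exact: orthant0.
have main x y (t : R) : orthant x -> orthant y -> 0 < t ->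
    psi (x + const_mx t) - psi (y + const_mx t) <= support_fun S (x - y).
  move=> Dx Dy t0.
  have Dt z : orthant z -> orthant (z + const_mx t).
    by move=> Dz k; rewrite !mxE; have := Dz k; lra.
  rewrite -!uE; [|exact: Dt..].
  have -> : x + const_mx t = (y + const_mx t) + (x - y).
    by apply/rowP => k; rewrite !mxE; ring.
  apply: (@increment_le_ae _ _ _ _ L0 uL _ _ 1 _ _ d0 ltr01 psiS) => z z01 x1 nN.
  have x1t k : t <= x1 0 k.
    rewrite /x1 /tube !mxE mul1r.
    have /andP[s0 s1] := z01 (lshift d ord0); have /andP[z0 _] := z01 (rshift 1 k).
    have := Dx k; have := Dy k; move: s0 s1; set s := z 0 _ => s0 s1 y0 x0.
    have : 0 <= s * x 0 k + (1 - s) * y 0 k by rewrite addr_ge0// mulr_ge0// subr_ge0.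
    by lra.
  have Dx1 : orthant x1 by move=> k; apply: le_trans (x1t k); exact: ltW.
  have [dpsi gS] : differentiable psi x1 /\ S (gradient psi x1).
    by apply: contrapT => nd; apply: nN; split.
  have [du ->] : differentiable u x1 /\ gradient u x1 = gradient psi x1.
    apply: approx_differentiable => e e0.
    have [r r0 rP] := differentiable_approx dpsi e0.
    exists (Num.min r t); first by rewrite lt_min r0.
    move=> w; rewrite lt_min => /andP[wr wt].
    rewrite !uE//; first exact: rP.
    move=> k; rewrite mxE; have := le_lt_trans (ler_coord w k) wt.
    by rewrite ltr_norml; have := x1t k; lra.
  by split => //; apply: (dot_le_support S0 SC).
move=> x y Dx Dy; apply/ler_addgt0Pr => e e0.
pose t := e / (2 * (L + 1)).
have L1 : 0 < L + 1 by lra.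
have t0 : 0 < t by rewrite divr_gt0// mulr_gt0.
have tL : L * t <= e / 2.
  by rewrite /t invfM !mulrA ler_pdivrMr// [in leRHS]mulrDr; nra.
have Dt z : orthant z -> orthant (z + const_mx t).
  by move=> Dz k; rewrite !mxE; have := Dz k; lra.
have dt z : orthant z -> `|psi z - psi (z + const_mx t)| <= e / 2.
  move=> Dz; apply: le_trans (psiL _ _ Dz (Dt _ _ Dz)) _.
  apply: le_trans tL; rewrite ler_wpM2l// opprD addrA subrr sub0r normrN.
  by apply: ler_rV_norm => [|k]; rewrite ?mxE ?gtr0_norm// ltW.
have := main x y t Dx Dy t0; have := dt x Dx; have := dt y Dy.
by rewrite !ler_norml; lra.
Qed.

End convex_sets.

(** * The non-linearity and the set of gradients *)
Section dual_norm.
Variables (R : realType) (d : nat).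
Implicit Types (w y : 'rV[R]_d) (b : R).

Lemma norm1dual_ge0 w : 0 <= norm1dual w.
Proof. exact: bigmax_ge_id. Qed.

Lemma norm1dual_coord w k : d%:R * `|w 0 k| <= norm1dual w.
Proof. exact: (le_bigmax _ (fun k => d%:R * `|w 0 k|)). Qed.

Lemma norm1dual_le w b : 0 <= b -> (forall k, d%:R * `|w 0 k| <= b) -> norm1dual w <= b.
Proof. by move=> b0 wb; apply: bigmax_le => // k _; exact: wb. Qed.

Lemma norm1dualD w y : norm1dual (w + y) <= norm1dual w + norm1dual y.
Proof.
apply: norm1dual_le => [|k]; first by rewrite addr_ge0// norm1dual_ge0.
rewrite mxE; apply: le_trans (lerD (norm1dual_coord w k) (norm1dual_coord y k)).
by rewrite -mulrDr ler_wpM2l// ler_normD.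
Qed.

Lemma norm1dualZ (s : R) w : 0 <= s -> norm1dual (s *: w) <= s * norm1dual w.
Proof.
move=> s0; apply: norm1dual_le => [|k]; first by rewrite mulr_ge0// norm1dual_ge0.
by rewrite mxE normrM ger0_norm// mulrCA ler_wpM2l// norm1dual_coord.
Qed.

Lemma norm1_ge0 w : 0 <= norm1 w.
Proof. by rewrite mulr_ge0 ?invr_ge0// sumr_ge0. Qed.

Lemma norm1_le_norm w : norm1 w <= `|w|.
Proof.
have [d0|d0] := posnP d.
  have D0 : d%:R = 0 :> R by rewrite d0.
  by rewrite /norm1 D0 invr0 mul0r.
rewrite ler_pdivrMl ?ltr0n//; apply: (@le_trans _ _ (\sum_(k < d) `|w|)).
  by apply: ler_sum => k _; exact: ler_coord.
by rewrite sumr_const card_ord mulr_natl.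
Qed.

Lemma norm_le_norm1 w : `|w| <= d%:R * norm1 w.
Proof.
have [d0|d0] := posnP d.
  have D0 : d%:R = 0 :> R by rewrite d0.
  rewrite D0 mul0r; apply: ler_rV_norm => // -[k kd].
  by have : (k < 0)%N by rewrite -d0.
rewrite /norm1 mulrA divff ?pnatr_eq0 -?lt0n// mul1r.
apply: ler_rV_norm => [|k]; first exact: sumr_ge0.
by rewrite (bigD1 k)//= lerDl sumr_ge0.
Qed.

Lemma norm1D w y : norm1 (w + y) <= norm1 w + norm1 y.
Proof.
rewrite /norm1 -mulrDr ler_wpM2l ?invr_ge0// -big_split; apply: ler_sum => k _.
by rewrite mxE ler_normD.
Qed.

Lemma norm1Z (s : R) w : norm1 (s *: w) = `|s| * norm1 w.
Proof.
rewrite /norm1 [RHS]mulrCA [in RHS]mulr_sumr; congr (_ * _).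
by apply: eq_bigr => k _; rewrite mxE normrM.
Qed.

End dual_norm.

Section nonlinearity.
Variables (R : realType) (K : nat) (g : R -> R) (m : R).
Hypothesis m0 : 0 < m.
Hypothesis g_ge : forall x, -1 <= x <= 1 -> m <= g x.
Local Notation d := (dimK K).
Implicit Types (x y w : 'rV[R]_d) (s t : R).

Lemma dimK_gt0 : (0 < d)%N.
Proof. by rewrite /dimK expn_gt0. Qed.

Lemma GKxD x y : GKx g (x + y) = GKx g x + GKx g y.
Proof. exact: mulmxDl. Qed.

Lemma GKxZ s x : GKx g (s *: x) = s *: GKx g x.
Proof. by rewrite /GKx scalemxAl. Qed.

Lemma GK_ge i j : d%:R ^- 2 * m <= GK K g i j.
Proof.
rewrite mxE; apply: ler_wpM2l; first by rewrite invr_ge0 exprn_ge0.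
have n1 (k : 'I_d) : `|dyadic R k| <= 1 by rewrite ler_norml; exact: Defs.dyadic_itv.
by apply: g_ge; rewrite -ler_norml normrM mulr_ile1.
Qed.

Lemma GK_ge0 i j : 0 <= GK K g i j.
Proof.
apply: le_trans (GK_ge i j); apply: mulr_ge0; last exact: ltW.
by rewrite invr_ge0 exprn_ge0.
Qed.

Lemma GKxE x k : GKx g x 0 k = \sum_j x 0 j * GK K g k j.
Proof. by rewrite mxE; apply: eq_bigr => j _; rewrite mxE. Qed.

Lemma GKx_orthant x : orthant x -> orthant (GKx g x).
Proof.
by move=> x0 k; rewrite GKxE sumr_ge0// => j _; apply: mulr_ge0; [exact: x0|exact: GK_ge0].
Qed.

Let one : 'rV[R]_d := const_mx 1.
Let c1 := GKx g one.
Let kap := d%:R * (d%:R ^- 2 * m) : R.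

Let kap_gt0 : 0 < kap.
Proof. by rewrite /kap !mulr_gt0 ?invr_gt0 ?exprn_gt0 ?ltr0n ?dimK_gt0. Qed.

Let c1_ge k : kap <= c1 0 k.
Proof.
rewrite /c1 GKxE /kap; apply: (@le_trans _ _ (\sum_(j < d) d%:R ^- 2 * m)).
  by rewrite sumr_const card_ord [leLHS]mulr_natl.
by apply: ler_sum => j _; rewrite mxE mul1r; exact: GK_ge.
Qed.

Let one_orthant s : 0 <= s -> orthant (s *: one).
Proof. by move=> s0 k; rewrite !mxE mulr1. Qed.

Let orthantD x y : orthant x -> orthant y -> orthant (x + y).
Proof. by move=> x0 y0 k; rewrite mxE addr_ge0. Qed.

Variable r : R.
Hypothesis r0 : 0 < r.

Let lin w := 8 * r / m * (norm1dual w - r).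

Let b0 : 0 <= 8 * r / m.
Proof. by rewrite divr_ge0 ?mulr_ge0 ?(ltW r0) ?(ltW m0). Qed.

Let CKtilde_ge w : lin w <= CKtilde g m r w.
Proof. by rewrite /CKtilde; case: ifP => // _; rewrite le_max lexx orbT. Qed.

Let lin_ge w : - (8 * r / m * r) <= lin w.
Proof.
rewrite /lin mulrBr; have := mulr_ge0 b0 (norm1dual_ge0 w); lra.
Qed.

(** Adding a multiple of [G 1] to a point of the cone increases the
    nonlinearity at most linearly, although the quadratic part is not Lipschitz:
    that part counts only where the dual norm is at most [2 r]. *)
Lemma CKtilde_add x s : orthant x -> 0 <= s ->
  CKtilde g m r (GKx g (x + s *: one)) <=
  CKtilde g m r (GKx g x) + (3 * r + 8 * r / m * norm1dual c1) * s.
Proof.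
move=> x0 s0; rewrite GKxD GKxZ -/c1; set w := GKx g x; set w' := w + _.
have w0 : orthant w by exact: GKx_orthant.
have c0 : orthant c1 by apply: GKx_orthant; rewrite -[one]scale1r; exact: one_orthant.
have w'E k : w' 0 k = w 0 k + s * c1 0 k by rewrite !mxE.
have w'0 : orthant w' by move=> k; rewrite w'E addr_ge0// mulr_ge0.
have linw' : lin w' <= lin w + 8 * r / m * norm1dual c1 * s.
  rewrite /lin -[8 * r / m * norm1dual c1 * s]mulrA -mulrDr ler_wpM2l//.
  by have := norm1dualD w (s *: c1); have := norm1dualZ c1 s0; rewrite -/w'; lra.
have rs0 : 0 <= 3 * r * s by rewrite !mulr_ge0 ?(ltW r0).
have bs0 : 0 <= 8 * r / m * norm1dual c1 * s by apply: mulr_ge0 => //; apply: mulr_ge0 => //; exact: norm1dual_ge0.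
rewrite mulrDl {1}/CKtilde -/(lin w'); case: ifPn => w'r; last first.
  by have := CKtilde_ge w; lra.
have d0 : 0 < d%:R :> R by rewrite ltr0n dimK_gt0.
have w'_le k : w' 0 k <= 2 * r / d%:R.
  rewrite ler_pdivlMr// mulrC -[X in _ * X]ger0_norm//.
  exact: le_trans (norm1dual_coord w' k) w'r.
have wr : norm1dual w <= 2 * r.
  apply: norm1dual_le => [|k]; first by rewrite mulr_ge0// ltW.
  apply: le_trans w'r; apply: le_trans (norm1dual_coord w' k).
  rewrite ler_wpM2l// !ger0_norm ?w'0 ?w0// w'E lerDl mulr_ge0//.
have sum_le (v : 'rV[R]_d) : (forall k, v 0 k <= 2 * r / d%:R) -> dot v one <= 2 * r.
  move=> vr; apply: (@le_trans _ _ (\sum_(k < d) 2 * r / d%:R)).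
    by apply: ler_sum => k _; rewrite mxE mulr1.
  by rewrite sumr_const card_ord -[leLHS]mulr_natl mulrC mulfVK// gt_eqF.
rewrite ge_max; apply/andP; split; last by have := CKtilde_ge w; lra.
have CKw' : CK g w' = CK g w + s * dot w one + s * dot (s *: c1) one / 2.
  have -> : w' = GKx g (x + s *: one) by rewrite GKxD GKxZ.
  rewrite !CKE//; last by apply: orthantD => //; exact: one_orthant.
  rewrite GKxD GKxZ -/w -/c1 dotDl !dotDr !dotZr !dotZl (dot_GKxC g one x) -/w.
  by field.
have h1 : s * dot w one <= s * (2 * r).
  apply: ler_wpM2l => //; apply: sum_le => k; apply: le_trans (w'_le k).
  by rewrite w'E lerDl mulr_ge0.
have h2 : s * dot (s *: c1) one <= s * (2 * r).
  apply: ler_wpM2l => //; apply: sum_le => k; apply: le_trans (w'_le k).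
  by rewrite w'E mxE lerDr.
have : CK g w <= CKtilde g m r w by rewrite /CKtilde wr le_max lexx.
rewrite CKw'; lra.
Qed.

Let HKset y := [set CKtilde g m r w | w in [set w | coneK g w /\ forall k, y 0 k <= w 0 k]].

Let HKset_inf y : has_inf (HKset y).
Proof.
split; last first.
  exists (- (8 * r / m * r)) => _ [w _ <-].
  exact: le_trans (lin_ge w) (CKtilde_ge w).
pose s := `|y| / kap.
have s0 : 0 <= s by rewrite divr_ge0// ltW.
exists (CKtilde g m r (GKx g (s *: one))), (GKx g (s *: one)) => //; split.
  by exists (s *: one) => //; exact: one_orthant.
move=> k; rewrite GKxZ mxE; apply: le_trans (ler_norm _) _; apply: le_trans (ler_coord y k) _.
by rewrite /s mulrAC ler_pdivlMr// ler_wpM2l// c1_ge.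
Qed.

Lemma HK_nondecreasing y y' : (forall k, y 0 k <= y' 0 k) -> HK g m r y <= HK g m r y'.
Proof.
move=> yy'; apply: lb_le_inf; first by have [] := HKset_inf y'.
move=> _ [w [wC y'w] <-]; apply: ge_inf; first by have [] := HKset_inf y.
by exists w => //; split => // k; exact: le_trans (yy' k) (y'w k).
Qed.

(** A point [w >= y'] of the cone becomes a point above [y] after adding a
    multiple of [G 1], because the entries of [G 1] are bounded below, [g] being
    at least [m]; this multiple is proportional to [|y - y'|], and
    [CKtilde_add] applies. *)
Lemma HK_lipschitz : exists2 C, 0 <= C & forall y y', HK g m r y <= HK g m r y' + C * `|y - y'|.
Proof.
pose C := (3 * r + 8 * r / m * norm1dual c1) / kap.
have C0 : 0 <= C.
  rewrite divr_ge0 ?(ltW kap_gt0)// addr_ge0//; first by rewrite mulr_ge0// ltW.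
  by rewrite mulr_ge0// norm1dual_ge0.
exists C => // y y'.
suff : HK g m r y - C * `|y - y'| <= HK g m r y' by lra.
apply: lb_le_inf; first by have [] := HKset_inf y'.
move=> _ [w [[x x0 xw] y'w] <-].
pose s := `|y - y'| / kap.
have s0 : 0 <= s by rewrite divr_ge0// ltW.
have := CKtilde_add x0 s0; rewrite xw.
have -> : (3 * r + 8 * r / m * norm1dual c1) * s = C * `|y - y'|.
  by rewrite /s /C mulrA mulrAC.
suff : HK g m r y <= CKtilde g m r (GKx g (x + s *: one)) by lra.
apply: ge_inf; first by have [] := HKset_inf y.
exists (GKx g (x + s *: one)) => //; split.
  by exists (x + s *: one) => //; apply: orthantD => //; exact: one_orthant.
move=> k; rewrite GKxD GKxZ xw !mxE -/c1.
have : `|y - y'| <= s * c1 0 k by rewrite /s mulrAC ler_pdivlMr// ler_wpM2l// c1_ge.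
have := ler_norm ((y - y') 0 k); have := ler_coord (y - y') k; have := y'w k.
by rewrite !mxE; lra.
Qed.

Section gradient_set.
Variable a : R.
Hypothesis a0 : 0 < a.
Let S : set 'rV[R]_d := calK' g a.
Let b : R := (Num.sqrt d%:R)^-1.

Let b_ge0 : 0 <= b. Proof. by rewrite invr_ge0 sqrtr_ge0. Qed.

Lemma calK'_nonempty : S !=set0.
Proof.
have z1 : norm1 (0 : 'rV[R]_d) = 0 by rewrite -(scale0r 0) norm1Z normr0 mul0r.
exists 0, 0, 0; split; last by rewrite addr0.
  exists 0; last by rewrite /GKx mul0mx.
  by split; [exact: orthant0|rewrite z1 ltW].
by apply: norm1dual_le => // k; rewrite mxE normr0 mulr0.
Qed.

Lemma calK'_convex q q' t : S q -> S q' -> 0 <= t <= 1 -> S (q + t *: (q' - q)).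
Proof.
move=> [_ [w [[x [x0 xa] <-] wb ->]]] [_ [w' [[x' [x'0 x'a] <-] w'b ->]]] /andP[t0 t1].
have t1' : 0 <= 1 - t by rewrite subr_ge0.
have E (v v' : 'rV[R]_d) : v + t *: (v' - v) = (1 - t) *: v + t *: v'.
  by apply/rowP => k; rewrite !mxE; ring.
exists (GKx g ((1 - t) *: x + t *: x')), ((1 - t) *: w + t *: w'); split.
- exists ((1 - t) *: x + t *: x') => //; split.
    by move=> k; rewrite !mxE addr_ge0// mulr_ge0.
  apply: le_trans (norm1D _ _) _; rewrite !norm1Z !ger0_norm//.
  have := ler_wpM2l t1' xa; have := ler_wpM2l t0 x'a; lra.
- apply: le_trans (norm1dualD _ _) _.
  have := ler_wpM2l t1' wb; have := ler_wpM2l t0 w'b.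
  have := norm1dualZ w t1'; have := norm1dualZ w' t0; lra.
- by rewrite E GKxD !GKxZ; apply/rowP => k; rewrite !mxE; ring.
Qed.

Lemma calK'_compact : compact S.
Proof.
have d0 : 0 < d%:R :> R by rewrite ltr0n dimK_gt0.
pose A := [set x : 'rV[R]_d | orthant x /\ norm1 x <= a].
pose B := [set w : 'rV[R]_d | norm1dual w <= b].
have cA : compact A.
  have -> : A = [set x : 'rV[R]_d | forall k, `[0, d%:R * a]%classic (x ord0 k)] `&`
      (@norm1 R d) @^-1` [set y | y <= a].
    apply/seteqP; split => x /=.
      move=> [x0 xa]; split => // k; rewrite in_itv/= x0/=.
      apply: le_trans (ler_norm _) _; apply: le_trans (ler_coord x k) _.
      by apply: le_trans (norm_le_norm1 x) _; rewrite ler_wpM2l.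
    by move=> [xk xa]; split => // k; have := xk k; rewrite in_itv/= => /andP[].
  apply: compact_closedI.
    by apply: (rV_compact (A := fun=> `[0, d%:R * a]%classic)) => k; exact: segment_compact.
  apply: preimage_closed; last exact: closed_le.
  move=> x _.
  apply: (@continuousM _ _ (fun=> d%:R^-1) (fun x : 'rV[R]_d => \sum_k `|x 0 k|)).
    exact: cst_continuous.
  have cs : continuous (fun x : 'rV[R]_d => \sum_k `|x 0 k|).
    apply: continuous_big => [|k _ z]; first exact: add_continuous.
    by apply: (@continuous_comp _ _ _ (fun M : 'rV[R]_d => M 0 k) (fun t : R => `|t|));
      [exact: coord_continuous|exact: norm_continuous].
  exact: cs.
have cB : compact B.
  have -> : B = [set w : 'rV[R]_d | forall k, `[- (b / d%:R), b / d%:R]%classic (w ord0 k)].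
    apply/seteqP; split => w /=.
      move=> wb k; rewrite in_itv/= -ler_norml ler_pdivlMr// mulrC.
      exact: le_trans (norm1dual_coord w k) wb.
    move=> wk; apply: norm1dual_le => // k.
    by have := wk k; rewrite in_itv/= -ler_norml ler_pdivlMr// mulrC.
  by apply: (rV_compact (A := fun=> `[- (b / d%:R), b / d%:R]%classic)) => k; exact: segment_compact.
have cG : continuous (fun x : 'rV[R]_d => GKx g x).
  under eq_fun do rewrite /GKx mulmx_sum_row.
  apply: continuous_big => [|k _ x]; first exact: add_continuous.
  by apply: continuousZr_tmp; exact: coord_continuous.
have -> : S = (fun p : 'rV[R]_d * 'rV[R]_d => p.1 + p.2) @` ((GKx g @` A) `*` B).
  apply/seteqP; split => q.
    by move=> [z [w [[x xA <-] wB ->]]]; exists (GKx g x, w) => //; split => //; exists x.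
  by move=> [[z w] [/= [x xA <-] wB] <-]; exists (GKx g x), w; split => //; exists x.
apply: continuous_compact; first by apply: continuous_subspaceT => p; exact: add_continuous.
apply: compact_setX => //; apply: continuous_compact => //.
exact: continuous_subspaceT.
Qed.

Lemma calK'_bounded : exists C, forall q, S q -> \sum_k `|q 0 k| <= C.
Proof.
have [C [_ SC]] := compact_bounded calK'_compact.
exists (d%:R * (C + 1)) => q Sq; apply: (@le_trans _ _ (\sum_(k < d) (C + 1))).
  apply: ler_sum => k _; apply: le_trans (ler_coord q k) _.
  by apply: SC => //; rewrite ltrDl.
by rewrite sumr_const card_ord mulr_natl.
Qed.

End gradient_set.

End nonlinearity.

(** * Test functions *)
Section smooth_expressions.
Variables (R : realType) (d : nat).
Local Notation V := (R * 'rV[R]_d)%type.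
Local Notation D := (@open_domain R d).
Implicit Types (p q v : V) (h : V -> R).

Lemma time_continuous : continuous (fun p : V => p.1).
Proof. by move=> p; exact: cvg_fst. Qed.

Lemma space_continuous k : continuous (fun p : V => p.2 0 k).
Proof.
move=> p; apply: (@continuous_comp _ _ _ (fun p : V => p.2) (fun M : 'rV[R]_d => M 0 k)).
  exact: cvg_snd.
exact: coord_continuous.
Qed.

Lemma near_open_domain q : D q -> \forall p \near q, D p.
Proof.
move=> [q1 q2].
have H1 : \forall p \near q, 0 < p.1 by apply: (cvgr_gt _ (@time_continuous q)).
have H2 : \forall p \near q, forall k : 'I_d, 0 < (p : V).2 0 k.
  have H k : nbhs q [set p : V | 0 < p.2 0 k].
    by apply: (cvgr_gt _ (@space_continuous k q)).
  have := @filter_forall V _ (fun (k : 'I_d) => [set p : V | 0 < p.2 0 k]) (nbhs q) (nbhs_filter q) H.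
  exact.
by near=> p; split; near: p.
Unshelve. all: by end_near. Qed.

(** Polynomials in the coordinates and in the inverses of the space
    coordinates. The derivatives of such a function are again of this form, so
    that the existence and the continuity of all iterated derivatives follow by
    induction. *)
Inductive expr : (V -> R) -> Prop :=
| expr_cst c : expr (fun=> c)
| expr_time : expr (fun p => p.1)
| expr_space k : expr (fun p => p.2 0 k)
| expr_inv k : expr (fun p => (p.2 0 k)^-1)
| expr_add f g : expr f -> expr g -> expr (fun p => f p + g p)
| expr_mul f g : expr f -> expr g -> expr (fun p => f p * g p).

Lemma expr_sum (I : Type) (s : seq I) (F : I -> V -> R) :
  (forall i, expr (F i)) -> expr (fun p => \sum_(i <- s) F i p).
Proof.
move=> eF; elim: s => [|i s IHs].
  by under eq_fun do rewrite big_nil; exact: expr_cst.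
by under eq_fun do rewrite big_cons; exact: expr_add.
Qed.

Lemma is_derive_additive (l : V -> R) q v :
  (forall s : R, l (s *: v + q) = s * l v + l q) -> is_derive q v l (l v).
Proof.
move=> ladd.
have H : s^-1 *: ((l \o shift q) (s *: v) - l q) @[s --> (0 : R)^'] --> l v.
  apply: cvg_near_cst; near=> s.
  have s0 : s != 0 by near: s; exact: nbhs_dnbhs_neq.
  by rewrite /= ladd addrK; change (s^-1 * (s * l v) = l v); rewrite mulKf.
by apply: DeriveDef; [apply/cvg_ex; exists (l v)|exact: cvg_lim H].
Unshelve. all: by end_near. Qed.

Lemma expr_continuous h q : expr h -> D q -> {for q, continuous h}.
Proof.
move=> eh [q1 q2]; elim: eh => [c||k|k|f g _ cf _ cg|f g _ cf _ cg].
- exact: cst_continuous.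
- exact: time_continuous.
- exact: space_continuous.
- by apply: cvgV; [rewrite gt_eqF|exact: space_continuous].
- exact: continuousD.
- exact: continuousM.
Qed.

Lemma expr_derive h v : expr h ->
  exists2 h', expr h' & forall q, D q -> is_derive q v h (h' q).
Proof.
elim=> [c||k|k|f g ef [f' ef' ff'] eg [g' eg' gg']|f g ef [f' ef' ff'] eg [g' eg' gg']].
- by exists (fun=> 0); [exact: expr_cst|move=> q _; exact: is_derive_cst].
- exists (fun=> v.1); first exact: expr_cst.
  by move=> q _; apply: (is_derive_additive (l := fun p => p.1)).
- exists (fun=> v.2 0 k); first exact: expr_cst.
  move=> q _; apply: (is_derive_additive (l := fun p => p.2 0 k)) => s.
  by rewrite /= !mxE.
- exists (fun p => - v.2 0 k * ((p.2 0 k)^-1 * (p.2 0 k)^-1)).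
    by apply: expr_mul; [exact: expr_cst|apply: expr_mul; exact: expr_inv].
  move=> q [_ /(_ k) qk].
  have dk : is_derive q v (fun p : V => p.2 0 k) (v.2 0 k).
    apply: (is_derive_additive (l := fun p => p.2 0 k)) => s.
    by rewrite /= !mxE.
  have q0 : q.2 0 k != 0 by rewrite gt_eqF.
  apply: DeriveDef; first by apply: derivableV => //; exact: ex_derive.
  rewrite deriveV// derive_val.
  change (- (q.2 0 k) ^- 2 * v.2 0 k = - v.2 0 k * ((q.2 0 k)^-1 * (q.2 0 k)^-1)).
  by field.
- exists (fun p => f' p + g' p); first exact: expr_add.
  by move=> q Dq; apply: is_deriveD; [exact: ff'|exact: gg'].
- exists (fun p => f p * g' p + g p * f' p).
    by apply: expr_add; exact: expr_mul.
  by move=> q Dq; apply: is_deriveM; [exact: ff'|exact: gg'].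
Qed.

Lemma expr_smooth h : expr h -> smooth_on D h.
Proof.
move=> eh s q Dq.
have [h' eh' hh'] : exists2 h', expr h' &
    forall p : V, D p -> foldr (fun v h => 'D_v h) h s p = h' p.
  elim: s => [|v s [h' eh' hh']]; first by exists h.
  have [h'' eh'' h'h''] := expr_derive v eh'.
  exists h'' => // p Dp; rewrite /= (@near_eq_derive _ _ _ _ h').
    by have [_ ->] := h'h'' p Dp.
  by have := near_open_domain Dp; apply: filterS => p'; exact: hh'.
have near_hh' : \forall p \near q, h' p = foldr (fun v h => 'D_v h) h s p.
  by have := near_open_domain Dq; apply: filterS => p' /hh' ->.
split=> [|v].
  have cont_eq (F : V -> R) : (\forall p \near q, h' p = F p) -> F q = h' q ->
      {for q, continuous F}.
    move=> h'F Fq; suff : F p @[p --> q] --> F q by []; rewrite Fq.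
    apply: cvg_trans (expr_continuous eh' Dq).
    by apply: near_eq_cvg; exact: h'F.
  exact: cont_eq near_hh' (hh' _ Dq).
apply: near_eq_derivable near_hh' _.
by have [h'' _ h'h''] := expr_derive v eh'; have [] := h'h'' q Dq.
Qed.

Variables (A0 B0 A th : R) (b : 'rV[R]_d).

(** The penalization of the comparison principle, as a function of one of the
    two points, up to a constant; [th] is the weight of the barrier. *)
Definition test_fun p : R := A0 * (p.1 * p.1) + B0 * p.1 +
  \sum_k (A * (p.2 0 k * p.2 0 k) + b 0 k * p.2 0 k + th * (p.2 0 k)^-1).

Lemma test_fun_expr : expr test_fun.
Proof.
apply: expr_add; first apply: expr_add; first apply: expr_mul.
- exact: expr_cst.
- by apply: expr_mul; exact: expr_time.
- by apply: expr_mul; [exact: expr_cst|exact: expr_time].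
apply: expr_sum => k; apply: expr_add; first apply: expr_add; first apply: expr_mul.
- exact: expr_cst.
- by apply: expr_mul; exact: expr_space.
- by apply: expr_mul; [exact: expr_cst|exact: expr_space].
- by apply: expr_mul; [exact: expr_cst|exact: expr_inv].
Qed.

Lemma test_fun_derive q v : D q ->
  'D_v test_fun q = (2 * A0 * q.1 + B0) * v.1 +
    \sum_k (2 * A * q.2 0 k + b 0 k - th * (q.2 0 k) ^- 2) * v.2 0 k.
Proof.
move=> [q1 q2].
have dt1 : is_derive q v (fun p : V => p.1) v.1.
  by apply: (is_derive_additive (l := fun p => p.1)).
have dx1 k : is_derive q v (fun p : V => p.2 0 k) (v.2 0 k).
  by apply: (is_derive_additive (l := fun p => p.2 0 k)) => s; rewrite /= !mxE.
have dinv k : is_derive q v (fun p : V => (p.2 0 k)^-1) (- (q.2 0 k) ^- 2 * v.2 0 k).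
  have q0 : q.2 0 k != 0 by rewrite gt_eqF.
  apply: DeriveDef; first by apply: derivableV => //; exact: ex_derive.
  by rewrite deriveV// derive_val.
have dcst (c : R) : is_derive q v (fun=> c) 0 by exact: is_derive_cst.
pose F (k : 'I_d) (p : V) := A * (p.2 0 k * p.2 0 k) + b 0 k * p.2 0 k + th * (p.2 0 k)^-1.
have dF k : is_derive q v (F k) ((2 * A * q.2 0 k + b 0 k - th * (q.2 0 k) ^- 2) * v.2 0 k).
  have := is_deriveD (is_deriveD (is_deriveM (dcst A) (is_deriveM (dx1 k) (dx1 k)))
     (is_deriveM (dcst (b 0 k)) (dx1 k))) (is_deriveM (dcst th) (dinv k)).
  move=> [Hd Hv]; apply: DeriveDef; first exact: Hd.
  by rewrite [LHS]Hv !scaler0 !addr0 /GRing.scale/=; ring.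
have dS : is_derive q v (fun p => \sum_k F k p)
    (\sum_k (2 * A * q.2 0 k + b 0 k - th * (q.2 0 k) ^- 2) * v.2 0 k).
  have := is_derive_sum dF; congr (is_derive _ _ _ _).
  by apply/funext => p; rewrite fct_sumE.
have := is_deriveD (is_deriveD (is_deriveM (dcst A0) (is_deriveM dt1 dt1))
   (is_deriveM (dcst B0) dt1)) dS.
move=> [_ dT]; rewrite [LHS]dT.
rewrite !scaler0 !addr0; congr (_ + _).
by rewrite /GRing.scale/=; ring.
Qed.

Lemma test_fun_dt q : D q -> dt test_fun q = 2 * A0 * q.1 + B0.
Proof.
by move=> Dq; rewrite /dt test_fun_derive//= mulr1 big1 ?addr0// => k _; rewrite mxE mulr0.
Qed.

Lemma test_fun_dx q k : D q ->
  dx test_fun q 0 k = 2 * A * q.2 0 k + b 0 k - th * (q.2 0 k) ^- 2.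
Proof.
move=> Dq; rewrite mxE test_fun_derive//= mulr0 add0r (bigD1 k)//= mxE !eqxx mulr1.
by rewrite big1 ?addr0// => j jk; rewrite mxE (negbTE jk) andbF mulr0.
Qed.

End smooth_expressions.

(** * Comparison principle *)
Lemma within_continuous_comp (T U W : topologicalType) (A : set U) (B : set T)
    (F : U -> W) (h : T -> U) :
  {within A, continuous F} -> continuous h -> (forall p, B p -> A (h p)) ->
  {within B, continuous (F \o h)}.
Proof.
move=> /subspace_continuousP cF ch BA; apply/subspace_continuousP => p Bp.
apply: cvg_comp (cF _ (BA _ Bp)) => Q /= /ch hQ.
have : nbhs p (fun q => A (h q) -> Q (h q)) by exact: hQ.
by apply: filterS => q AQ Bq; exact/AQ/BA.
Qed.

Lemma within_continuousB (R : realType) (T : topologicalType) (A : set T) (u v : T -> R) :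
  {within A, continuous u} -> {within A, continuous v} ->
  {within A, continuous (fun p => u p - v p)}.
Proof.
move=> /subspace_continuousP cu /subspace_continuousP cv.
apply/subspace_continuousP => p Ap.
by apply: cvgB; [exact: cu|exact: cv].
Qed.

Section comparison.
Variables (R : realType) (d : nat).
Local Notation V := (R * 'rV[R]_d)%type.
Variables (H : 'rV[R]_d -> R) (CH : R).
Hypothesis CH0 : 0 <= CH.
Hypothesis H_mono : forall y y' : 'rV[R]_d, (forall k, y 0 k <= y' 0 k) -> H y <= H y'.
Hypothesis H_lip : forall y y', H y <= H y' + CH * `|y - y'|.
Variables (f f' : R -> 'rV[R]_d -> R) (C : R).
Hypothesis C0 : 0 <= C.
Hypothesis f_cont : {within @closed_domain R d, continuous (fun p : V => f p.1 p.2)}.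
Hypothesis f'_cont : {within @closed_domain R d, continuous (fun p : V => f' p.1 p.2)}.
Hypothesis f_sub : forall (phi : V -> R) (q : V), smooth_on (@open_domain R d) phi ->
  @open_domain R d q -> (\forall p \near q, f p.1 p.2 - phi p <= f q.1 q.2 - phi q) ->
  dt phi q - H (dx phi q) <= 0.
Hypothesis f'_sup : forall (phi : V -> R) (q : V), smooth_on (@open_domain R d) phi ->
  @open_domain R d q -> (\forall p \near q, f' q.1 q.2 - phi q <= f' p.1 p.2 - phi p) ->
  0 <= dt phi q - H (dx phi q).
Hypothesis ft : forall (t : R) x, 0 <= t -> orthant x -> `|f t x - f 0 x| <= C * t.
Hypothesis f't : forall (t : R) x, 0 <= t -> orthant x -> `|f' t x - f' 0 x| <= C * t.
Hypothesis fx : forall (t : R) x y, 0 <= t -> orthant x -> orthant y -> `|f t x - f t y| <= C * `|x - y|.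
Hypothesis f'x : forall (t : R) x y, 0 <= t -> orthant x -> orthant y -> `|f' t x - f' t y| <= C * `|x - y|.
Hypothesis ff'0 : forall x, orthant x -> f 0 x <= f' 0 x.

Let pos (x : 'rV[R]_d) := forall k, 0 < x 0 k.

Let pos_orthant x : pos x -> orthant x.
Proof. by move=> x0 k; exact/ltW. Qed.

(** Between the two points the solutions are joined through time [0], where
    they are ordered. *)
Let diff_bound (t : R) x (s : R) y : 0 <= t -> 0 <= s -> orthant x -> orthant y ->
  f t x - f' s y <= C * t + C * s + \sum_k C * `|x 0 k - y 0 k|.
Proof.
move=> t0 s0 x0 y0.
have : C * `|x - y| <= \sum_k C * `|x 0 k - y 0 k|.
  rewrite -mulr_sumr ler_wpM2l//; apply: ler_rV_norm => [|k]; first exact: sumr_ge0.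
  by rewrite !mxE (bigD1 k)//= lerDl sumr_ge0.
have := ft t0 x0; have := f't s0 y0; have := f'x (lexx 0) x0 y0; have := ff'0 x0.
by rewrite !ler_norml; lra.
Qed.

Section doubling.
Variables (eps kap del th : R).
Hypothesis eps0 : 0 < eps.
Hypothesis kap0 : 0 < kap.
Hypothesis del0 : 0 < del.
Hypothesis th0 : 0 < th.

Let young (z : R) : C * `|z| <= z ^+ 2 / (2 * eps) + C ^+ 2 * eps / 2.
Proof.
have e2 : 0 < 2 * eps by rewrite mulr_gt0.
rewrite -[z ^+ 2](real_normK (num_real z)) -subr_ge0.
rewrite (_ : _ - _ = (`|z| - C * eps) ^+ 2 / (2 * eps)); last by field; rewrite gt_eqF.
by rewrite divr_ge0 ?sqr_ge0// ltW.
Qed.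

(** The penalization: the first terms pull the two points together, those in
    [kap] and [del] bound the maximum point, [kap * t] makes the inequality
    of the subsolution strict, and [th] weighs the barrier. *)
Let pk (a b : R) := (2 * eps)^-1 * (a - b) ^+ 2 + del * (a ^+ 2 + b ^+ 2) + th * (a^-1 + b^-1).
Let ptime (t s : R) := (2 * eps)^-1 * (t - s) ^+ 2 + kap * t + kap * (t ^+ 2 + s ^+ 2).
Let Psi t x s y := f t x - f' s y - (ptime t s + \sum_k pk (x 0 k) (y 0 k)).
(** A bound for the quadratic and barrier terms at points where [Psi] is
    non-negative; it does not depend on [del] and [th], which can thus be chosen
    after it. *)
Let C1 := C ^+ 2 / kap + d%:R * (C ^+ 2 * eps / 2).
Let rest (a b : R) := del * (a ^+ 2 + b ^+ 2) + th * (a^-1 + b^-1).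

Let Psi_le (t : R) x (s : R) y : 0 <= t -> 0 <= s -> pos x -> pos y ->
  Psi t x s y <= C1 - (kap / 2 * (t ^+ 2 + s ^+ 2) + \sum_k rest (x 0 k) (y 0 k)).
Proof.
move=> t0 s0 x0 y0.
have := diff_bound t0 s0 (pos_orthant x0) (pos_orthant y0).
have : \sum_k C * `|x 0 k - y 0 k| <= \sum_k (pk (x 0 k) (y 0 k) - rest (x 0 k) (y 0 k)) +
    d%:R * (C ^+ 2 * eps / 2).
  rewrite [d%:R * _]mulr_natl -[X in _ + _ *+ X](card_ord d) -sumr_const -big_split/=.
  apply: ler_sum => k _; apply: le_trans (young _) _.
  by rewrite /pk /rest le_eqVlt; apply/orP; left; apply/eqP; ring.
rewrite sumrB /Psi /C1 /ptime.
have time_bound (u : R) : C * u <= kap / 2 * u ^+ 2 + C ^+ 2 / kap / 2.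
  rewrite -subr_ge0 (_ : _ - _ = (kap * u - C) ^+ 2 / (2 * kap)); last by field; rewrite gt_eqF.
  by rewrite divr_ge0 ?sqr_ge0// mulr_ge0// ltW.
have := time_bound t; have := time_bound s.
have : 0 <= (t - s) ^+ 2 / (2 * eps) by rewrite divr_ge0 ?sqr_ge0// mulr_ge0// ltW.
have : 0 <= kap * t by rewrite mulr_ge0// ltW.
lra.
Qed.

Let rest_ge0 (a b : R) : 0 < a -> 0 < b -> 0 <= rest a b.
Proof.
move=> a0 b0; rewrite /rest addr_ge0// mulr_ge0 ?(ltW del0) ?(ltW th0)// addr_ge0 ?sqr_ge0//.
  by rewrite invr_ge0 ltW.
by rewrite invr_ge0 ltW.
Qed.

Let Psi_ge0 (t : R) x (s : R) y : 0 <= t -> 0 <= s -> pos x -> pos y -> 0 <= Psi t x s y ->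
  kap / 2 * (t ^+ 2 + s ^+ 2) <= C1 /\ forall k, rest (x 0 k) (y 0 k) <= C1.
Proof.
move=> t0 s0 x0 y0; have := Psi_le t0 s0 x0 y0.
have S0 k : 0 <= rest (x 0 k) (y 0 k) by exact: rest_ge0.
have : 0 <= \sum_k rest (x 0 k) (y 0 k) by exact: sumr_ge0.
have k2 : 0 <= kap / 2 * (t ^+ 2 + s ^+ 2).
  by rewrite mulr_ge0 ?divr_ge0 ?addr_ge0 ?sqr_ge0// ltW.
move=> h1 h2 h3; split=> [|k]; first lra.
have : rest (x 0 k) (y 0 k) <= \sum_k rest (x 0 k) (y 0 k).
  by rewrite (bigD1 k)//= lerDl sumr_ge0.
lra.
Qed.

Let W := (V * V)%type.

(** The coercive terms confine the maximization to a compact set, on which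
    [c <= x_k] because of the barrier. *)
Let Psi_max (t0 : R) x0 : 0 <= t0 -> pos x0 -> 0 <= Psi t0 x0 t0 x0 ->
  exists (t : R) x (s : R) y, [/\ 0 <= t /\ 0 <= s, pos x, pos y, Psi t0 x0 t0 x0 <= Psi t x s y &
   forall (t' : R) x' (s' : R) y', 0 <= t' -> 0 <= s' -> pos x' -> pos y' ->
     Psi t' x' s' y' <= Psi t x s y].
Proof.
move=> t00 x00 Psi00.
pose F (P : W) := Psi P.1.1 P.1.2 P.2.1 P.2.2.
have C10 : 0 <= C1.
  by rewrite addr_ge0 ?divr_ge0 ?mulr_ge0 ?sqr_ge0 ?divr_ge0// ltW.
pose T := 1 + 2 * C1 / kap.
pose X := 1 + C1 / del.
pose c := th / (C1 + 1).
have c0 : 0 < c by rewrite divr_gt0// ltr_wpDl.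
pose Bx := [set x : 'rV[R]_d | forall k, `[c, X]%classic (x ord0 k)].
pose BV : set V := `[0, T]%classic `*` Bx.
pose Bx2 : set W := BV `*` BV.
have Bx2P (t : R) x (s : R) y : 0 <= t -> 0 <= s -> pos x -> pos y -> 0 <= Psi t x s y ->
    Bx2 ((t, x), (s, y)).
  move=> t_ge0 s_ge0 xpos ypos /(Psi_ge0 t_ge0 s_ge0 xpos ypos)[hts hxy].
  have T1 : 1 <= T by rewrite /T lerDl divr_ge0 ?mulr_ge0// ltW.
  have X1 : 1 <= X by rewrite /X lerDl divr_ge0 ?mulr_ge0// ltW.
  have tT (u : R) : 0 <= u -> kap / 2 * u ^+ 2 <= C1 -> u <= T.
    move=> u0 uC; rewrite leNgt; apply/negP => Tu.
    have u1 : u <= u ^+ 2 by rewrite expr2 ler_peMl//; lra.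
    have : T * kap <= 2 * C1.
      apply: (@le_trans _ _ (u ^+ 2 * kap)); last by lra.
      by rewrite ler_pM2r//; lra.
    rewrite /T mulrDl mul1r divfK ?gt_eqF// => h.
    have : kap <= 0 by lra.
    by rewrite leNgt kap0.
  have xX (a : R) : 0 < a -> del * a ^+ 2 <= C1 -> a <= X.
    move=> a0 aC; rewrite leNgt; apply/negP => Xa.
    have a1 : a <= a ^+ 2 by rewrite expr2 ler_peMl//; lra.
    have : X * del <= C1.
      apply: (@le_trans _ _ (a ^+ 2 * del)); last by lra.
      by rewrite ler_pM2r//; lra.
    rewrite /X mulrDl mul1r divfK ?gt_eqF// => h.
    have : del <= 0 by lra.
    by rewrite leNgt del0.
  have xc (a : R) : 0 < a -> th * a^-1 <= C1 -> c <= a.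
    move=> a0; rewrite ler_pdivrMr// => aC; rewrite /c ler_pdivrMr; last by lra.
    by lra.
  have k0 (u : R) : 0 <= kap / 2 * u ^+ 2 by rewrite mulr_ge0 ?sqr_ge0// divr_ge0// ltW.
  have d0 (u : R) : 0 <= del * u ^+ 2 by rewrite mulr_ge0 ?sqr_ge0// ltW.
  have th_0 (u : R) : 0 < u -> 0 <= th * u^-1 by move=> u0; rewrite divr_ge0// ltW.
  split; split => /=.
  - rewrite in_itv/= t_ge0/=; apply: tT => //; have := k0 s; lra.
  - move=> k /=; rewrite in_itv/=; have := hxy k; rewrite /rest.
    have := d0 (x 0 k); have := d0 (y 0 k); have := th_0 _ (xpos k); have := th_0 _ (ypos k).
    by move=> *; rewrite xc ?xX//; lra.
  - rewrite in_itv/= s_ge0/=; apply: tT => //; have := k0 t; lra.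
  - move=> k /=; rewrite in_itv/=; have := hxy k; rewrite /rest.
    have := d0 (x 0 k); have := d0 (y 0 k); have := th_0 _ (xpos k); have := th_0 _ (ypos k).
    by move=> *; rewrite xc ?xX//; lra.
have cBx : compact Bx2.
  have cV : compact BV.
    apply: compact_setX; first exact: segment_compact.
    by apply: (rV_compact (A := fun=> `[c, X]%classic)) => k; exact: segment_compact.
  exact: compact_setX.
have Bx_pos p : BV p -> 0 <= p.1 /\ pos p.2.
  move=> [/= + px]; rewrite in_itv/= => /andP[-> _]; split => // k.
  by have /= := px k; rewrite in_itv/= => /andP[/(lt_le_trans c0)].
have cF : {within Bx2, continuous F}.
  have cf : {within Bx2, continuous (fun P : W => f P.1.1 P.1.2)}.
    apply: (within_continuous_comp (h := fst) f_cont) => [P|P [/Bx_pos[p1 p2] _]].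
      exact: cvg_fst.
    by split => //; exact: pos_orthant.
  have cf' : {within Bx2, continuous (fun P : W => f' P.2.1 P.2.2)}.
    apply: (within_continuous_comp (h := snd) f'_cont) => [P|P [_ /Bx_pos[p1 p2]]].
      exact: cvg_snd.
    by split => //; exact: pos_orthant.
  have cpen : {within Bx2, continuous (fun P : W =>
      ptime P.1.1 P.2.1 + \sum_k pk (P.1.2 0 k) (P.2.2 0 k))}.
    apply: continuous_in_subspaceT => P; rewrite inE => -[/Bx_pos[_ p1] /Bx_pos[_ p2]].
    have csq (h : W -> R) : {for P, continuous h} -> {for P, continuous (fun P => h P ^+ 2)}.
      by move=> ch; exact: (continuousM ch ch).
    have cc (e : R) (h : W -> R) : {for P, continuous h} -> {for P, continuous (fun P => e * h P)}.
      by move=> ch; exact: (continuousM (@cst_continuous _ _ e P) ch).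
    have ct : {for P, continuous (fun P : W => P.1.1)}.
      exact: (@continuous_comp _ _ _ (fun P : W => P.1) (fun p : V => p.1) P cvg_fst
        (@time_continuous R d _)).
    have cs : {for P, continuous (fun P : W => P.2.1)}.
      exact: (@continuous_comp _ _ _ (fun P : W => P.2) (fun p : V => p.1) P cvg_snd
        (@time_continuous R d _)).
    have cx k : {for P, continuous (fun P : W => P.1.2 0 k)}.
      exact: (@continuous_comp _ _ _ (fun P : W => P.1) (fun p : V => p.2 0 k) P cvg_fst
        (@space_continuous R d k _)).
    have cy k : {for P, continuous (fun P : W => P.2.2 0 k)}.
      exact: (@continuous_comp _ _ _ (fun P : W => P.2) (fun p : V => p.2 0 k) P cvg_snd
        (@space_continuous R d k _)).
    have cpk k : {for P, continuous (fun P : W => pk (P.1.2 0 k) (P.2.2 0 k))}.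
      have i1 : {for P, continuous (fun P : W => (P.1.2 0 k)^-1)}.
        by apply: cvgV; [rewrite gt_eqF|exact: cx].
      have i2 : {for P, continuous (fun P : W => (P.2.2 0 k)^-1)}.
        by apply: cvgV; [rewrite gt_eqF|exact: cy].
      exact: (continuousD (continuousD
        (cc (2 * eps)^-1 _ (csq _ (continuousB (cx k) (cy k))))
        (cc del _ (continuousD (csq _ (cx k)) (csq _ (cy k)))))
        (cc th _ (continuousD i1 i2))).
    have cpt : {for P, continuous (fun P : W => ptime P.1.1 P.2.1)}.
      exact: (continuousD (continuousD (cc (2 * eps)^-1 _ (csq _ (continuousB ct cs)))
         (cc kap _ ct)) (cc kap _ (continuousD (csq _ ct) (csq _ cs)))).
    apply: (continuousD cpt).
    by apply: cvg_big => [|k _]; [exact: add_continuous|exact: cpk].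
  exact: within_continuousB (within_continuousB cf cf') cpen.
have B0 : Bx2 ((t0, x0), (t0, x0)) by exact: Bx2P.
have [P PB Pmax] := compact_EVT_max (ex_intro _ _ B0) cBx cF.
rewrite inE in PB; have [/Bx_pos[p1 p2] /Bx_pos[p3 p4]] := PB.
have Pm (t' : R) x' (s' : R) y' : 0 <= t' -> 0 <= s' -> pos x' -> pos y' -> Psi t' x' s' y' <= F P.
  move=> t'0 s'0 x'0 y'0; have [P0|Pneg] := leP 0 (Psi t' x' s' y').
    by have := Pmax ((t', x'), (s', y')); rewrite inE; apply; exact: Bx2P.
  apply: le_trans (ltW Pneg) (le_trans Psi00 _).
  by have := Pmax ((t0, x0), (t0, x0)); rewrite inE; apply.
by exists P.1.1, P.1.2, P.2.1, P.2.2; split => //; exact: Pm.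
Qed.

(** At a time [0] the quadratic terms absorb the Lipschitz ones, up to an error
    of order [eps]. *)
Let Psi_boundary (t : R) x (s : R) y : 0 <= t -> 0 <= s -> pos x -> pos y -> t = 0 \/ s = 0 ->
  Psi t x s y <= d.+1%:R * (C ^+ 2 * eps / 2).
Proof.
move=> t0 s0 px py ts.
have := diff_bound t0 s0 (pos_orthant px) (pos_orthant py).
have -> : C * t + C * s = C * `|t - s|.
  by case: ts => ->; rewrite ?subr0 ?sub0r ?normrN ?mulr0 ?addr0 ?add0r ger0_norm.
have := young (t - s).
have : \sum_k C * `|x 0 k - y 0 k| <= \sum_k pk (x 0 k) (y 0 k) + d%:R * (C ^+ 2 * eps / 2).
  rewrite [d%:R * _]mulr_natl -[X in _ + _ *+ X](card_ord d) -sumr_const -big_split/=.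
  apply: ler_sum => k _; apply: le_trans (young _) _.
  by have := rest_ge0 (px k) (py k); rewrite /pk /rest; lra.
have : 0 <= kap * t by rewrite mulr_ge0// ltW.
have : 0 <= kap * (t ^+ 2 + s ^+ 2) by rewrite mulr_ge0 ?addr_ge0 ?sqr_ge0// ltW.
rewrite /Psi /ptime -[d.+1%:R]natr1.
lra.
Qed.

(** The inequalities of the subsolution and of the supersolution at the maximum
    point. The gradients of the two test functions differ by
    [2 del (x + y)] and by barrier terms of the favourable sign, which
    [H_mono] discards. *)
Let doubling_slopes (t : R) x (s : R) y : 0 < t -> 0 < s -> pos x -> pos y ->
  (forall (t' : R) x' (s' : R) y', 0 <= t' -> 0 <= s' -> pos x' -> pos y' ->
     Psi t' x' s' y' <= Psi t x s y) ->
  kap <= CH * `|(2 * del) *: (x + y)|.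
Proof.
move=> t0 s0 px py Pmax.
pose c := (2 * eps)^-1.
pose phi := test_fun (c + kap) (kap - 2 * c * s) (c + del) th (- (2 * c) *: y).
pose phi' := test_fun (- (c + kap)) (2 * c * t) (- (c + del)) (- th) ((2 * c) *: x).
have Dx : @open_domain R d (t, x) by [].
have Dy : @open_domain R d (s, y) by [].
have pkE a b : pk a b = c * (a * a) - 2 * c * b * a + c * (b * b) + del * (a * a) + del * (b * b)
    + th * a^-1 + th * b^-1 by rewrite /pk -/c; ring.
have phiE t' (x' : 'rV[R]_d) : ptime t' s + \sum_k pk (x' 0 k) (y 0 k) = phi (t', x') +
    ((c + kap) * (s * s) + \sum_k ((c + del) * (y 0 k * y 0 k) + th * (y 0 k)^-1)).
  rewrite /phi /test_fun/= /ptime -/c addrACA -big_split/=; congr (_ + _); first by ring.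
  by apply: eq_bigr => k _; rewrite pkE !mxE; ring.
have phi'E s' (y' : 'rV[R]_d) : ptime t s' + \sum_k pk (x 0 k) (y' 0 k) = - phi' (s', y') +
    ((c + kap) * (t * t) + kap * t + \sum_k ((c + del) * (x 0 k * x 0 k) + th * (x 0 k)^-1)).
  rewrite /phi' /test_fun/= /ptime -/c opprD addrACA -sumrN -big_split/=; congr (_ + _).
    by ring.
  by apply: eq_bigr => k _; rewrite pkE !mxE; ring.
have h1 : dt phi (t, x) - H (dx phi (t, x)) <= 0.
  apply: f_sub => //; first exact/expr_smooth/test_fun_expr.
  have := near_open_domain Dx; apply: filterS => -[t' x'] [/= t'0 px'].
  have := Pmax t' x' s y (ltW t'0) (ltW s0) px' py.
  by rewrite /Psi !phiE; lra.
have h2 : 0 <= dt phi' (s, y) - H (dx phi' (s, y)).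
  apply: f'_sup => //; first exact/expr_smooth/test_fun_expr.
  have := near_open_domain Dy; apply: filterS => -[s' y'] [/= s'0 py'].
  have := Pmax t x s' y' (ltW t0) (ltW s'0) px py'.
  by rewrite /Psi !phi'E; lra.
rewrite test_fun_dt//= in h1; rewrite test_fun_dt//= in h2.
have : H (dx phi (t, x)) <= H (dx phi' (s, y) + (2 * del) *: (x + y)).
  apply: H_mono => k; rewrite test_fun_dx// [leRHS]mxE test_fun_dx// !mxE/=.
  have : 0 <= th * (x 0 k) ^- 2 by rewrite mulr_ge0 ?(ltW th0)// invr_ge0 sqr_ge0.
  have : 0 <= th * (y 0 k) ^- 2 by rewrite mulr_ge0 ?(ltW th0)// invr_ge0 sqr_ge0.
  lra.
have := H_lip (dx phi' (s, y) + (2 * del) *: (x + y)) (dx phi' (s, y)).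
rewrite addrAC subrr add0r.
have : 0 <= kap * t by rewrite mulr_ge0// ltW.
have : 0 <= kap * s by rewrite mulr_ge0// ltW.
lra.
Qed.

(** A larger value would be attained at positive times; but then
    [doubling_slopes] bounds [kap] by a multiple of [del (x + y)], which is of
    order [sqrt (del C1)], so that a small [del] is contradictory. *)
Lemma doubling_le (t0 : R) x0 : 0 <= t0 -> pos x0 ->
  del * (C1 + 1) <= (kap / (8 * (CH + 1))) ^+ 2 ->
  Psi t0 x0 t0 x0 <= d.+1%:R * (C ^+ 2 * eps / 2).
Proof.
move=> t00 px0 delC; rewrite leNgt; apply/negP => P0.
have K0 : 0 <= d.+1%:R * (C ^+ 2 * eps / 2).
  by rewrite mulr_ge0// divr_ge0// mulr_ge0 ?sqr_ge0// ltW.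
have [t [x [s [y [[t_ge0 s_ge0] px py Pge Pmax]]]]] := Psi_max t00 px0 (le_trans K0 (ltW P0)).
have Plt := lt_le_trans P0 Pge.
have t_gt0 : 0 < t.
  rewrite lt_def t_ge0 andbT; apply/eqP => tz.
  by have := Psi_boundary t_ge0 s_ge0 px py (or_introl tz); rewrite leNgt Plt.
have s_gt0 : 0 < s.
  rewrite lt_def s_ge0 andbT; apply/eqP => sz.
  by have := Psi_boundary t_ge0 s_ge0 px py (or_intror sz); rewrite leNgt Plt.
have := doubling_slopes t_gt0 s_gt0 px py Pmax; apply/negP; rewrite -ltNge.
have [_ hrest] := Psi_ge0 t_ge0 s_ge0 px py (le_trans K0 (ltW Plt)).
have CH1 : 0 < CH + 1 by rewrite ltr_wpDl.
pose z := kap / (8 * (CH + 1)).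
have z0 : 0 < z by rewrite divr_gt0// mulr_gt0.
have small (a b : R) : 0 < a -> 0 < b -> rest a b <= C1 -> del * a <= z /\ del * b <= z.
  move=> a0 b0; rewrite /rest => hr.
  have aC : del * a ^+ 2 <= C1 + 1 /\ del * b ^+ 2 <= C1 + 1.
    have : 0 <= th * (a^-1 + b^-1).
      by rewrite mulr_ge0 ?(ltW th0)// addr_ge0 ?invr_ge0 ?ltW.
    have : 0 <= del * a ^+ 2 by rewrite mulr_ge0 ?sqr_ge0// ltW.
    have : 0 <= del * b ^+ 2 by rewrite mulr_ge0 ?sqr_ge0// ltW.
    by move=> *; split; lra.
  have sq (e : R) : 0 < e -> del * e ^+ 2 <= C1 + 1 -> del * e <= z.
    move=> e0 eC; rewrite -ler_sqr ?nnegrE ?(ltW z0) ?mulr_ge0 ?(ltW e0) ?(ltW del0)//.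
    apply: le_trans delC; rewrite exprMn expr2 -mulrA ler_wpM2l//; exact/ltW.
  by split; apply: sq => //; case: aC.
have nx : `|(2 * del) *: (x + y)| <= 4 * z.
  apply: ler_rV_norm => [|k]; first by rewrite mulr_ge0// ltW.
  rewrite !mxE ger0_norm; last first.
    by rewrite mulr_ge0 ?addr_ge0 ?mulr_ge0// ?ltW.
  by have [] := small _ _ (px k) (py k) (hrest k); lra.
apply: le_lt_trans (ler_wpM2l CH0 nx) _.
apply: (@le_lt_trans _ _ ((CH + 1) * (4 * z))).
  by apply: ler_wpM2r; [rewrite mulr_ge0// ltW|rewrite lerDl].
rewrite (_ : _ * _ = kap / 2); last by rewrite /z; field; rewrite gt_eqF.
by have := kap0; lra.
Qed.

End doubling.

Let comparison_pos (t0 : R) x0 : 0 <= t0 -> pos x0 -> f t0 x0 <= f' t0 x0.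
Proof.
move=> t00 px0; rewrite leNgt; apply/negP => lt0.
(* [eps] makes the bound of [doubling_le] at most [eta / 2]; each of [kap],
   [del] and [th] costs at most [eta / 8] at the point [(t0, x0)]. *)
pose eta := f t0 x0 - f' t0 x0.
have eta0 : 0 < eta by rewrite subr_gt0.
pose eps := eta / (d.+1%:R * C ^+ 2 + 1).
have D1 : 0 < d.+1%:R * C ^+ 2 + 1 by rewrite ltr_wpDl// mulr_ge0// sqr_ge0.
have eps0 : 0 < eps by rewrite divr_gt0.
have epsE : d.+1%:R * (C ^+ 2 * eps / 2) <= eta / 2.
  rewrite (_ : d.+1%:R * _ = (d.+1%:R * C ^+ 2) * eps / 2); last by ring.
  rewrite ler_pM2r// /eps mulrCA -[leRHS]mulr1 ler_pM2l//.
  by rewrite ler_pdivrMr// mul1r lerDl.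
pose T := 1 + t0 + 2 * t0 ^+ 2.
have T0 : 0 < T by have := sqr_ge0 t0; rewrite /T; lra.
pose kap := eta / 8 / T.
have kap0 : 0 < kap by rewrite !divr_gt0.
pose C1 := C ^+ 2 / kap + d%:R * (C ^+ 2 * eps / 2).
have C10 : 0 <= C1.
  apply: addr_ge0; first exact: divr_ge0 (sqr_ge0 _) (ltW kap0).
  apply: mulr_ge0 => //; apply: divr_ge0 => //.
  exact: mulr_ge0 (sqr_ge0 _) (ltW eps0).
have C11 : 0 < C1 + 1 by rewrite ltr_wpDl.
pose S2 := \sum_k ((x0 0 k) ^+ 2 + (x0 0 k) ^+ 2).
have S20 : 0 <= S2 by apply: sumr_ge0 => k _; rewrite addr_ge0 ?sqr_ge0.
pose S1 := \sum_k ((x0 0 k)^-1 + (x0 0 k)^-1).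
have S10 : 0 <= S1 by apply: sumr_ge0 => k _; rewrite addr_ge0 ?invr_ge0 ?ltW.
pose z := kap / (8 * (CH + 1)).
have z0 : 0 < z by rewrite divr_gt0// mulr_gt0// ltr_wpDl.
pose del := Num.min (z ^+ 2 / (C1 + 1)) (eta / 8 / (1 + S2)).
have S2p : 0 < 1 + S2 by rewrite ltr_wpDr.
have S1p : 0 < 1 + S1 by rewrite ltr_wpDr.
have del0 : 0 < del by rewrite lt_min !divr_gt0// exprn_gt0.
pose th := eta / 8 / (1 + S1).
have th0 : 0 < th by rewrite !divr_gt0.
have delC : del * (C1 + 1) <= z ^+ 2.
  by rewrite -ler_pdivlMr// ge_min lexx.
have := doubling_le eps0 kap0 del0 th0 t00 px0 delC.
have sumE : \sum_k ((2 * eps)^-1 * (x0 0 k - x0 0 k) ^+ 2 + del * (x0 0 k ^+ 2 + x0 0 k ^+ 2) +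
    th * ((x0 0 k)^-1 + (x0 0 k)^-1)) = del * S2 + th * S1.
  rewrite !mulr_sumr -big_split/=; apply: eq_bigr => k _.
  by rewrite subrr expr0n mulr0 add0r.
rewrite sumE subrr expr0n/= mulr0 add0r.
have e1 : kap * (1 + t0 + 2 * t0 ^+ 2) = eta / 8 by rewrite /kap divfK// gt_eqF.
have e2 : th * (1 + S1) = eta / 8 by rewrite /th divfK// gt_eqF.
have e3 : del * (1 + S2) <= eta / 8 by rewrite -ler_pdivlMr// ge_min lexx orbT.
rewrite -/eta; lra.
Qed.

(** On the faces of the orthant the inequality follows by approximation from
    the interior, both functions being Lipschitz in space. *)
Lemma comparison (t : R) x : 0 <= t -> orthant x -> f t x <= f' t x.
Proof.
move=> t0 x0; apply/ler_addgt0Pr => e e0.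
pose h := e / (2 * C + 1).
have C21 : 0 < 2 * C + 1 by rewrite ltr_wpDl// mulr_ge0.
have h0 : 0 < h by rewrite divr_gt0.
pose y := x + const_mx h : 'rV[R]_d.
have py : pos y by move=> k; rewrite !mxE ltr_wpDl//; exact: x0.
have yx : `|y - x| <= h.
  rewrite addrAC subrr add0r; apply: ler_rV_norm => [|k]; first exact/ltW.
  by rewrite mxE ger0_norm// ltW.
have hE : h * (2 * C + 1) = e by rewrite divfK// gt_eqF.
have Ch : C * `|y - x| <= C * h by rewrite ler_wpM2l.
have := fx t0 (pos_orthant py) x0; have := f'x t0 (pos_orthant py) x0.
have := comparison_pos t0 py.
rewrite !ler_norml; lra.
Qed.

End comparison.

(** * Convergence of monotone schemes *)
Section consistency.
Variables (R : realType) (d : nat).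
Local Notation V := (R * 'rV[R]_d)%type.

Lemma near_box (q : V) (P : set V) : (\forall p \near q, P p) ->
  exists2 r : R, 0 < r & forall p : V, `|p.1 - q.1| <= r ->
    (forall k, `|p.2 0 k - q.2 0 k| <= r) -> P p.
Proof.
move=> /nbhs_ballP[e /= e0 eP]; exists (e / 2); first by rewrite divr_gt0.
have e2 : e / 2 < e by lra.
move=> p p1 p2; apply: eP; split; rewrite -ball_normE/= distrC; apply: le_lt_trans e2 => //.
by apply: ler_rV_norm => [|k]; [rewrite divr_ge0// ltW|rewrite !mxE].
Qed.

Lemma compact_box (q : V) (r : R) :
  compact [set p : V | `|p.1 - q.1| <= r /\ forall k, `|p.2 0 k - q.2 0 k| <= r].
Proof.
have -> : [set p : V | `|p.1 - q.1| <= r /\ forall k, `|p.2 0 k - q.2 0 k| <= r] =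
    `[q.1 - r, q.1 + r]%classic `*`
    [set x : 'rV[R]_d | forall k, `[q.2 0 k - r, q.2 0 k + r]%classic (x ord0 k)].
  apply/seteqP; split=> p /= [p1 p2]; split.
  - by rewrite in_itv/= -ler_distl.
  - by move=> k; rewrite in_itv/= -ler_distl.
  - by move: p1; rewrite in_itv/= -ler_distl.
  - by move=> k; have := p2 k; rewrite in_itv/= -ler_distl.
apply: compact_setX; first exact: segment_compact.
by apply: (rV_compact (A := fun k => `[q.2 0 k - r, q.2 0 k + r]%classic)) => k;
  exact: segment_compact.
Qed.

Lemma line_mean_value (phi dphi : V -> R) (p v : V) (h : R) : 0 < h ->
  (forall s, 0 <= s <= h -> is_derive (p + s *: v) v phi (dphi (p + s *: v))) ->
  exists2 s, 0 <= s <= h & phi (p + h *: v) - phi p = dphi (p + s *: v) * h.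
Proof.
move=> h0 Dphi.
have Dl (s : R) : 0 <= s <= h ->
    is_derive s 1 (fun s => phi (p + s *: v)) (dphi (p + s *: v)).
  move=> /Dphi[Hd Hv].
  have E : (fun t : R => t^-1 *: (phi (p + (t *: 1 + s) *: v) - phi (p + s *: v))) =
      (fun t : R => t^-1 *: (phi (t *: v + (p + s *: v)) - phi (p + s *: v))).
    apply/funext => t; congr (_ *: (phi _ - _)).
    by rewrite [t *: 1]mulr1 scalerDl addrCA.
  split; first by rewrite /derivable/= E.
  by rewrite -Hv /derive/= E.
have [] := @MVT R (fun s => phi (p + s *: v)) (fun s => dphi (p + s *: v)) 0 h h0.
- move=> s; rewrite in_itv/= => /andP[s0 sh]; apply: Dl.
  by rewrite (ltW s0) (ltW sh).
- apply: continuous_in_subspaceT => s; rewrite inE/= in_itv/= => /Dl[Hd _].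
  by apply: differentiable_continuous; apply/derivable1_diffP.
- move=> s; rewrite in_itv/= => /andP[s0 sh]; rewrite scale0r addr0 subr0 => E.
  by exists s => //; rewrite (ltW s0) (ltW sh).
Qed.

Variables (H : 'rV[R]_d -> R) (CH : R).
Hypothesis CH0 : 0 <= CH.
Hypothesis H_mono : forall y y' : 'rV[R]_d, (forall k, y 0 k <= y' 0 k) -> H y <= H y'.
Hypothesis H_lip : forall y y', H y <= H y' + CH * `|y - y'|.
Variables (G : set_system nat) (GF : ProperFilter G) (eps del : nat -> R).
Hypothesis eps0 : forall n, 0 < eps n.
Hypothesis del0 : forall n, 0 < del n.
Hypothesis CFL : forall n, del n * CH <= eps n.
Hypothesis small : forall e : R, 0 < e -> \forall n \near G, eps n < e /\ del n < e.
Variables (u : nat -> R -> 'rV[R]_d -> R) (f : R -> 'rV[R]_d -> R).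
Hypothesis step : forall n (t : R) x, del n <= t -> u n t x = u n (t - del n) x +
  del n * H (\row_k ((u n (t - del n) (x + eps n *: ei R k) - u n (t - del n) x) / eps n)).
Hypothesis unif : forall B : set V, compact B -> B `<=` @closed_domain R d ->
  forall e : R, 0 < e ->
  \forall n \near G, forall p, B p -> `|u n p.1 p.2 - f p.1 p.2| <= e.

(** The argument of Barles and Souganidis. After the addition of [Q], which
    makes the maximum of [f - phi] at [q] strict, an almost maximum point
    [(t, x)] of [w - phi - Q], with [w] an approximation close to [f], is near
    [q]. One step of the scheme back in time, [w] lies below [phi + Q] plus a
    constant [c]; by the monotonicity of the scheme this remains true after the
    step, up to the error committed by the scheme on the smooth function
    [phi + Q]. The inequality follows since [w] almost touches [phi + Q + c] at
    [(t, x)].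

    Only derivatives near [q] that are continuous at [q] are used, so that the
    statement also applies to [- phi]. *)
Lemma scheme_subsolution (phi phit : V -> R) (phix : 'I_d -> V -> R) (q : V) :
  @open_domain R d q ->
  (\forall p \near q, is_derive p ((1, 0) : V) phi (phit p)) ->
  (forall k, \forall p \near q, is_derive p ((0, ei R k) : V) phi (phix k p)) ->
  {for q, continuous phit} -> (forall k, {for q, continuous (phix k)}) ->
  (\forall p \near q, f p.1 p.2 - phi p <= f q.1 q.2 - phi q) ->
  phit q <= H (\row_k phix k q).
Proof.
move=> Dq Dt Dx ct cx fmax; rewrite leNgt; apply/negP => gap.
set H0 := H _ in gap.
pose z := (phit q - H0) / (4 + 2 * CH).
have C4 : 0 < 4 + 2 * CH by have := CH0; lra.
have z0 : 0 < z by rewrite divr_gt0// subr_gt0.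
have zE : (4 + 2 * CH) * z = phit q - H0 by rewrite mulrC divfK// gt_eqF.
have [r0 r00 good] : exists2 r : R, 0 < r & forall p : V, `|p.1 - q.1| <= r ->
    (forall k, `|p.2 0 k - q.2 0 k| <= r) ->
    [/\ @open_domain R d p, is_derive p ((1, 0) : V) phi (phit p) /\ `|phit p - phit q| <= z,
      forall k, is_derive p ((0, ei R k) : V) phi (phix k p), forall k, `|phix k p - phix k q| <= z &
      f p.1 p.2 - phi p <= f q.1 q.2 - phi q].
  apply: near_box.
  have N1 : \forall p \near q, `|phit p - phit q| <= z.
    by have /cvgrPdist_le/(_ _ z0) := ct; apply: filterS => p; rewrite distrC.
  have N2 : \forall p \near q, forall k, `|phix k p - phix k q| <= z.
    apply: (@filter_forall V _ (fun k p => `|phix k p - phix k q| <= z) (nbhs q)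
      (nbhs_filter q)) => k.
    by have /cvgrPdist_le/(_ _ z0) := cx k; apply: filterS => p; rewrite distrC.
  have N3 : \forall p \near q, forall k, is_derive p ((0, ei R k) : V) phi (phix k p).
    exact: (@filter_forall V _ (fun k p => is_derive p ((0, ei R k) : V) phi (phix k p)) (nbhs q)
      (nbhs_filter q)).
  have N4 := near_open_domain Dq.
  apply: filterS (filterI N1 (filterI N2 (filterI N3 (filterI N4 (filterI Dt fmax))))).
  by move=> p [? [? [? [? [? ?]]]]]; split.
pose r := Num.min r0 (z / 2).
have r_gt0 : 0 < r by rewrite lt_min r00 divr_gt0.
have rz : 2 * r <= z by have : r <= z / 2 by [rewrite ge_min lexx orbT]; lra.
have rr0 : r <= r0 by rewrite ge_min lexx.
pose B := [set p : V | `|p.1 - q.1| <= r /\ forall k, `|p.2 0 k - q.2 0 k| <= r].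
have goodB p : B p -> [/\ @open_domain R d p,
    is_derive p ((1, 0) : V) phi (phit p) /\ `|phit p - phit q| <= z,
    forall k, is_derive p ((0, ei R k) : V) phi (phix k p), forall k, `|phix k p - phix k q| <= z &
    f p.1 p.2 - phi p <= f q.1 q.2 - phi q].
  by move=> [p1 p2]; apply: good => [|k]; exact: le_trans rr0.
have Bcl : B `<=` @closed_domain R d.
  by move=> p /goodB[[p1 p2] _ _ _ _]; split=> [|k]; exact/ltW.
pose eta := r ^+ 2 / 16.
have eta0 : 0 < eta by rewrite divr_gt0// exprn_gt0.
have ra0 : 0 < Num.min (r / 4) (eta / z) by rewrite lt_min (divr_gt0 eta0 z0) divr_gt0.
have [n [nB [en dn]]] := filter_ex (filterI (unif (@compact_box q r) Bcl eta0) (small ra0)).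
rewrite lt_min in en; rewrite lt_min in dn.
have [{}en _] := andP en; have [dn1] := andP dn; rewrite ltr_pdivlMr// => dn2.
have := eps0 n; have := del0 n; have := CFL n; have := @step n.
move: (u n) nB (eps n) (del n) en dn1 dn2 {dn} => w wB e dl er dr dz wstep cfl dl0 e0.
pose Q (p : V) := (p.1 - q.1) ^+ 2 + \sum_k (p.2 0 k - q.2 0 k) ^+ 2.
have Bq : B q by split=> [|k]; rewrite subrr normr0 ltW.
have Qq : Q q = 0.
  by rewrite /Q subrr expr0n add0r/= big1// => k _; rewrite subrr expr0n.
have Q0 p : 0 <= Q p by rewrite addr_ge0 ?sqr_ge0// sumr_ge0// => k _; exact: sqr_ge0.
pose X (p : V) := w p.1 p.2 - phi p - Q p.
have Xsup : has_sup (X @` B).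
  split; first by exists (X q); exists q.
  exists (f q.1 q.2 + eta - phi q) => _ [p Bp <-].
  have [_ _ _ _ fp] := goodB p Bp; have := wB p Bp; have := Q0 p.
  by rewrite ler_norml /X; lra.
(* [w] may be discontinuous in time, hence only an almost maximum point *)
have [_ [p Bp <-] pmax] := sup_adherent (mulr_gt0 dl0 z0) Xsup.
have {}pmax p' : B p' -> X p' <= X p + dl * z.
  move=> Bp'; have : X p' <= sup (X @` B) by apply: sup_upper_bound => //; exists p'.
  lra.
have Qp : Q p <= (r / 2) ^+ 2.
  have := pmax q Bq; rewrite {1}/X Qq /X; have := wB p Bp; have := wB q Bq.
  have [_ _ _ _] := goodB p Bp; rewrite !ler_norml /eta in dz *.
  have : (r / 2) ^+ 2 = 4 * (r ^+ 2 / 16) by field.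
  have := sqr_ge0 r; lra.
have sq_le (a : R) : a ^+ 2 <= (r / 2) ^+ 2 -> `|a| <= r / 2.
  by rewrite -[a ^+ 2](real_normK (num_real a)) ler_sqr ?nnegrE// divr_ge0// ltW.
have p1 : `|p.1 - q.1| <= r / 2.
  apply: sq_le; apply: le_trans Qp; rewrite /Q lerDl sumr_ge0// => k _; exact: sqr_ge0.
have p2 k : `|p.2 0 k - q.2 0 k| <= r / 2.
  apply: sq_le; apply: le_trans Qp; rewrite /Q (bigD1 k)//= addrCA lerDl.
  by rewrite addr_ge0 ?sqr_ge0// sumr_ge0// => j _; exact: sqr_ge0.
case: p p1 p2 {Qp} Bp pmax => t x /= p1 p2 Bp pmax.
have Bs (s : R) : 0 <= s <= dl -> B (t - s, x).
  move=> /andP[s0 sd]; split=> /= [|k]; last by have := p2 k; have := r_gt0; lra.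
  by move: p1; rewrite !ler_norml; lra.
have Bsx (s : R) k : 0 <= s <= e -> B (t - dl, x + s *: ei R k).
  move=> /andP[s0 sd]; split=> /= [|j].
    by move: p1; rewrite !ler_norml; lra.
  rewrite !mxE/=; have := p2 j; rewrite !ler_norml.
  by case: (j == k) => /=; rewrite ?mulr1 ?mulr0; lra.
have Bs0 : B (t - dl, x) by apply: Bs; rewrite lexx ltW.
have dlt : dl <= t by have [[/= ? _] _ _ _ _] := goodB _ Bs0; lra.
pose c := X (t, x) + dl * z.
pose A := phi (t - dl, x) + Q (t - dl, x) + c - w (t - dl) x.
have A0 : 0 <= A by have := pmax _ Bs0; rewrite /A /c {1}/X/=; lra.
have Ht : (phit q - z) * dl <= phi (t, x) - phi (t - dl, x).
  have E (s : R) : (t - dl, x) + s *: ((1, 0) : V) = (t - (dl - s), x) :> V.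
    by apply: injective_projections => /=; [rewrite [s *: 1]mulr1; ring|rewrite scaler0 addr0].
  have Bs' (s : R) : 0 <= s <= dl -> B ((t - dl, x) + s *: ((1, 0) : V)).
    by move=> /andP[s0 sd]; rewrite E; apply: Bs; rewrite subr_ge0 sd/= gerBl.
  have [s sd] : exists2 s, 0 <= s <= dl & phi ((t - dl, x) + dl *: ((1, 0) : V)) -
      phi (t - dl, x) = phit ((t - dl, x) + s *: ((1, 0) : V)) * dl.
    by apply: line_mean_value => // s /Bs'/goodB[_ []].
  have [_ [_ hz] _ _ _] := goodB _ (Bs' s sd).
  rewrite {1}E subrr subr0 => ->; rewrite ler_pM2r//.
  by move: hz; rewrite ler_norml; lra.
have Qt : - (z * dl) <= Q (t, x) - Q (t - dl, x).
  rewrite /Q/= (_ : _ - _ = dl * (2 * (t - q.1) - dl)); last by ring.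
  rewrite [z * dl]mulrC -[- (dl * z)]mulrN ler_pM2l//; move: p1; rewrite ler_norml; lra.
have Hx k : phi (t - dl, x + e *: ei R k) + Q (t - dl, x + e *: ei R k) -
    phi (t - dl, x) - Q (t - dl, x) <= (phix k q + 2 * z) * e.
  have E (s : R) : (t - dl, x) + s *: ((0, ei R k) : V) = (t - dl, x + s *: ei R k) :> V.
    by apply: injective_projections => //=; rewrite [s *: 0]mulr0 addr0.
  have [s sd] : exists2 s, 0 <= s <= e & phi ((t - dl, x) + e *: ((0, ei R k) : V)) -
      phi (t - dl, x) = phix k ((t - dl, x) + s *: ((0, ei R k) : V)) * e.
    apply: line_mean_value => // s se; have := Bsx s k se; rewrite -E.
    by move=> /goodB[_ _ + _ _]; apply.
  have [_ _ _ + _] := goodB _ (Bsx s k sd) => /(_ k) hz.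
  rewrite {1}E => phiE.
  have QE : Q (t - dl, x + e *: ei R k) - Q (t - dl, x) = e * (2 * (x 0 k - q.2 0 k) + e).
    rewrite /Q/= [in LHS](bigD1 k)//= [X in _ - (_ + X)](bigD1 k)//= !mxE/= eqxx mulr1.
    rewrite (eq_bigr (fun j => (x 0 j - q.2 0 j) ^+ 2)).
      by ring.
    by move=> j jk; rewrite !mxE/= (negbTE jk) mulr0 addr0.
  rewrite (_ : _ - _ - _ = (phi (t - dl, x + e *: ei R k) - phi (t - dl, x)) +
    (Q (t - dl, x + e *: ei R k) - Q (t - dl, x))); last by ring.
  rewrite phiE QE E [e * _]mulrC -mulrDl ler_pM2r//.
  have := p2 k; move: hz; rewrite !ler_norml; lra.
pose row := \row_k ((w (t - dl) (x + e *: ei R k) - w (t - dl) x) / e).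
(* [A] is the gap between [phi + Q + c] and [w] at the previous time; by the
   condition [cfl] its effect on [H row] is compensated by its own decrease. *)
have HA : H row <= H0 + CH * (2 * z + A / e).
  have Ae0 : 0 <= A / e := divr_ge0 A0 (ltW e0).
  have a0 : 0 <= 2 * z + A / e := addr_ge0 (mulr_ge0 (ler0n _ 2) (ltW z0)) Ae0.
  apply: (@le_trans _ _ (H (\row_k phix k q + const_mx (2 * z + A / e)))).
    apply: H_mono => k; rewrite !mxE ler_pdivrMr// addrA [leRHS]mulrDl divfK ?gt_eqF//.
    have Bk : B (t - dl, x + e *: ei R k) by apply: Bsx; rewrite lexx ltW.
    by have := pmax _ Bk; have := Hx k; rewrite /A /c {1}/X/=; lra.
  apply: le_trans (H_lip _ (\row_k phix k q)) _; rewrite lerD2l ler_wpM2l//.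
  rewrite addrAC subrr add0r; apply: ler_rV_norm => // k.
  by rewrite mxE ger0_norm.
have := wstep t x dlt; rewrite -/row => wE.
have h1 : dl * H row <= dl * (H0 + 2 * CH * z) + A.
  apply: le_trans (ler_wpM2l (ltW dl0) HA) _.
  have E (h y b : R) : dl * (h + CH * (2 * y + b)) = dl * (h + 2 * CH * y) + dl * CH * b.
    by ring.
  rewrite E.
  rewrite lerD2l; apply: le_trans (ler_wpM2r (divr_ge0 A0 (ltW e0)) cfl) _.
  by rewrite mulrCA divff ?gt_eqF// mulr1.
have : dl * (phit q - z - z) <= dl * (z + H0 + 2 * CH * z).
  by move: h1; rewrite /A /c /X/=; lra.
rewrite ler_pM2l//; lra.
Qed.

End consistency.

(** * Existence by an explicit monotone scheme *)
Section existence.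
Variables (R : realType) (d : nat).
Local Notation V := (R * 'rV[R]_d)%type.
Variables (H : 'rV[R]_d -> R) (CH : R).
Hypothesis CH0 : 0 <= CH.
Hypothesis H_mono : forall y y' : 'rV[R]_d, (forall k, y 0 k <= y' 0 k) -> H y <= H y'.
Hypothesis H_lip : forall y y', H y <= H y' + CH * `|y - y'|.

Section limit_is_viscosity.
Variables (G : set_system nat) (GF : ProperFilter G) (eps del : nat -> R).
Hypothesis eps0 : forall n, 0 < eps n.
Hypothesis del0 : forall n, 0 < del n.
Hypothesis CFL : forall n, del n * CH <= eps n.
Hypothesis small : forall e : R, 0 < e -> \forall n \near G, eps n < e /\ del n < e.
Variables (u : nat -> R -> 'rV[R]_d -> R) (f : R -> 'rV[R]_d -> R).
Hypothesis step : forall n (t : R) x, del n <= t -> u n t x = u n (t - del n) x +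
  del n * H (\row_k ((u n (t - del n) (x + eps n *: ei R k) - u n (t - del n) x) / eps n)).
Hypothesis unif : forall B : set V, compact B -> B `<=` @closed_domain R d ->
  forall e : R, 0 < e ->
  \forall n \near G, forall p, B p -> `|u n p.1 p.2 - f p.1 p.2| <= e.

(** The functions [- u n] follow the scheme of the Hamiltonian [- H (- p)],
    which has the same monotonicity and Lipschitz properties. *)
Lemma scheme_supersolution (phi phit : V -> R) (phix : 'I_d -> V -> R) (q : V) :
  @open_domain R d q ->
  (\forall p \near q, is_derive p ((1, 0) : V) phi (phit p)) ->
  (forall k, \forall p \near q, is_derive p ((0, ei R k) : V) phi (phix k p)) ->
  {for q, continuous phit} -> (forall k, {for q, continuous (phix k)}) ->
  (\forall p \near q, f q.1 q.2 - phi q <= f p.1 p.2 - phi p) ->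
  H (\row_k phix k q) <= phit q.
Proof.
move=> Dq Dt Dx ct cx fmin; rewrite -lerN2.
have -> : - H (\row_k phix k q) = - H (- \row_k (- phix k q)).
  by congr (- H _); apply/rowP => k; rewrite !mxE opprK.
apply: (@scheme_subsolution R d (fun p => - H (- p)) CH CH0 _ _ G GF eps del eps0 del0 CFL small
  (fun n t x => - u n t x) (fun t x => - f t x) _ _ (fun p => - phi p) (fun p => - phit p)
  (fun k p => - phix k p) q Dq).
- by move=> y y' yy'; rewrite lerN2; apply: H_mono => k; rewrite !mxE lerN2.
- move=> y y'; have := H_lip (- y') (- y); rewrite opprK [- y' + y]addrC; lra.
- move=> n t x /step ->; rewrite opprD -mulrN; congr (_ + _ * - H _).
  by apply/rowP => k; rewrite !mxE -mulNr opprD !opprK addrC.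
- move=> B cB Bcl e e0; have := unif cB Bcl e0; apply: filterS => n nB p Bp.
  by rewrite -opprD normrN; exact: nB.
- by apply: filterS Dt => p; exact: is_deriveN.
- by move=> k; apply: filterS (Dx k) => p; exact: is_deriveN.
- exact: continuousN.
- by move=> k; exact: continuousN.
- by apply: filterS fmin => p; lra.
Qed.

Lemma scheme_viscosity (phi : V -> R) (q : V) :
  smooth_on (@open_domain R d) phi -> @open_domain R d q ->
  ((\forall p \near q, f p.1 p.2 - phi p <= f q.1 q.2 - phi q) -> dt phi q - H (dx phi q) <= 0) /\
  ((\forall p \near q, f q.1 q.2 - phi q <= f p.1 p.2 - phi p) -> 0 <= dt phi q - H (dx phi q)).
Proof.
move=> phiS Dq.
have Dv v : \forall p \near q, is_derive p v phi ('D_v phi p).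
  apply: filterS (near_open_domain Dq) => p Dp; apply: DeriveDef => //.
  by have [_] := phiS [::] p Dp; apply.
have cv v : {for q, continuous ('D_v phi)} by have [] := phiS [:: v] q Dq.
split=> fmax; rewrite ?subr_le0 ?subr_ge0.
  exact: (scheme_subsolution CH0 H_mono H_lip GF eps0 del0 CFL small step unif
    (phit := 'D_((1, 0) : V) phi) (phix := fun k => 'D_((0, ei R k) : V) phi) Dq).
exact: (scheme_supersolution (phit := 'D_((1, 0) : V) phi)
  (phix := fun k => 'D_((0, ei R k) : V) phi) Dq).
Qed.

End limit_is_viscosity.

Variables (rho u0 : 'rV[R]_d -> R) (L : R).
Hypothesis L0 : 0 <= L.
Hypothesis rhoL : forall h, rho h <= L * `|h|.
Hypothesis u0_rho : forall x h, u0 (x + h) - u0 x <= rho h.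

Let bounded_slope (v : 'rV[R]_d -> R) := forall x h, v (x + h) - v x <= rho h.

Let bounded_slope_lip v x h : bounded_slope v -> `|v (x + h) - v x| <= L * `|h|.
Proof.
move=> bv; rewrite ler_norml (le_trans (bv x h) (rhoL h)) andbT.
have := bv (x + h) (- h); have := rhoL (- h); rewrite addrK normrN; lra.
Qed.

Let eps (n : nat) : R := 2^-1 ^+ n.
Let del (n : nat) : R := eps n / (CH + 1).
Let CH1 : 0 < CH + 1. Proof. by rewrite ltr_wpDl. Qed.
Let eps0 n : 0 < eps n. Proof. by rewrite exprn_gt0. Qed.
Let del0 n : 0 < del n. Proof. exact: divr_gt0. Qed.
Let CFL n : del n * CH <= eps n.
Proof.
by rewrite /del -mulrA ler_piMr ?(ltW (eps0 n))// mulrC ler_pdivrMr// mul1r lerDl.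
Qed.
Let del_eps n : del n <= eps n.
Proof. by rewrite ler_pdivrMr// ler_peMr ?(ltW (eps0 n))// lerDr. Qed.

Let small e : 0 < e -> \forall n \near \oo, eps n < e /\ del n < e.
Proof.
move=> e0; have : eps n @[n --> \oo] --> (0 : R).
  by apply: cvg_expr; rewrite ger0_norm// invf_lt1// ltr1n.
move=> /cvgrPdist_lt/(_ _ e0); apply: filterS => n; rewrite sub0r normrN gtr0_norm// => en.
by split=> //; exact: le_lt_trans (del_eps n) en.
Qed.

(** Forward differences, because a non-decreasing [H] then makes the new value
    non-decreasing in the neighbouring values; the small step [del n] takes care
    of the dependence on the value at [x] itself. *)
Definition scheme_step n (v : 'rV[R]_d -> R) x : R :=
  v x + del n * H (\row_k ((v (x + eps n *: ei R k) - v x) / eps n)).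

Lemma scheme_step_mono n v w : (forall x, v x <= w x) ->
  forall x, scheme_step n v x <= scheme_step n w x.
Proof.
move=> vw x; pose a := w x - v x.
have a0 : 0 <= a by rewrite subr_ge0.
have ae0 : 0 <= a / eps n := divr_ge0 a0 (ltW (eps0 n)).
rewrite /scheme_step; set rv := \row_k _; set rw := \row_k _.
have h : H rv <= H rw + CH * (a / eps n).
  apply: (@le_trans _ _ (H (rw + const_mx (a / eps n)))).
    apply: H_mono => k; rewrite !mxE -mulrDl ler_pM2r ?invr_gt0//.
    by have := vw (x + eps n *: ei R k); rewrite /a; lra.
  apply: le_trans (H_lip _ rw) _; rewrite lerD2l ler_wpM2l//.
  by rewrite addrAC subrr add0r; apply: ler_rV_norm => // k; rewrite mxE ger0_norm.
have h1 : del n * H rv <= del n * H rw + a.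
  apply: le_trans (ler_wpM2l (ltW (del0 n)) h) _; rewrite mulrDr lerD2l [leLHS]mulrA.
  apply: le_trans (ler_wpM2r ae0 (CFL n)) _.
  by rewrite mulrCA divff ?gt_eqF// mulr1.
by move: h1; rewrite /a; lra.
Qed.

(** By monotonicity, the inequality between a translate of [v] and [v] plus a
    constant is preserved by the step, which commutes with both operations. *)
Lemma scheme_step_slope n v : bounded_slope v -> bounded_slope (scheme_step n v).
Proof.
move=> bv x h.
have h1 : scheme_step n (fun x => v (x + h)) x <= scheme_step n (fun x => v x + rho h) x.
  by apply: scheme_step_mono => y; have := bv y h; lra.
have E1 : scheme_step n (fun x => v (x + h)) x = scheme_step n v (x + h).
  by rewrite /scheme_step; congr (_ + _ * H _); apply/rowP => k; rewrite !mxE addrAC.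
have E2 : scheme_step n (fun x => v x + rho h) x = scheme_step n v x + rho h.
  rewrite /scheme_step addrAC; congr (_ + _ * H _ + _); apply/rowP => k; rewrite !mxE.
  by congr (_ / _); ring.
by move: h1; rewrite E1 E2; lra.
Qed.

Let M := `|H 0| + CH * L.

Let M0 : 0 <= M. Proof. by rewrite addr_ge0 ?mulr_ge0. Qed.

Lemma scheme_step_dist n v x : bounded_slope v -> `|scheme_step n v x - v x| <= del n * M.
Proof.
move=> bv; rewrite /scheme_step addrAC subrr add0r normrM gtr0_norm// ler_pM2l//.
set p := \row_k _.
have pL : `|p| <= L.
  apply: ler_rV_norm => // k; rewrite mxE normrM [X in _ * X]gtr0_norm ?invr_gt0//.
  rewrite ler_pdivrMr//; apply: le_trans (bounded_slope_lip _ _ bv) _.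
  rewrite ler_wpM2l// ; apply: ler_rV_norm => [|j]; first exact/ltW.
  rewrite !mxE/= normrM [X in X * _]gtr0_norm// ger0_norm// ler_piMr ?(ltW (eps0 n))//.
  by case: (j == k).
have CpL : CH * `|p| <= CH * L by rewrite ler_wpM2l.
have := H_lip p 0; have := H_lip 0 p; rewrite subr0 sub0r normrN /M.
rewrite ler_norml; have := ler_norm (H 0); have := ler_norm (- H 0); rewrite normrN; lra.
Qed.

Let u n (t : R) x := iter (Num.trunc (t / del n)) (scheme_step n) u0 x.

Let iter_slope n i : bounded_slope (iter i (scheme_step n) u0).
Proof. by elim: i => //= i ih; exact: scheme_step_slope. Qed.

Let iter_dist n i j x :
  `|iter (j + i) (scheme_step n) u0 x - iter i (scheme_step n) u0 x| <= j%:R * (del n * M).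
Proof.
elim: j => [|j ih]; first by rewrite add0n subrr normr0 mul0r.
rewrite addSn/= -[j.+1%:R]natr1 mulrDl mul1r.
have := scheme_step_dist n x (@iter_slope n (j + i)%N); move: ih.
move: (iter _ _ _ x) (iter _ _ _ x) (scheme_step _ _ x) => a b c.
rewrite !ler_norml; lra.
Qed.

Let u_time n (t s : R) x : 0 <= t -> 0 <= s -> `|u n t x - u n s x| <= M * (`|t - s| + del n).
Proof.
wlog st : s t / s <= t => [wl|] t0 s0.
  by have [st|/ltW st] := leP s t; [exact: wl|rewrite distrC [`|t - s|]distrC; exact: wl].
rewrite [`|t - s|]ger0_norm ?subr_ge0// /u.
have sd0 : 0 <= s / del n by rewrite divr_ge0// ltW.
have td0 : 0 <= t / del n by rewrite divr_ge0// ltW.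
have /andP[i1 i2] := truncn_itv sd0; have /andP[j1 j2] := truncn_itv td0.
move: (Num.trunc _) (Num.trunc _) i1 i2 j1 j2 => j i i1 i2 j1 j2.
have ij : (i <= j)%N.
  rewrite -ltnS -(ltr_nat R); apply: le_lt_trans i1 (le_lt_trans _ j2).
  by rewrite ler_pM2r ?invr_gt0.
rewrite -{1}(subnK ij); apply: le_trans (iter_dist _ _ _ _) _.
rewrite mulrA mulrC ler_wpM2l// natrB// mulrBl.
move: i2 j1; rewrite ler_pdivlMr// ltr_pdivrMr// -[i.+1%:R]natr1 mulrDl mul1r; lra.
Qed.

Let u_step n (t : R) x : del n <= t -> u n t x = u n (t - del n) x +
  del n * H (\row_k ((u n (t - del n) (x + eps n *: ei R k) - u n (t - del n) x) / eps n)).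
Proof.
move=> dt; rewrite /u.
have t1 : 0 <= (t - del n) / del n by rewrite divr_ge0 ?subr_ge0// ltW.
have -> : Num.trunc (t / del n) = (Num.trunc ((t - del n) / del n)).+1.
  apply: truncn_def; have /andP[h1 h2] := truncn_itv t1.
  move: h1 h2; rewrite mulrBl divff ?gt_eqF// => h1 h2.
  rewrite -[X in X <= _]natr1 -[X in _ < X]natr1; apply/andP; split; lra.
by [].
Qed.

(** Along an ultrafilter all bounded sequences converge, so the limits at
    uncountably many points can be taken without extracting subsequences. *)
Lemma ultra_cvg (G : set_system nat) (v : nat -> R) (B : R) : UltraFilter G ->
  (forall n, `|v n| <= B) -> exists l : R, v n @[n --> G] --> l.
Proof.
move=> GU vB; have GF : ProperFilter G := @ultra_proper _ _ GU.
have := segment_compact (a := - B) (b := B).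
have FG : (v n @[n --> G]) `[- B, B]%classic.
  by apply: (@filterE _ G) => n; rewrite /= in_itv/= -ler_norml; exact: vB.
move=> /(_ _ _ FG)[l [_ cl]]; exists l => A Al /=.
have [//|nA] := in_ultra_setVsetC (v @^-1` A) GU.
by have [x [/= ]] := cl (~` A) A nA Al.
Qed.

(** The iterates are uniformly Lipschitz in space, and in time up to [del n], so
    their pointwise limit along an ultrafilter is locally uniform. *)
Lemma scheme_solution : exists f : R -> 'rV[R]_d -> R,
  [/\ viscosity_solution H f, forall x, f 0 x = u0 x,
    exists2 C, 0 <= C & forall (t s : R) x, 0 <= t -> 0 <= s -> `|f t x - f s x| <= C * `|t - s| &
    forall (t : R) x h, 0 <= t -> f t (x + h) - f t x <= rho h].
Proof.
have [G [GU Goo]] := ultraFilterLemma (_ : ProperFilter \oo).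
have GF : ProperFilter G := @ultra_proper _ _ GU.
pose f t x := xget 0 [set l : R | u n t x @[n --> G] --> l].
have u_bound n (t : R) x : 0 <= t -> `|u n t x - u0 x| <= M * (t + 1).
  move=> t0; have := iter_dist n 0 (Num.trunc (t / del n)) x; rewrite addn0/=.
  move=> /le_trans; apply; rewrite mulrA mulrC ler_wpM2l//.
  have td0 : 0 <= t / del n by rewrite divr_ge0// ltW.
  have /andP[+ _] := truncn_itv td0; rewrite ler_pdivlMr//; lra.
have fP (t : R) x : 0 <= t -> u n t x @[n --> G] --> f t x.
  move=> t0; have uB n : `|u n t x| <= `|u0 x| + M * (t + 1).
    have := u_bound n t x t0; have := ler_norm (u0 x); have := ler_norm (- u0 x).
    by rewrite normrN !ler_norml; lra.
  by have [l ul] := ultra_cvg GU uB; rewrite /f; case: xgetP => // /(_ l).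
have fn (t : R) x e : 0 <= t -> 0 < e -> \forall n \near G, `|u n t x - f t x| < e.
  by move=> t0 e0; have /cvgrPdist_lt/(_ _ e0) := fP t x t0; apply: filterS => n; rewrite distrC.
have smallG (e : R) : 0 < e -> \forall n \near G, eps n < e /\ del n < e.
  by move=> e0; exact: Goo _ (small e0).
have f_time (t s : R) x : 0 <= t -> 0 <= s -> `|f t x - f s x| <= M * `|t - s|.
  move=> t0 s0; apply/ler_addgt0Pr => e e0.
  have e3 : 0 < e / 3 by rewrite divr_gt0.
  have eM : 0 < e / 3 / (M + 1) by rewrite divr_gt0// ltr_wpDl.
  have [n [n1 [n2 [_ n3]]]] := filter_ex (filterI (fn _ x _ t0 e3) (filterI (fn _ x _ s0 e3)
    (smallG _ eM))).
  have : M * del n <= e / 3.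
    apply: (@le_trans _ _ (del n * (M + 1))); first by rewrite mulrC ler_wpM2l ?lerDl// ltW.
    by rewrite -ler_pdivlMr ?ltr_wpDl// ltW.
  have := u_time n x t0 s0; move: n1 n2; rewrite mulrDr !ler_norml !ltr_norml.
  move: (M * `|_|) (M * del n) => a b; lra.
have f_space (t : R) x h : 0 <= t -> f t (x + h) - f t x <= rho h.
  move=> t0; apply/ler_addgt0Pr => e e0.
  have e2 : 0 < e / 2 by rewrite divr_gt0.
  have [n [n1 n2]] := filter_ex (filterI (fn _ (x + h) _ t0 e2) (fn _ x _ t0 e2)).
  have := @iter_slope n (Num.trunc (t / del n)) x h; rewrite -/(u n t (x + h)) -/(u n t x).
  by move: n1 n2; rewrite !ltr_norml; lra.
have f_slope (t : R) : 0 <= t -> bounded_slope (f t) by move=> t0 x h; exact: f_space.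
have f_lip (t s : R) x y : 0 <= t -> 0 <= s ->
    `|f t x - f s y| <= M * `|t - s| + L * `|x - y|.
  move=> t0 s0; rewrite -(subrKA (f s x)); apply: le_trans (ler_normD _ _) _.
  apply: lerD; first exact: f_time.
  by have := bounded_slope_lip y (x - y) (f_slope _ s0); rewrite subrKC.
have u_lip n (t s : R) x y : 0 <= t -> 0 <= s ->
    `|u n t x - u n s y| <= M * (`|t - s| + del n) + L * `|x - y|.
  move=> t0 s0; rewrite -(subrKA (u n s x)); apply: le_trans (ler_normD _ _) _.
  apply: lerD; first exact: u_time.
  have := bounded_slope_lip y (x - y) (@iter_slope n (Num.trunc (s / del n))).
  by rewrite subrKC.
have near_pair (p : V) (e : R) : 0 < e ->
    \forall p' \near p, `|p.1 - p'.1| < e /\ `|p.2 - p'.2| < e.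
  move=> e0; apply: filterI.
    by have /cvgrPdist_lt/(_ _ e0) : p'.1 @[p' --> p] --> p.1 by exact: cvg_fst.
  by have /cvgrPdist_lt/(_ _ e0) : p'.2 @[p' --> p] --> p.2 by exact: cvg_snd.
have ML0 : 0 < M + L + 1 by rewrite ltr_wpDl// addr_ge0.
have ML_small (e a b : R) : 0 <= a -> 0 <= b -> a < e / (M + L + 1) -> b < e / (M + L + 1) ->
    M * a + L * b <= e.
  move=> a0 b0 ae be; apply: (@le_trans _ _ (M * (e / (M + L + 1)) + L * (e / (M + L + 1)))).
    by apply: lerD; apply: ler_wpM2l => //; exact: ltW.
  rewrite -mulrDl mulrA ler_pdivrMr// mulrC ler_wpM2l ?lerDl//.
  apply: ltW; have := le_lt_trans a0 ae; rewrite pmulr_lgt0// invr_gt0//.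
(* equicontinuity and a near covering of the compact set *)
have unif : forall B : set V, compact B -> B `<=` @closed_domain R d ->
    forall e : R, 0 < e -> \forall n \near G, forall p, B p -> `|u n p.1 p.2 - f p.1 p.2| <= e.
  move=> B /compact_near_coveringP cB Bcl e e0.
  have e4 : 0 < e / 4 by rewrite divr_gt0.
  have e4M : 0 < e / 4 / (M + L + 1) by rewrite divr_gt0.
  have := cB nat G (fun n p => B p -> `|u n p.1 p.2 - f p.1 p.2| <= e) GF.
  have cover (p : V) : B p -> \forall p' \near p & n \near G,
      B p' -> `|u n p'.1 p'.2 - f p'.1 p'.2| <= e.
    move=> Bp; have [p1 _] := Bcl _ Bp.
    exists ([set p' | `|p.1 - p'.1| < e / 4 / (M + L + 1) /\ `|p.2 - p'.2| < e / 4 / (M + L + 1)],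
      [set n | `|u n p.1 p.2 - f p.1 p.2| < e / 4 /\
        (eps n < e / 4 / (M + L + 1) /\ del n < e / 4 / (M + L + 1))]).
      split; first exact: near_pair.
      by apply: filterI; [exact: fn|exact: smallG].
    move=> [p' n] [/= [h1 h2] [h3 [_ h4]]] Bp'.
    have [p'1 _] := Bcl _ Bp'.
    have := u_lip n p.1 p'.1 p.2 p'.2 p1 p'1; have := f_lip p.1 p'.1 p.2 p'.2 p1 p'1.
    have := ML_small _ _ _ (normr_ge0 (p.1 - p'.1)) (normr_ge0 (p.2 - p'.2)) h1 h2.
    have := ML_small _ _ _ (ltW (del0 n)) (lexx 0) h4 (lt_trans (del0 n) h4).
    move: h3; rewrite mulr0 addr0 mulrDr !ler_norml !ltr_norml.
    move: (M * `|_|) (L * `|_|) (M * del n) => a b c; lra.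
  move=> /(_ cover); apply: filterS => n nB p Bp; exact: nB.
exists f; split.
- split=> [|phi q phiS Dq].
    apply/subspace_continuousP => p [p1 p2]; apply/cvgrPdist_le => e e0.
    have eM : 0 < e / (M + L + 1) by rewrite divr_gt0.
    have := near_pair p _ eM; apply: filterS => p' [h1 h2] [p'1 p'2].
    apply: le_trans (f_lip _ _ _ _ p1 p'1) _.
    exact: ML_small (normr_ge0 _) (normr_ge0 _) h1 h2.
  exact: (scheme_viscosity GF eps0 del0 CFL smallG u_step unif).
- move=> x; apply/eqP; rewrite -subr_eq0 -normr_le0; apply/ler_addgt0Pr => e e0.
  have [n] := filter_ex (fn 0 x e (lexx 0) e0).
  have -> : u n 0 x = u0 x by rewrite /u mul0r truncn0.
  by rewrite add0r distrC => /ltW.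
- by exists M.
- exact: f_space.
Qed.

End existence.

(** * Well-posedness and Lipschitz constants *)
Lemma ereal_sup_bound (R : realType) (S : set (\bar R)) : (ereal_sup S < +oo)%E ->
  exists2 B : R, 0 <= B & forall z, S z -> (z <= B%:E)%E.
Proof.
move=> Soo; exists (Num.max (fine (ereal_sup S)) 0); first by rewrite le_max lexx orbT.
move=> z Sz; have : (z <= ereal_sup S)%E by exact: ereal_sup_ubound.
move: Soo; case: (ereal_sup S) => [s| |]//= _ zs; first last.
  by apply: le_trans zs _; rewrite leNye.
by apply: le_trans zs _; rewrite lee_fin le_max lexx.
Qed.

Section lipschitz_constant.
Variables (R : realType) (d : nat).
Implicit Types (x y : 'rV[R]_d) (h : 'rV[R]_d -> R) (L : R).

Lemma lip1_le h L : 0 <= L ->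
  (forall x y, orthant x -> orthant y -> `|h x - h y| <= L * norm1 (x - y)) ->
  (lip1 h <= L%:E)%E.
Proof.
move=> L0 hL; apply: ge_ereal_sup => _ [x [y [x0 y0 _ ->]]]; rewrite lee_fin.
have := norm1_ge0 (x - y); rewrite le_eqVlt => /orP[/eqP<-|n0]; first by rewrite invr0 mulr0.
by rewrite ler_pdivrMr//; exact: hL.
Qed.

Lemma lip1_slope h L x y : (lip1 h <= L%:E)%E -> orthant x -> orthant y ->
  `|h x - h y| <= L * norm1 (x - y).
Proof.
move=> hL x0 y0; have [->|xy] := eqVneq x y.
  by rewrite !subrr normr0 (_ : norm1 0 = 0) ?mulr0// -(scale0r y) norm1Z normr0 mul0r.
have n0 : 0 < norm1 (x - y).
  rewrite lt_def norm1_ge0 andbT; apply/eqP => n0; have := norm_le_norm1 (x - y).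
  by rewrite n0 mulr0 normr_le0 subr_eq0 (negbTE xy).
rewrite -ler_pdivrMr// -lee_fin; apply: le_trans hL; apply: ereal_sup_ubound.
by exists x, y.
Qed.

Lemma lip1_ge0 h : (0 < d)%N -> (0 <= lip1 h)%E.
Proof.
move=> d0; pose x : 'rV[R]_d := const_mx 1.
have xn : x != 0 by apply/eqP => /rowP/(_ (Ordinal d0))/eqP; rewrite !mxE oner_eq0.
apply: (@le_trans _ _ (`|h x - h 0| / norm1 (x - 0))%:E).
  by rewrite lee_fin divr_ge0// norm1_ge0.
apply: ereal_sup_ubound; exists x, 0; split => //; last exact: orthant0.
by move=> k; rewrite mxE.
Qed.

Lemma lip1_fin h : (0 < d)%N -> (lip1 h < +oo)%E ->
  exists2 L, 0 <= L & lip1 h = L%:E.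
Proof. by move=> /(lip1_ge0 h); case: (lip1 h) => // L L0 _; exists L. Qed.

End lipschitz_constant.

Section hamilton_jacobi.
Variables (R : realType) (d : nat).
Variables (H : 'rV[R]_d -> R) (CH : R).
Hypothesis CH0 : 0 <= CH.
Hypothesis H_mono : forall y y' : 'rV[R]_d, (forall k, y 0 k <= y' 0 k) -> H y <= H y'.
Hypothesis H_lip : forall y y', H y <= H y' + CH * `|y - y'|.

Lemma HJ_solution_lipschitz psi f : HJ_solution H psi f -> exists2 C, 0 <= C &
  (forall t x, 0 <= t -> orthant x -> `|f t x - f 0 x| <= C * t) /\
  (forall t x y, 0 <= t -> orthant x -> orthant y -> `|f t x - f t y| <= C * `|x - y|).
Proof.
move=> [_ [[_ /ereal_sup_bound[B B0 BP]] /ereal_sup_bound[B' B'0 B'P]] _].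
exists (Num.max B B'); first by rewrite le_max B0.
split=> [t x|t x y] t0 x0.
  move: t0; rewrite le_eqVlt => /orP[/eqP<-|t0]; first by rewrite subrr normr0 mulr0.
  have := BP (`|f t x - f 0 x| / t)%:E; rewrite lee_fin ler_pdivrMr// => /(_ _).
  move=> h; apply: (@le_trans _ _ (B * t)); first by apply: h; exists t, x.
  by rewrite ler_pM2r// le_max lexx.
move=> y0; apply: (@le_trans _ _ (B' * norm1 (x - y))).
  by apply: lip1_slope => //; apply: B'P; exists t.
by apply: ler_pM => //; rewrite ?norm1_ge0 ?norm1_le_norm// le_max lexx orbT.
Qed.

Lemma HJ_solution_le psi f f' : HJ_solution H psi f -> HJ_solution H psi f' ->
  forall (t : R) x, 0 <= t -> orthant x -> f t x <= f' t x.
Proof.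
move=> fS f'S t x; have [C C0 [ft fx]] := HJ_solution_lipschitz fS.
have [C' C'0 [f't f'x]] := HJ_solution_lipschitz f'S.
have [[fc fv] _ f0] := fS; have [[f'c f'v] _ f'0] := f'S.
have CD : 0 <= C + C' by exact: addr_ge0.
apply: (@comparison R d H CH CH0 H_mono H_lip f f' (C + C') CD fc f'c).
- by move=> phi q phiS Dq fm; have [] := fv phi q phiS Dq; auto.
- by move=> phi q phiS Dq fm; have [] := f'v phi q phiS Dq; auto.
- move=> s y s0 y0; apply: le_trans (ft _ _ s0 y0) _; by rewrite ler_wpM2r// lerDl.
- move=> s y s0 y0; apply: le_trans (f't _ _ s0 y0) _; by rewrite ler_wpM2r// lerDr.
- move=> s y z s0 y0 z0; apply: le_trans (fx _ _ _ s0 y0 z0) _; by rewrite ler_wpM2r// lerDl.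
- move=> s y z s0 y0 z0; apply: le_trans (f'x _ _ _ s0 y0 z0) _; by rewrite ler_wpM2r// lerDr.
- by move=> y y0; rewrite f0// f'0.
Qed.

Lemma HJ_solution_unique psi f f' : HJ_solution H psi f -> HJ_solution H psi f' ->
  forall (t : R) x, 0 <= t -> orthant x -> f' t x = f t x.
Proof.
move=> fS f'S t x t0 x0; apply/eqP; rewrite eq_le.
by rewrite (HJ_solution_le fS f'S)// (HJ_solution_le f'S fS).
Qed.

(** The extension of the initial condition to the whole space makes the scheme
    meet no boundary. *)
Lemma HJ_solution_exists (rho psi : 'rV[R]_d -> R) (L : R) : 0 <= L ->
  (forall h h', rho (h + h') <= rho h + rho h') -> rho 0 = 0 ->
  (forall h, rho h <= L * `|h|) ->
  (forall x y, orthant x -> orthant y -> psi x - psi y <= rho (x - y)) ->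
  exists2 f, HJ_solution H psi f & forall t x h, 0 <= t -> f t (x + h) - f t x <= rho h.
Proof.
move=> L0 rhoD rho0 rhoL psi_rho.
have u0_rho := mcshane_rho rhoD psi_rho (@orthant0 R d).
have u0E := mcshaneE rhoD rho0 psi_rho (@orthant0 R d).
have [f [fv f0 [C C0 ft] fx]] := scheme_solution CH0 H_mono H_lip L0 rhoL u0_rho.
exists f => //.
have lipf t : 0 <= t -> (lip1 (f t) <= (L * d%:R)%:E)%E.
  move=> t0; apply: lip1_le => [|x y _ _]; first exact: mulr_ge0.
  apply: le_trans (rho_lipschitz rhoL (fun x h => fx t x h t0) x y) _.
  by rewrite -mulrA ler_wpM2l// norm_le_norm1.
split => //; last by move=> x x0; rewrite f0 u0E.
split; first split.
- by apply: le_lt_trans (lipf 0 (lexx 0)) _; rewrite ltry.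
- apply: (@le_lt_trans _ _ C%:E); last by rewrite ltry.
  apply: ge_ereal_sup => _ [t [x [t0 _ ->]]]; rewrite lee_fin ler_pdivrMr//.
  by have := ft t 0 x (ltW t0) (lexx 0); rewrite subr0 [`|t|]gtr0_norm.
- apply: (@le_lt_trans _ _ (L * d%:R)%:E); last by rewrite ltry.
  by apply: ge_ereal_sup => _ [t t0 <-]; exact: lipf.
Qed.

End hamilton_jacobi.

(** * The discretized functional *)
Section discretized_functional.
Variables (R : realType) (K : nat) (psi : Mplus R -> R).
Local Notation V := 'rV[R]_(dimK K).
Implicit Types (x y : V).

Lemma mu_xE x A : orthant x -> mu_x x A =
  ((dimK K)%:R^-1 * \sum_k x 0 k * (dyadic_pt R k \in A)%:R)%:E.
Proof.
move=> x0; rewrite /mu_x EFinM -sumEFin; congr (_ * _)%E; apply: eq_bigr => k _.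
by rewrite EFinM max_l ?x0// /dirac/= indicE.
Qed.

Lemma mu_x_dist x y A : orthant x -> orthant y ->
  `|fine (mu_x x A) - fine (mu_x y A)| <= norm1 (x - y).
Proof.
move=> x0 y0; rewrite !mu_xE//= -mulrBr normrM ger0_norm ?invr_ge0// ler_wpM2l ?invr_ge0//.
rewrite -sumrB; apply: le_trans (ler_norm_sum _ _ _) _; apply: ler_sum => k _.
by rewrite !mxE -mulrBl normrM ler_piMr// normr_nat; case: (_ \in _).
Qed.

Lemma TV_le_norm1 x y : orthant x -> orthant y -> TV (mu_x x) (mu_x y) <= norm1 (x - y).
Proof.
move=> x0 y0; apply: ge_sup => [|_ [A _ <-]]; last exact: mu_x_dist.
by exists `|fine (mu_x x set0) - fine (mu_x y set0)|, set0.
Qed.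

Lemma TV_ge x y A : orthant x -> orthant y -> measurable A ->
  `|fine (mu_x x A) - fine (mu_x y A)| <= TV (mu_x x) (mu_x y).
Proof.
move=> x0 y0 mA; apply: ub_le_sup; last by exists A.
by exists (norm1 (x - y)) => _ [B _ <-]; exact: mu_x_dist.
Qed.

(** Two measures at positive distance are needed, as the supremum of the empty
    set is [-oo]. *)
Lemma lipTV_ge0 : (0 <= lipTV psi)%E.
Proof.
pose x : V := const_mx 1.
have x0 : orthant x by move=> k; rewrite mxE.
have TV1 : 1 <= TV (mu_x x) (mu_x (0 : V)).
  have := TV_ge x0 (@orthant0 R _) measurableT; rewrite !mu_xE//=; last exact: orthant0.
  rewrite [X in _ - _ * X]big1 => [|k _]; last by rewrite mxE mul0r.
  rewrite (eq_bigr (fun=> 1)) => [|k _]; last by rewrite mxE in_setT mul1r.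
  by rewrite sumr_const card_ord mulr0 subr0 mulVf ?normr1// pnatr_eq0 -lt0n dimK_gt0.
have TV0 : 0 < TV (mu_x x) (mu_x (0 : V)) by apply: lt_le_trans TV1.
apply: (@le_trans _ _ (`|psi (mu_x x) - psi (mu_x (0 : V))| / TV (mu_x x) (mu_x (0 : V)))%:E).
  by rewrite lee_fin divr_ge0// ltW.
by apply: ereal_sup_ubound; exists (mu_x x), (mu_x (0 : V)); rewrite gt_eqF.
Qed.

Lemma lip1_psiK : lipschitzTV psi -> (lip1 (psiK (K := K) psi) <= lipTV psi)%E.
Proof.
move=> [psi_oo psiP]; move: psi_oo psiP lipTV_ge0; case: (lipTV psi) => // l _ psiP l0.
apply: lip1_le => // x y x0 y0; have := psiP (mu_x x) (mu_x y); rewrite lee_fin.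
by move=> /le_trans; apply; rewrite ler_wpM2l//; exact: TV_le_norm1.
Qed.

End discretized_functional.

(** * Gradient and Lipschitz constant of the solution *)
Section solution_properties.
Variables (R : realType) (d : nat).

(** The bound on increments makes [u] Lipschitz, hence differentiable almost
    everywhere. *)
Lemma gradient_in_slope (S : set 'rV[R]_d) (C : R) (u : 'rV[R]_d -> R) : (0 < d)%N -> 0 <= C ->
  S !=set0 -> (forall q, S q -> \sum_k `|q 0 k| <= C) -> compact S ->
  (forall q q' (t : R), S q -> S q' -> 0 <= t <= 1 -> S (q + t *: (q' - q))) ->
  (forall x h, u (x + h) - u x <= support_fun S h) -> gradient_in u S.
Proof.
move=> d0 C0 S0 SC cS convS uS.
have uL := rho_lipschitz (support_le_norm S0 SC) uS.
have [N N0 Ndiff] := rademacher C0 uL d0.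
move=> e e0; have [l [v [lv Nlv Ve]]] := N0 e e0.
exists l, v; split => // x [_ nx]; apply: Nlv; apply: contrapT => /Ndiff ux.
by apply: nx; split => //; exact: (gradient_mem S0 SC).
Qed.

(** The Lipschitz constants at positive times bound the initial one by
    continuity at time [0]. *)
Lemma lip1_initial H (psi : 'rV[R]_d -> R) f (L : R) : (0 < d)%N -> 0 <= L ->
  HJ_solution H psi f -> lip1 psi = L%:E -> (forall t, 0 <= t -> (lip1 (f t) <= L%:E)%E) ->
  ereal_sup [set lip1 (f t) | t in [set t : R | 0 < t]] = lip1 psi.
Proof.
move=> d0 L0 fS psiL lipf; set s := ereal_sup _.
have sL : (s <= L%:E)%E by apply: ge_ereal_sup => _ [t t0 <-]; apply: lipf; exact: ltW.
have s0 : (0 <= s)%E.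
  by apply: le_trans (lip1_ge0 (f 1) d0) _; apply: ereal_sup_ubound; exists 1 => //=.
apply/eqP; rewrite eq_le {1}psiL sL/=.
have sP t : 0 < t -> (lip1 (f t) <= s)%E by move=> t0; apply: ereal_sup_ubound; exists t.
move: s s0 sL sP => [s| |]//; rewrite !lee_fin => s0 _ sP.
have [C C0 [ft _]] := HJ_solution_lipschitz fS; have [_ _ f0] := fS.
apply: lip1_le => // x y x0 y0; rewrite -!f0//; apply/ler_addgt0Pr => e e0.
pose t := e / (2 * C + 1).
have C21 : 0 < 2 * C + 1 by rewrite ltr_wpDl// mulr_ge0.
have t0 : 0 < t by rewrite divr_gt0.
have tE : t * (2 * C + 1) = e by rewrite divfK// gt_eqF.
have := lip1_slope (sP t t0) x0 y0; have := ft t x (ltW t0) x0; have := ft t y (ltW t0) y0.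
rewrite !ler_norml; lra.
Qed.

End solution_properties.

Unset Implicit Arguments.
Set Strict Implicit.
Set Printing Implicit Defensive.

Theorem theorem1p1 (R : realType) (g : R -> R) (psi : Mplus R -> R) (m a : R)
    (g_C1 : C1_on11 g)
    (m_gt0 : 0 < m) (g_ge : forall x : R, -1 <= x <= 1 -> m <= g x)
    (psi_lip : lipschitzTV psi)
    (a_gt0 : 0 < a)
    (psi_grad : forall K : nat, (1 <= K)%N ->
      gradient_in (psiK (K := K) psi) (calK' g a))
    (K : nat) (K_ge1 : (1 <= K)%N) (r : R) (r_gt0 : 0 < r) :
  exists f : R -> 'rV[R]_(dimK K) -> R,
    [/\ HJ_solution (HK g m r) (psiK (K := K) psi) f,
        forall f' : R -> 'rV[R]_(dimK K) -> R,
          HJ_solution (HK g m r) (psiK (K := K) psi) f' ->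
          forall (t : R) x, 0 <= t -> orthant x -> f' t x = f t x,
        forall t : R, 0 <= t -> gradient_in (f t) (calK' g a),
        ereal_sup [set lip1 (f t) | t in [set t : R | 0 < t]] =
          lip1 (psiK (K := K) psi) &
        (lip1 (psiK (K := K) psi) <= lipTV psi)%E].
Proof.
have d0 := dimK_gt0 K.
have H_mono := @HK_nondecreasing R K g m m_gt0 g_ge r r_gt0.
have [CH CH0 H_lip] := HK_lipschitz K m_gt0 g_ge r_gt0.
have lip_psi := lip1_psiK K psi_lip.
have [L L0 LE] := lip1_fin d0 (le_lt_trans lip_psi psi_lip.1).
have psi_norm1 x y : orthant x -> orthant y ->
    `|psiK (K := K) psi x - psiK (K := K) psi y| <= L * norm1 (x - y).
  by apply: lip1_slope; rewrite LE.
have S0 := calK'_nonempty K g a_gt0.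
have [C SC] := calK'_bounded K g a.
have C0 : 0 <= C by have [q /SC] := S0; apply: le_trans; exact: sumr_ge0.
have psi_support := increment_le_support d0 L0 (fun x y x0 y0 => le_trans (psi_norm1 x y x0 y0)
  (ler_wpM2l L0 (norm1_le_norm (x - y)))) S0 SC (psi_grad K K_ge1).
have [f fS f_slope] := HJ_solution_exists CH0 H_mono H_lip C0 (supportD S0 SC) (support0 S0 SC)
  (support_le_norm S0 SC) psi_support.
have [f2 f2S f2_slope] : exists2 f2, HJ_solution (HK g m r) (psiK (K := K) psi) f2 &
    forall t x h, 0 <= t -> f2 t (x + h) - f2 t x <= L * norm1 h.
  apply: (HJ_solution_exists CH0 H_mono H_lip L0).
  - by move=> h h'; rewrite -mulrDr ler_wpM2l// norm1D.
  - by rewrite -(scale0r 0) norm1Z normr0 mul0r mulr0.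
  - by move=> h; rewrite ler_wpM2l// norm1_le_norm.
  - by move=> x y x0 y0; apply: le_trans (ler_norm _) _; exact: psi_norm1.
have ff2 := HJ_solution_unique CH0 H_mono H_lip f2S fS.
exists f; split => //.
- by move=> f' f'S; exact: (HJ_solution_unique CH0 H_mono H_lip fS f'S).
- move=> t t0; apply: (gradient_in_slope d0 C0 S0 SC) => [||x h]; last exact: f_slope.
    exact: calK'_compact.
  by move=> q q' s; exact: calK'_convex.
- apply: (lip1_initial d0 L0 fS LE) => t t0; apply: lip1_le => // x y x0 y0.
  rewrite !ff2// ler_norml; have := f2_slope t x (y - x) t0; have := f2_slope t y (x - y) t0.
  have -> : norm1 (y - x) = norm1 (x - y) by rewrite -opprB -scaleN1r norm1Z normrN1 mul1r.
  rewrite !subrKC; lra.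
Qed.
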